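(* Let $\lambda\in(0,\infty)$ and suppose that the random variable $\alpha$ with values in $(0,1)$ has a probability density of the form $\psi(x)(1-x)^{\beta}$, $x\in(0,1)$, where $\psi$ is a function on $(0,1)$ having a limit $\lim_{x\uparrow 1}\psi(x)=\psi_1\in(0,\infty)$. Let $\widetilde S^{(N,n)}$ be the doubly aggregated, conditionally centered partial sum process of independent copies of the randomized INAR(1) process with Poisson innovations (defined in the context). If $\beta=0$, then $$\mathcal D_{\mathrm f}\text{-}\lim_{n\to\infty}\ \mathcal D_{\mathrm f}\text{-}\lim_{N\to\infty}\ n^{-1}(N\log N)^{-\frac12}\,\widetilde S^{(N,n)}=(W_{\lambda\psi_1}\,t)_{t\in[0,\infty)},$$ where $W_{\lambda\psi_1}$ is a normally distributed random variable with mean zero and variance $\lambda\psi_1$.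
   Context: Randomized INAR(1) process: let $\lambda\in(0,\infty)$ and let $\alpha$ be a random variable with values in $(0,1)$. Let $X_0$, $\xi_{k,j}$, $\varepsilon_k$ ($k,j\in\mathbb N=\{1,2,\dots\}$) be random variables which are conditionally independent given $\alpha$ and such that, conditionally on $\alpha$, each $\xi_{k,j}$ is Bernoulli with $\mathbb P(\xi_{k,j}=1\mid\alpha)=\alpha=1-\mathbb P(\xi_{k,j}=0\mid\alpha)$, each $\varepsilon_k$ is Poisson with parameter $\lambda$, and $X_0$ is Poisson with parameter $\lambda/(1-\alpha)$. Define $X_k=\sum_{j=1}^{X_{k-1}}\xi_{k,j}+\varepsilon_k$, $k\in\mathbb N$ (with $\sum_{j=1}^0:=0$). Let $(\alpha^{(j)},(X^{(j)}_k)_{k\in\mathbb Z_+})$, $j\in\mathbb N$, be independent copies of $(\alpha,(X_k)_{k\in\mathbb Z_+})$, where $\mathbb Z_+=\{0,1,2,\dots\}$. Conditional expectations are in the generalized sense, and $\mathbb E(X_k\mid\alpha)=\lambda/(1-\alpha)$. For $N,n\in\mathbb N$ set $\widetilde S^{(N,n)}_t:=\sum_{j=1}^N\sum_{k=1}^{\lfloor nt\rfloor}\bigl(X^{(j)}_k-\mathbb E(X^{(j)}_k\mid\alpha^{(j)})\bigr)=\sum_{j=1}^N\sum_{k=1}^{\lfloor nt\rfloor}\bigl(X^{(j)}_k-\frac{\lambda}{1-\alpha^{(j)}}\bigr)$, $t\in[0,\infty)$. $\mathcal D_{\mathrm f}\text{-}\lim$ denotes weak convergence of finite dimensional distributions.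 An iterated limit $\mathcal D_{\mathrm f}\text{-}\lim_{n\to\infty}\mathcal D_{\mathrm f}\text{-}\lim_{N\to\infty}$ means: for each fixed $n$ the limit in finite dimensional distributions as $N\to\infty$ exists, and then these limit processes converge in finite dimensional distributions as $n\to\infty$ to the stated process. *)

(* Defs.v *)
From mathcomp Require Export all_boot all_order all_algebra.
From mathcomp Require Export all_classical all_reals all_analysis.
Export numFieldNormedType.Exports.

Set Implicit Arguments.
Unset Strict Implicit.
Unset Printing Implicit Defensive.

Import Order.TTheory GRing.Theory Num.Theory.

#[global] Open Scope classical_set_scope.
#[global] Open Scope ring_scope.

(* [M] is a version of E(Y | A) for a nonnegative [Y], in the generalized sense:
   [Y] is not assumed to be integrable, both integrals may be infinite. *)
Definition is_cond_expectation {d} {T : measurableType d} {R : realType}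
    (P : probability T R) (A Y M : T -> R) : Prop :=
  [/\ measurable_fun [set: g_sigma_algebra_preimageType A] M,
      {ae P, forall w, 0 <= M w} &
      forall B : set R, measurable B ->
        (\int[P]_(w in A @^-1` B) (Y w)%:E =
         \int[P]_(w in A @^-1` B) (M w)%:E)%E ].

Definition is_cond_probability {d} {T : measurableType d} {R : realType}
    (P : probability T R) (A : T -> R) (E : set T) (M : T -> R) : Prop :=
  is_cond_expectation P A (\1_E) M.

Definition cond_independent {d} {T : measurableType d} {R : realType}
    (P : probability T R) (A : T -> R) (I : eqType) (Y : I -> T -> nat) : Prop :=
  forall (s : seq I) (B : I -> set nat) (M : I -> T -> R),
    uniq s ->
    (forall i, i \in s -> is_cond_probability P A (Y i @^-1` B i) (M i)) ->
    is_cond_probability P A (\bigcap_(i in [set` s]) (Y i @^-1` B i))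
      (fun w => \prod_(i <- s) M i w).

Definition has_density_on {d} {T : measurableType d} {R : realType}
    (P : probability T R) (A : T -> R) (D : set R) (f : R -> R) : Prop :=
  [/\ measurable_fun D f,
      forall x, D x -> 0 <= f x &
      forall B : set R, measurable B ->
        (P (A @^-1` B) = \int[lebesgue_measure]_(x in B `&` D) (f x)%:E)%E ].

Definition same_law {d d1 d2} {S : measurableType d}
    {T1 : measurableType d1} {T2 : measurableType d2} {R : realType}
    (P1 : probability T1 R) (V1 : T1 -> S)
    (P2 : probability T2 R) (V2 : T2 -> S) : Prop :=
  forall D : set S, measurable D -> P1 (V1 @^-1` D) = P2 (V2 @^-1` D).

Definition mutually_independent {d d1} {S : measurableType d1}
    {T : measurableType d} {R : realType} (P : probability T R)
    (I : eqType) (V : I -> T -> S) : Prop :=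
  forall (s : seq I) (D : I -> set S),
    uniq s -> (forall i, measurable (D i)) ->
    P (\bigcap_(i in [set` s]) (V i @^-1` D i)) =
    (\prod_(i <- s) P (V i @^-1` D i))%E.

(* The index type collects X_0 ([None]), the thinning variables xi_{k,j} and
   the innovations eps_k. The indices k, j = 1, 2, ...
   are shifted by one: [xi k j] is xi_{k+1,j+1} and [eps k] is eps_{k+1}. *)
Definition inar1_inputs {T : Type} (X0 : T -> nat) (xi : nat -> nat -> T -> nat)
    (eps : nat -> T -> nat) (i : option (nat * nat + nat)) : T -> nat :=
  match i with
  | None => X0
  | Some (inl (k, j)) => xi k j
  | Some (inr k) => eps k
  end.

Fixpoint inar1 {T : Type} (X0 : T -> nat) (xi : nat -> nat -> T -> nat)
    (eps : nat -> T -> nat) (k : nat) (w : T) : nat :=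
  if k is k'.+1 then
    (\sum_(j < inar1 X0 xi eps k' w) xi k' j w + eps k' w)%N
  else X0 w.

Record randomized_inar1_inputs {d} {T : measurableType d} {R : realType}
    (P : probability T R) (lambda : R) (alpha : {RV P >-> R})
    (X0 : {RV P >-> nat}) (xi : nat -> nat -> {RV P >-> nat})
    (eps : nat -> {RV P >-> nat}) : Prop := {
  inar1_alpha01 : forall w, 0 < alpha w < 1;
  inar1_indep :
    cond_independent P alpha (inar1_inputs X0 (fun k j => xi k j) eps);
  inar1_xi1 : forall k j,
    is_cond_probability P alpha (xi k j @^-1` [set 1%N]) alpha;
  inar1_xi0 : forall k j,
    is_cond_probability P alpha (xi k j @^-1` [set 0%N]) (fun w => 1 - alpha w);
  inar1_eps : forall k i,
    is_cond_probability P alpha (eps k @^-1` [set i])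
      (fun=> poisson_pmf lambda i);
  inar1_X0 : forall i,
    is_cond_probability P alpha (X0 @^-1` [set i])
      (fun w => poisson_pmf (lambda / (1 - alpha w)) i) }.

Definition cylinders : set (set (nat -> nat)) :=
  [set D | exists k (B : set nat), D = [set x | B (x k)]].

Definition coef_trajectory {T : Type} {R : realType} (alpha : T -> R)
    (X : nat -> T -> nat) (w : T) : R * g_sigma_algebraType cylinders :=
  (alpha w, fun k => X k w).

(* The copies j = 1, ..., N are numbered 0, ..., N - 1, and [M j k] stands for
   E(X^(j)_k | alpha^(j)). *)
Definition aggregated {T : Type} {R : realType} (X : nat -> nat -> T -> nat)
    (M : nat -> nat -> T -> R) (N n : nat) (t : {nonneg R}) (w : T) : R :=
  \sum_(j < N) \sum_(1 <= k < (Num.truncn (n%:R * t%:num)).+1)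
    ((X j k w)%:R - M j k w).

(* The processes may live on different probability spaces. *)
Definition fdd_cvg {R : realType}
    (d : nat -> measure_display) (T : forall k, measurableType (d k))
    (P : forall k, probability (T k) R) (Y : forall k, {nonneg R} -> T k -> R)
    (d' : measure_display) (T' : measurableType d')
    (P' : probability T' R) (Y' : {nonneg R} -> T' -> R) : Prop :=
  forall (m : nat) (t : 'I_m -> {nonneg R}) (f : 'rV[R]_m -> R),
    continuous f -> (exists C, forall x, `|f x| <= C) ->
    'E_(P k)[fun w => f (\row_i Y k (t i) w)]%E @[k --> \oo] -->
    'E_P'[fun w => f (\row_i Y' (t i) w)]%E.

(* D_f-lim_{n -> oo} D_f-lim_{N -> oo} Y N n = Y', over n = 1, 2, ... *)
Definition iterated_fdd_lim {R : realType}
    (d : measure_display) (T : measurableType d) (P : probability T R)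
    (Y : nat -> nat -> {nonneg R} -> T -> R)
    (d' : measure_display) (T' : measurableType d')
    (P' : probability T' R) (Y' : {nonneg R} -> T' -> R) : Prop :=
  exists (dZ : nat -> measure_display) (TZ : forall n, measurableType (dZ n))
         (Q : forall n, probability (TZ n) R)
         (Z : forall n, {nonneg R} -> {RV (Q n) >-> R}),
    (forall n, (0 < n)%N ->
       fdd_cvg (fun=> P) (fun N => Y N n) (Q n) (fun t => Z n t)) /\
    fdd_cvg Q (fun n t => Z n t) P' Y'.

(* Main.v *)
From HB Require Import structures.
Require Import Defs.
From mathcomp Require Import ring lra measurable_realfun.

Set Implicit Arguments.
Unset Strict Implicit.
Unset Printing Implicit Defensive.

Import Order.TTheory GRing.Theory Num.Theory.

(** Write rate(a) = lambda / (1 - a).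

    The INAR(1) chain is stationary given alpha: thinning a Poisson(rate(a))
    population with survival probability a leaves Poisson(a rate(a))
    individuals, and adding Poisson(lambda) immigrants restores
    Poisson(rate(a)), since a rate(a) + lambda = rate(a)
    ([inar_stationary]).  Hence E(X_k | alpha) = rate(alpha), whose mean is
    infinite because the density of alpha is close to psi1 near 1: it is the
    copies with alpha near 1 that produce the normalization (N log N)^(1/2).

    Time plays almost no role.  The number of deaths in one step has law
    Poisson((1 - a) rate(a)) = Poisson(lambda), the same as the number of
    immigrants, so X_(k+1) - X_k is, almost surely, a difference of two
    Poisson(lambda) variables and is square integrable although X_k is not even
    integrable ([inar_increment]).  For fixed k the sum over N independent
    copies of X_k - X_0 is thus of order N^(1/2), negligible against
    (N log N)^(1/2), and S_t behaves like floor(n t) times the single sum U of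
    the X_0 - rate(alpha) over the N copies.  After division by n the limit in
    N is W floor(n t) / n, and the limit in n is W t.

    It remains to see that U / (N log N)^(1/2) is asymptotically normal with
    variance lambda psi1.  Drop the copies with alpha > 1 - delta, where
    delta = 1 / (b N): for large N one of them occurs with probability at
    most (psi1 + 1) / b ([tail_prob]), and b is arbitrary.  The remaining summands
    have mean 0 and variance E(rate(alpha); alpha <= 1 - delta), equivalent to
    lambda psi1 log N ([trunc_mean_cvg]) because 1 / (1 - x) integrates to a
    logarithm.  As rate(alpha) <= lambda b N on the truncation event, their
    fourth moments are O(N log N), so that the normalized fourth moments add
    up to O(1 / log N).  This is a Lyapunov condition, and the central
    limit theorem [clt_array] applies.  The latter is proved by Stein's method:
    the solution of s^2 f' - x f = h - E h(Z) has a bounded continuous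
    derivative, and expanding f around the sum without its i-th term bounds
    E(s^2 f'(S) - S f(S)). *)

(** * Independence *)

Section independence.
Context {d} {T : measurableType d} {R : realType} (P : probability T R).

Definition indep2 d1 d2 (S1 : measurableType d1) (S2 : measurableType d2)
    (U : T -> S1) (V : T -> S2) : Prop :=
  forall A B, measurable A -> measurable B ->
    P (U @^-1` A `&` V @^-1` B) = (P (U @^-1` A) * P (V @^-1` B))%E.

Lemma measurable_preimage d1 (S1 : measurableType d1) (U : T -> S1) A :
  measurable_fun setT U -> measurable A -> measurable (U @^-1` A).
Proof. by move=> mU mA; rewrite -[X in measurable X]setTI; exact: mU. Qed.

Lemma indep2_comp d1 d2 d3 d4 (S1 : measurableType d1) (S2 : measurableType d2)
    (S3 : measurableType d3) (S4 : measurableType d4)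
    (U : T -> S1) (V : T -> S2) (g : S1 -> S3) (h : S2 -> S4) :
  measurable_fun setT g -> measurable_fun setT h ->
  indep2 U V -> indep2 (g \o U) (h \o V).
Proof.
move=> mg mh UV A B mA mB; apply: (UV (g @^-1` A) (h @^-1` B)).
- by rewrite -[X in measurable X]setTI; exact: mg.
- by rewrite -[X in measurable X]setTI; exact: mh.
Qed.

(** Both sides are finite measures in C, so it is enough to compare them on
    rectangles, which form a pi-system. *)
Lemma pair_indep_event d1 d2 (S1 : measurableType d1) (S2 : measurableType d2)
    (U : T -> S1) (V : T -> S2) (E : set T) :
  measurable_fun setT U -> measurable_fun setT V -> measurable E ->
  (forall A B, measurable A -> measurable B ->
     P (U @^-1` A `&` V @^-1` B `&` E) =
     (P (U @^-1` A `&` V @^-1` B) * P E)%E) ->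
  forall C, measurable C ->
    P ((fun w => (U w, V w)) @^-1` C `&` E) =
    (P ((fun w => (U w, V w)) @^-1` C) * P E)%E.
Proof.
move=> mU mV mE H C mC.
have mUV := measurable_fun_pair mU mV.
pose UV : {mfun T >-> (S1 * S2)%type} :=
  HB.pack (fun w => (U w, V w)) (isMeasurableFun.Build _ _ _ _ _ mUV).
have PE0 : 0 <= fine (P E) by exact: fine_ge0.
pose m1_ : {measure set _ -> \bar R} := pushforward (mrestr P mE) UV.
pose m1 := m1_ mUV.
pose m2 : {measure set _ -> \bar R} := mscale (NngNum PE0) (distribution P UV).
pose G : set (set (S1 * S2)) :=
  [set C | exists A, measurable A /\ exists B, measurable B /\ C = A `*` B].
have : m1 C = m2 C.
  apply: (@measure_unique _ _ _ G (fun=> setT)) => //.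
  - rewrite measurable_prod_measurableType //; congr (<<s _ >>).
    rewrite predeqE; split => [[A mA [B mB <-]]|[A [mA [B [mB ->]]]]].
      by exists A; split => //; exists B.
    by exists A => //; exists B.
  - move=> /= _ _ [X1 [mX1 [X2 [mX2 ->]]]] [Y1 [mY1 [Y2 [mY2 ->]]]].
    rewrite -setXI; exists (X1 `&` Y1); split; first exact: measurableI.
    by exists (X2 `&` Y2); split => //; exact: measurableI.
  - by move=> _; exists setT; split => //; exists setT; split => //; rewrite setXTT.
  - by apply/seteqP; split => // x _; exists 0%N.
  - move=> _ [A [mA [B [mB ->]]]].
    have -> : m1 (A `*` B) = P (U @^-1` A `&` V @^-1` B `&` E) by [].
    have -> : m2 (A `*` B) =
      ((fine (P E))%:E * P (U @^-1` A `&` V @^-1` B))%E by [].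
    by rewrite H// fineK ?fin_num_measure// muleC.
  - move=> _; have -> : m1 setT = P (setT `&` E) by [].
    by rewrite setTI (le_lt_trans (probability_le1 _ _))// ltry.
have -> : m1 C = P ((fun w => (U w, V w)) @^-1` C `&` E) by [].
have -> : m2 C = ((fine (P E))%:E * P ((fun w => (U w, V w)) @^-1` C))%E by [].
by move=> ->; rewrite fineK ?fin_num_measure// muleC.
Qed.

(** The law of the pair is the product of the two laws, and Fubini's theorem
    factors the integral of z.1 * z.2. *)
Lemma expectation_indep (U V : T -> R) :
  measurable_fun setT U -> measurable_fun setT V -> indep2 U V ->
  P.-integrable setT (EFin \o U) -> P.-integrable setT (EFin \o V) ->
  P.-integrable setT (EFin \o (fun w => U w * V w)) /\
  \int[P]_w (U w * V w) = (\int[P]_w U w) * (\int[P]_w V w).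
Proof.
move=> mU mV UV iU iV.
pose U' : {mfun T >-> R} := HB.pack U (isMeasurableFun.Build _ _ _ _ _ mU).
pose V' : {mfun T >-> R} := HB.pack V (isMeasurableFun.Build _ _ _ _ _ mV).
have mUV := measurable_fun_pair mU mV.
pose W : {mfun T >-> (R * R)%type} :=
  HB.pack (fun w => (U w, V w)) (isMeasurableFun.Build _ _ _ _ _ mUV).
pose m1 := distribution P U'. pose m2 := distribution P V'.
have E X : measurable X -> (m1 \x m2)%E X = distribution P W X.
  apply: product_measure_unique => A B mA mB.
  exact: UV.
pose f (z : R * R) := (z.1 * z.2)%:E.
have mf : measurable_fun setT f.
  apply/measurable_EFinP; apply: measurable_funM.
    exact: measurable_fst.
  exact: measurable_snd.
have i1 : m1.-integrable setT EFin.
  by apply: integrable_pushforward => //; exact: measurable_funTS.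
have i2 : m2.-integrable setT EFin.
  by apply: integrable_pushforward => //; exact: measurable_funTS.
have mnorm : measurable_fun [set: R] (fun x : R => `|x|%:E).
  by apply/measurable_EFinP; exact: normr_measurable.
have i12 : (m1 \x m2)%E.-integrable setT f.
  apply/(integrable12ltyP m1 m2 mf).
  rewrite [X in (X < _)%E](_ : _ =
      \int[m1]_x (`|x|%:E * \int[m2]_y `|y|%:E))%E.
    rewrite ge0_integralZr//=; last exact: integral_ge0.
    rewrite lte_mul_pinfty//.
    - exact: integral_ge0.
    - by apply: integrable_fin_num => //; exact: integrable_norm i1.
    - by case/integrableP : i2.
  apply: eq_integral => x _.
  rewrite -ge0_integralZl//=.
  by apply: eq_integral => y _; rewrite /f/= normrM.
have eqi g : (\int[m1 \x m2]_z g z = \int[distribution P W]_z g z)%E.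
  by apply: eq_measure_integral => A mA _; exact: E.
have iWf : P.-integrable setT (f \o W).
  apply/integrableP; split; first exact: measurableT_comp.
  rewrite -(ge0_integral_distribution W (f := abse \o f)).
  - by rewrite -eqi; case/integrableP : i12.
  - exact: measurableT_comp.
  - by move=> y; exact: abse_ge0.
split; first exact: iWf.
have -> : \int[P]_w (U w * V w) = fine (\int[distribution P W]_z f z)%E.
  by rewrite integral_distribution.
rewrite -eqi -(integral12_prod_meas1 i12) /fubini_F /f/=.
under eq_integral.
  move=> x _; under eq_integral do rewrite EFinM.
  rewrite integralZl//; over.
rewrite /= -(@fineK _ (\int[m2]_y y%:E)%E); last exact: integrable_fin_num.
rewrite integralZr// fineM//; last exact: integrable_fin_num.
congr (_ * _).
- by rewrite integral_distribution.
- by rewrite /= integral_distribution.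
Qed.

Section sums.
Context {d1} {S : measurableType d1}.
Variable V : nat -> T -> S.
Hypothesis mV : forall j, measurable_fun setT (V j).
Hypothesis indV : mutually_independent P V.

Let cyl (r : seq nat) (D : nat -> set S) : set T :=
  \bigcap_(i in [set` r]) (V i @^-1` D i).

Let mcyl r D : (forall i, measurable (D i)) -> measurable (cyl r D).
Proof.
move=> mD; apply: bigcap_measurableType => i _.
exact: measurable_preimage (mV i) (mD i).
Qed.

Let cyl_cons j r D B : j \notin r ->
  cyl (j :: r) (fun i => if i == j then B else D i) = V j @^-1` B `&` cyl r D.
Proof.
move=> jr; apply/seteqP; split => w /=.
  move=> H; split; first by have := H j; rewrite /= mem_head eqxx; exact.
  move=> i /= ir; have := H i; rewrite /= in_cons ir orbT => /(_ isT).
  by case: eqP => // ij; move: ir jr; rewrite ij => ->.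
move=> [wB H] i /=; rewrite in_cons; case: eqP => [-> //|_] /= ir.
exact: H.
Qed.

Let cyl1 j D : cyl [:: j] D = V j @^-1` D j.
Proof.
apply/seteqP; split => w /=; first by move=> H; apply: H; rewrite /= mem_head.
by move=> H i /=; rewrite mem_seq1 => /eqP ->.
Qed.

Let P_cyl_cons j r D B : uniq (j :: r) -> (forall i, measurable (D i)) ->
  measurable B ->
  P (V j @^-1` B `&` cyl r D) = (P (V j @^-1` B) * P (cyl r D))%E.
Proof.
move=> ujr mD mB; have /andP[jr ur] := ujr.
rewrite -cyl_cons// indV//; last by move=> i; case: ifP.
rewrite big_cons eqxx; congr (_ * _)%E; rewrite indV//.
rewrite [LHS]big_seq [RHS]big_seq; apply: eq_bigr => i ir.
by case: eqP => // ij; move: ir jr; rewrite -ij => ->.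
Qed.

Variable F : S -> R.
Hypothesis mF : measurable_fun setT F.

Lemma measurable_sum_comp (s : seq nat) :
  measurable_fun setT (fun w => \sum_(j <- s) F (V j w)).
Proof. by apply: measurable_sum => j; exact: measurableT_comp. Qed.

(** By induction on s, for all blocks r of untouched coordinates at once: the
    coordinate j that leaves the sum has to join the block. *)
Let indep_event_sum s r D : uniq (s ++ r) -> (forall i, measurable (D i)) ->
  forall A, measurable A ->
  P ((fun w => \sum_(j <- s) F (V j w)) @^-1` A `&` cyl r D) =
  (P ((fun w => (\sum_(j <- s) F (V j w))%R) @^-1` A) * P (cyl r D))%E.
Proof.
elim: s r D => [|j s IH] r D.
  move=> _ mD A mA.
  rewrite (_ : (fun w => _) = cst 0); last by apply/funext => w; rewrite big_nil.
  rewrite preimage_cst; case: ifPn => _.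
    by rewrite setTI probability_setT mul1e.
  by rewrite set0I measure0 mul0e.
rewrite /= mem_cat negb_or => /andP[/andP[js jr] usr] mD A mA.
pose U w := \sum_(j <- s) F (V j w).
have mU : measurable_fun setT U := measurable_sum_comp s.
have ujr : uniq (j :: r).
  by rewrite /= jr; move: usr; rewrite cat_uniq => /and3P[].
have usj : uniq (s ++ [:: j]) by rewrite cats1 rcons_uniq js; move: usr; rewrite cat_uniq => /andP[].
have usjr : uniq (s ++ j :: r).
  move: usr; rewrite !cat_uniq /= => /and3P[-> sr ->].
  by rewrite (negbTE js) /= sr jr.
pose C : set (R * S) := (fun z => z.1 + F z.2) @^-1` A.
have mC : measurable C.
  rewrite -[C]setTI; apply: (measurable_funD measurable_fst) => //.
  exact: measurableT_comp mF measurable_snd.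
have -> : (fun w => \sum_(i <- j :: s) F (V i w)) @^-1` A =
    (fun w => (U w, V j w)) @^-1` C.
  by apply/seteqP; split => w; rewrite /C /= big_cons addrC.
apply: pair_indep_event => //; first exact: mcyl.
move=> B1 B2 mB1 mB2; rewrite -setIA -cyl_cons// IH//; last by move=> i; case: ifP.
rewrite cyl_cons// P_cyl_cons// muleA; congr (_ * _)%E.
have := IH [:: j] (fun=> B2) usj (fun=> mB2) B1 mB1.
rewrite cyl1 => ->.
by [].
Qed.

(** The form of independence that Stein's method uses. *)
Lemma indep_leave_one_out i s : uniq s -> i \notin s ->
  indep2 (V i) (fun w => \sum_(j <- s) F (V j w)).
Proof.
move=> us is_ A B mA mB.
have usi : uniq (s ++ [:: i]) by rewrite cats1 rcons_uniq is_.
have := indep_event_sum usi (fun=> mA) mB.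
by rewrite cyl1 setIC muleC.
Qed.

End sums.

End independence.

(** * Stein's equation for the normal law *)

Section stein.
Context {R : realType}.
Notation leb := (@lebesgue_measure R).
Variable s : R.
Hypothesis s0 : 0 < s.
Local Notation phi := (normal_pdf 0 s).
Let sn0 : s != 0. Proof. by rewrite gt_eqF. Qed.

Let phiE x : phi x = normal_peak s * expR (- (x ^+ 2 / (s ^+ 2 *+ 2))).
Proof. by rewrite normal_pdfE// /normal_fun subr0 mulNr. Qed.

Let phi_gt0 x : 0 < phi x.
Proof. by rewrite phiE mulr_gt0 ?expR_gt0// normal_peak_gt0. Qed.

Let phiN x : phi (- x) = phi x.
Proof. by rewrite !phiE sqrrN. Qed.

#[local] Instance phi_derive (x : R) : is_derive x (1 : R) phi (- (x / s ^+ 2 * phi x)).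
Proof.
have -> : phi = fun y : R => normal_peak s * expR (- (y ^+ 2 / (s ^+ 2 *+ 2))).
  by apply/funext => y; rewrite phiE.
apply: is_derive_eq.
by rewrite /GRing.scale/=; field.
Qed.

Let phi_cont : continuous phi.
Proof. exact: continuous_normal_pdf. Qed.

Let phi_cvgy : phi x @[x --> +oo] --> (0 : R).
Proof.
have -> : phi = fun y : R => normal_peak s * expR (- (y ^+ 2 / (s ^+ 2 *+ 2))).
  by apply/funext => y; rewrite phiE.
rewrite -(mulr0 (normal_peak s)); apply: cvgMr.
apply/cvgr0Pnorm_le => e e0.
near=> x.
rewrite ger0_norm ?expR_ge0// expRN.
rewrite -[leRHS]invrK lef_pV2 ?posrE ?invr_gt0 ?expR_gt0//.
apply: le_trans (expR_ge1Dx _).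
have x1 : 1 <= x by near: x; apply: nbhs_pinfty_ge; exact: num_real.
have xe : e^-1 * (s ^+ 2 *+ 2) <= x by near: x; apply: nbhs_pinfty_ge; exact: num_real.
rewrite -lerBlDl ler_pdivlMr ?mulrn_wgt0 ?exprn_gt0//.
apply: (@le_trans _ _ x); last by rewrite expr2 ler_peMl// (le_trans ler01).
apply: le_trans xe; rewrite ler_wpM2r ?mulrn_wge0 ?sqr_ge0// lerBlDr lerDl//.
Unshelve. all: by end_near. Qed.

(** The Mills ratio bound: on the domain x <= t, and t phi(t) is the derivative
    of - s^2 phi(t). *)
Lemma gauss_tail x : 0 < x ->
  (x%:E * \int[leb]_(t in `[x, +oo[) (phi t)%:E <= (s ^+ 2 * phi x)%:E)%E.
Proof.
move=> x0.
have phi0 t : 0 <= phi t by exact/ltW.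
rewrite -ge0_integralZl//=; last 3 first.
- apply/measurable_EFinP/measurable_funTS; exact: measurable_normal_pdf.
- by move=> t _; rewrite lee_fin.
- by rewrite lee_fin ltW.
apply: (@le_trans _ _ (\int[leb]_(t in `[x, +oo[) (t * phi t)%:E)%E).
  apply: ge0_le_integral => //=.
  - by move=> t _; rewrite -EFinM lee_fin mulr_ge0// ltW.
  - apply/measurable_EFinP; apply: measurable_funM => //.
    by apply/measurable_funTS; exact: measurable_normal_pdf.
  - apply/measurable_EFinP; apply: measurable_funM => //.
    by apply/measurable_funTS; exact: measurable_normal_pdf.
  - move=> t; rewrite in_itv/= andbT => xt.
    by rewrite -EFinM lee_fin ler_wpM2r.
have D (t : R) : is_derive t (1 : R) (fun t => - (s ^+ 2 * phi t)) (t * phi t).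
  by apply: is_derive_eq; rewrite /GRing.scale/=; field.
rewrite (@ge0_continuous_FTC2y _ (fun t => t * phi t) (fun t => - (s ^+ 2 * phi t)) x 0).
- by rewrite sub0e -EFinN opprK.
- by move=> t xt; rewrite mulr_ge0// (le_trans (ltW x0)).
- apply: continuous_subspaceT => t; apply: cvgM => //; exact: phi_cont.
- rewrite [X in _ --> X](_ : 0 = - (s ^+ 2 * 0)); last by rewrite mulr0 oppr0.
  by apply: cvgN; apply: cvgM; [exact: cvg_cst|exact: phi_cvgy].
- by move=> t _; case: (D t).
- by apply: cvg_at_right_filter; apply: cvgN; apply: cvgM; [exact: cvg_cst|exact: phi_cont].
- by move=> t _; rewrite derive1E; apply: derive_val.
Qed.

(** The solution is f = G / (s^2 phi), with G the primitive of (h - m) phi that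
    vanishes at -oo and m the normal mean of h.  The equation gives f' as
    (h - m + x f) / s^2, so it is enough to bound x f.  There the Mills ratio
    is used, on the side of x that lies away from the origin: as (h - m) phi
    has total mass 0, G(x) is also minus its mass to the right of x. *)
Lemma stein_solution (h : R -> R) (C : R) :
  continuous h -> (forall x, `|h x| <= C) ->
  exists f f' : R -> R,
    [/\ forall x, is_derive x (1 : R) f (f' x),
       continuous f',
       forall x, `|f' x| <= C *+ 4 / s ^+ 2 &
       forall x, s ^+ 2 * f' x - x * f x =
         h x - \int[leb]_t (h t * phi t)].
Proof.
move=> ch hC.
have mphi D : measurable_fun D (normal_pdf 0 s).
  apply/measurable_funTS; exact: measurable_normal_pdf.
have mh D : measurable_fun D h.
  by apply/measurable_funTS; exact: continuous_measurable_fun.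
have iphi D : measurable D -> leb.-integrable D (EFin \o phi).
  move=> mD; apply: integrableS (integrable_normal_pdf 0 s) => //.
have C0 : 0 <= C by exact: le_trans (hC 0).
have ihphi D : measurable D -> leb.-integrable D (EFin \o (fun t => h t * phi t)).
  move=> mD; apply: (le_integrable mD _ _ (integrableZl mD C (iphi _ mD))).
  - by apply/measurable_EFinP; apply: measurable_funM; [exact: mh|exact: mphi].
  - move=> t _; rewrite /= lee_fin !normrM ler_wpM2r//.
    by rewrite (ger0_norm C0).
set m := \int[leb]_t (h t * phi t).
have mC : `|m| <= C.
  apply: le_trans (le_normr_Rintegral _ (ihphi _ measurableT)) _ => //.
  apply: (@le_trans _ _ (\int[leb]_t (C * phi t))).
    apply: le_Rintegral => //.
    - exact: integrable_norm (ihphi _ measurableT).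
    - exact: integrableZl (iphi _ measurableT).
    - by move=> t _; rewrite normrM (ger0_norm (ltW (phi_gt0 t))) ler_wpM2r// ltW.
  rewrite RintegralZl//; last exact: iphi.
  by rewrite /Rintegral integral_normal_pdf/= mulr1.
pose k t := h t - m.

have kC t : `|k t| <= C *+ 2.
  by rewrite mulr2n (le_trans (ler_normB _ _))// lerD.
have C20 : 0 <= C *+ 2 by rewrite mulrn_wge0.
have ck : continuous k by move=> t; apply: cvgB; [exact: ch|exact: cvg_cst].
pose q t := k t * phi t.
have iq D : measurable D -> leb.-integrable D (EFin \o q).
  move=> mD.
  rewrite (_ : q = fun t => h t * phi t - m * phi t); last first.
    by apply/funext => t; rewrite /q /k mulrBl.
  have := integrableB mD (ihphi _ mD) (integrableZl mD m (iphi _ mD)).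
  exact.
have cq : continuous q by move=> t; apply: cvgM; [exact: ck|exact: phi_cont].
have q0 : \int[leb]_t q t = 0.
  under eq_Rintegral do rewrite /q /k mulrBl.
  rewrite RintegralB//; last 2 first.
    exact: ihphi.
    exact: integrableZl (iphi _ measurableT).
  rewrite RintegralZl//; last exact: iphi.
  by rewrite {2}/Rintegral integral_normal_pdf/= mulr1 subrr.
pose G x := \int[leb]_(t in `]-oo, x]) q t.
have GD (x : R) : is_derive x (1 : R) G (q x).
  have xx1 : x < x + 1 by rewrite ltrDl.
  have [] := @continuous_FTC1 R q -oo%O x (x + 1) xx1 (iq _ (measurable_itv _)).
  - exact: ltNyr.
  - exact: cq.
  - by rewrite derive1E => ? ?; apply: DeriveDef.
have qC (D : set R) : measurable D ->
    `|\int[leb]_(t in D) q t| <= C *+ 2 * \int[leb]_(t in D) phi t.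
  move=> mD; rewrite -RintegralZl//; last exact: iphi.
  apply: le_trans (le_normr_Rintegral _ (iq _ mD)) _ => //.
  apply: le_Rintegral => //.
  - exact: integrable_norm (iq _ mD).
  - exact: integrableZl (iphi _ mD).
  - by move=> t _; rewrite normrM (ger0_norm (ltW (phi_gt0 t))) ler_wpM2r// ltW.
have tail x : 0 < x -> x * \int[leb]_(t in `[x, +oo[) phi t <= s ^+ 2 * phi x.
  move=> x0; rewrite -lee_fin EFinM /Rintegral fineK.
    exact: gauss_tail.
  exact: integrable_fin_num (iphi _ _).
have Gb x : `|x * G x| <= C *+ 2 * (s ^+ 2 * phi x).
  have [x0|x0|->] := ltgtP x 0; last 1 first.
  - by rewrite mul0r normr0 !mulr_ge0// ?sqr_ge0// ltW.
  - rewrite normrM (ltr0_norm x0).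
    apply: (@le_trans _ _ (- x * (C *+ 2 * \int[leb]_(t in `]-oo, x]) phi t))).
      by rewrite ler_wpM2l ?oppr_ge0 ?(ltW x0)//; exact: qC.
    rewrite mulrCA ler_wpM2l// -phiN.
    rewrite (_ : \int[leb]_(t in `]-oo, x]) phi t =
                 \int[leb]_(t in `[- x, +oo[) phi t).
      by apply: tail; rewrite oppr_gt0.
    congr fine; rewrite -{1}(opprK x) ge0_integration_by_substitutionNy.
    + by apply: eq_integral => t _ /=; rewrite phiN.
    + exact/continuous_subspaceT/phi_cont.
    + by move=> t _; exact/ltW.
  - rewrite normrM (gtr0_norm x0).
    have -> : G x = - \int[leb]_(t in `]x, +oo[) q t.
      rewrite -(Rintegral_itvB (a := -oo%O))//; last exact: iq.
      by rewrite set_itvNyy q0 sub0r opprK.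
    rewrite normrN Rintegral_itv_obnd_cbnd; last exact: iq.
    apply: (@le_trans _ _ (x * (C *+ 2 * \int[leb]_(t in `[x, +oo[) phi t))).
      by rewrite ler_wpM2l ?(ltW x0)//; exact: qC.
    by rewrite mulrCA ler_wpM2l// tail.
have s2 : s ^+ 2 != 0 by rewrite sqrf_eq0.
pose f x := G x / (s ^+ 2 * phi x).
pose f' x := (k x + x * f x) / s ^+ 2.
have phin0 x : phi x != 0 by rewrite gt_eqF.
have fD (x : R) : is_derive x (1 : R) f (f' x).
  have D1 : is_derive x (1 : R) (fun y => s ^+ 2 * phi y)
    (s ^+ 2 * - (x / s ^+ 2 * phi x)) by exact: is_deriveZ.
  have := is_deriveM (GD x) (@is_deriveV _ (fun y => s ^+ 2 * phi y) _ _ _ (mulf_neq0 s2 (phin0 x)) D1).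
  move=> D2; apply: (is_derive_eq (f := f) D2).
  rewrite /f' /f /q /GRing.scale/=; field.
  by rewrite sn0 phin0.
have fxC x : `|x * f x| <= C *+ 2.
  rewrite /f mulrA normrM normfV (ger0_norm (x := s ^+ 2 * phi x)); last first.
    by rewrite mulr_ge0 ?sqr_ge0// ltW.
  by rewrite ler_pdivrMr// mulr_gt0// exprn_gt0.
exists f, f'; split => //.
- move=> x; apply: cvgM; last exact: cvg_cst.
  apply: cvgD; first exact: ck.
  apply: cvgM; first exact: cvg_id.
  by apply: differentiable_continuous; apply/derivable1_diffP; case: (fD x).
- move=> x; rewrite /f' normrM normfV (ger0_norm (sqr_ge0 s)).
  rewrite ler_pM2r ?invr_gt0 ?exprn_gt0//.
  by rewrite (le_trans (ler_normD _ _))// (mulrnDr C 2 2) lerD.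
- by move=> x; rewrite /f' mulrC mulfVK// addrK.
Qed.

End stein.

(** Only x is confined to the compact set: the second point may leave it. *)
Lemma uniform_continuity_on_compact (R : realType) (V : normedModType R) (f : V -> R) (K : set V) :
  continuous f -> compact K -> forall e : R, 0 < e ->
  exists2 r : R, 0 < r & forall x y, K x -> `|y - x| < r -> `|f y - f x| < e.
Proof.
move=> cf /compact_near_coveringP cK e e0.
have := cK R (0 : R)^'+ (fun r x => forall y, `|y - x| < r -> `|f y - f x| < e) _.
case.
  move=> x Kx.
  have /cvgrPdist_lt /(_ (e / 2)) := cf x.
  rewrite divr_gt0// => /(_ isT) /nbhs_normP [r /= r0 H].
  near=> z t => y yz.
  have z1 : `|x - z| < r / 2.
    by near: z; apply/nbhs_normP; exists (r / 2) => //=; rewrite divr_gt0.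
  have t1 : t < r / 2 by near: t; apply: nbhs_right_lt; rewrite divr_gt0.
  have fz : `|f x - f z| < e / 2.
    by apply: H => /=; rewrite (lt_trans z1)// ltr_pdivrMr// ltr_pMr// ltr1n.
  have fy : `|f x - f y| < e / 2.
    apply: H => /=; rewrite (_ : x - y = (x - z) - (y - z)); last first.
      by rewrite opprB addrA subrK.
    rewrite (le_lt_trans (ler_normB _ _))// [ltRHS]splitr ltrD//.
    exact: lt_trans yz t1.
  rewrite (_ : f y - f z = (f x - f z) - (f x - f y)); last by lra.
  by rewrite (le_lt_trans (ler_normB _ _))// [ltRHS]splitr ltrD.
move=> r /= r0 H; exists (r / 2); first by rewrite divr_gt0.
move=> x y Kx; apply: (H (r / 2)) => //=.
- by rewrite sub0r normrN gtr0_norm ?divr_gt0// ltr_pdivrMr// ltr_pMr// ltr1n.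
- by rewrite divr_gt0.
Unshelve. all: by end_near. Qed.

(** * Stein's method for sums of independent variables *)

Section taylor.
Context {R : realType}.
Variables (f f' : R -> R) (C K eta e : R).
Hypothesis fD : forall x : R, is_derive x (1 : R) f (f' x).
Hypothesis f'C : forall x, `|f' x| <= C.
Hypotheses (K0 : 0 < K) (eta0 : 0 < eta) (e0 : 0 <= e).
Hypothesis f'e : forall u x, `|u| <= K -> `|x| <= eta -> `|f' (u + x) - f' u| <= e.

(** Quadratic in u and x, so that its mean is controlled by second moments. *)
Definition increment_bound u x := e + C *+ 2 * (u ^+ 2 / K ^+ 2 + x ^+ 2 / eta ^+ 2).

(** Where the modulus of continuity e cannot be used, K < |u| or eta < |x|, one
    of the fractions exceeds 1 and the trivial bound 2 C takes over. *)
Lemma derivative_increment_le u x : `|f' (u + x) - f' u| <= increment_bound u x.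
Proof.
have C0 : 0 <= C by exact: le_trans (f'C 0).
have C20 : 0 <= C *+ 2 by rewrite mulrn_wge0.
have q1 : 0 <= u ^+ 2 / K ^+ 2 by rewrite divr_ge0 ?sqr_ge0.
have q2 : 0 <= x ^+ 2 / eta ^+ 2 by rewrite divr_ge0 ?sqr_ge0.
have sqle (a b : R) : 0 < a -> a < `|b| -> 1 <= b ^+ 2 / a ^+ 2.
  move=> a0 ab; rewrite -(real_normK (num_real b)) ler_pdivlMr ?exprn_gt0// mul1r.
  by rewrite ler_sqr ?nnegrE ?(ltW a0)// ltW.
have [uK|uK] := leP `|u| K; last first.
  rewrite /increment_bound -[leLHS]add0r lerD//.
  apply: (@le_trans _ _ (C *+ 2)).
    by rewrite mulr2n (le_trans (ler_normB _ _))// lerD.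
  by rewrite ler_peMr// -[leLHS]addr0 lerD// sqle.
have [xe|xe] := leP `|x| eta; last first.
  rewrite /increment_bound -[leLHS]add0r lerD//.
  apply: (@le_trans _ _ (C *+ 2)).
    by rewrite mulr2n (le_trans (ler_normB _ _))// lerD.
  by rewrite ler_peMr// -[leLHS]add0r lerD// sqle.
by rewrite (le_trans (f'e uK xe))// lerDl mulr_ge0// addr_ge0.
Qed.

Lemma mvt_increment u x : exists c, `|c| <= `|x| /\ f (u + x) - f u = f' (u + c) * x.
Proof.
have fc : continuous f.
  by move=> y; apply: differentiable_continuous; apply/derivable1_diffP; case: (fD y).
have [x0|x0] := leP 0 x.
  have ux : u <= u + x by rewrite lerDl.
  have [c] := MVT_segment ux (fun y _ => fD y) (continuous_subspaceT fc).
  rewrite in_itv/= => /andP[c1 c2] ->; exists (c - u).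
  rewrite (ger0_norm x0) ger0_norm ?subr_ge0// lerBlDl; split => //.
  by rewrite [u + x]addrC addrK [u + _]addrC subrK.
have ux : u + x <= u by rewrite gerDl ltW.
have [c] := MVT_segment ux (fun y _ => fD y) (continuous_subspaceT fc).
rewrite in_itv/= => /andP[c1 c2] h; exists (c - u).
rewrite (ltr0_norm x0) ler0_norm ?subr_le0//; split; first by lra.
have -> : u + (c - u) = c by ring.
by rewrite -opprB h; ring.
Qed.

(** The intermediate point of the mean value theorem is closer to u than
    u + x is, and increment_bound increases with |x|. *)
Lemma taylor_remainder_le u x :
  `|f (u + x) - f u - x * f' u| <= `|x| * increment_bound u x.
Proof.
have C20 : 0 <= C *+ 2 by rewrite mulrn_wge0// (le_trans _ (f'C 0)).
have [c [cx ->]] := mvt_increment u x.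
rewrite mulrC -mulrBr normrM ler_wpM2l//.
apply: le_trans (derivative_increment_le u c) _.
rewrite /increment_bound lerD2l ler_wpM2l// lerD2l ler_wpM2r ?invr_ge0 ?sqr_ge0//.
by rewrite -(real_normK (num_real c)) -(real_normK (num_real x)) lerXn2r ?nnegrE.
Qed.

Lemma lipschitz_bound u x : `|f (u + x) - f u| <= C * `|x|.
Proof.
have [c [cx ->]] := mvt_increment u x.
by rewrite normrM ler_wpM2r.
Qed.

End taylor.

Section l2.
Context {d} {T : measurableType d} {R : realType} (P : probability T R).
Local Notation int f := (P.-integrable setT (EFin \o f)).

Lemma dominated_integrable (f g : T -> R) : measurable_fun setT f -> int g ->
  (forall w, `|f w| <= g w) -> int f.
Proof.
move=> mf ig fg; apply: (le_integrable _ _ _ ig) => //.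
  exact/measurable_EFinP.
by move=> w _ /=; rewrite lee_fin (le_trans (fg w))// ler_norm.
Qed.

Lemma integrable_cstR (c : R) : int (fun=> c).
Proof. exact: finite_measure_integrable_cst. Qed.

Lemma Rintegral_cstP (c : R) : \int[P]__ c = c.
Proof.
rewrite /Rintegral (_ : (\int[P]__ c%:E = c%:E)%E)//.
by rewrite integral_cst// -[RHS]mule1; congr (_ * _)%E; exact: probability_setT.
Qed.

Lemma integrable_addR (f g : T -> R) : int f -> int g -> int (fun w => f w + g w).
Proof. by move=> fi gi; have := integrableD measurableT fi gi; exact. Qed.

Lemma integrable_scaleR (c : R) (f : T -> R) : int f -> int (fun w => c * f w).
Proof. by move=> fi; have := integrableZl measurableT c fi; exact. Qed.

Lemma integrable_of_sq (f : T -> R) : measurable_fun setT f ->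
  int (fun w => f w ^+ 2) -> int f.
Proof.
move=> mf f2; apply: (@dominated_integrable _ (fun w => 1 + f w ^+ 2)) => //.
  by apply: integrable_addR => //; exact: integrable_cstR.
move=> w; have [h|h] := leP `|f w| 1.
  by rewrite (le_trans h)// lerDl sqr_ge0.
rewrite -real_normK ?num_real// -[leLHS]add0r lerD//.
by rewrite expr2 ler_peMl// ltW.
Qed.

End l2.

Section sum_moments.
Context {d d1} {T : measurableType d} {S : measurableType d1} {R : realType}.
Variables (P : probability T R) (V : nat -> T -> S).
Local Notation int f := (P.-integrable setT (EFin \o f)).
Hypothesis mV : forall j, measurable_fun setT (V j).
Hypothesis indV : mutually_independent P V.
Variables (F : S -> R) (v : R).
Hypothesis mF : measurable_fun setT F.
Hypothesis iF2 : forall j, int (fun w => F (V j w) ^+ 2).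
Hypothesis EF0 : forall j, \int[P]_w F (V j w) = 0.
Hypothesis EF2 : forall j, \int[P]_w F (V j w) ^+ 2 = v.

Let mFV j : measurable_fun setT (fun w => F (V j w)).
Proof. exact: measurableT_comp. Qed.

Let iF j : int (fun w => F (V j w)).
Proof. exact: integrable_of_sq. Qed.

Lemma indep_comp_sum i s (g h : R -> R) : uniq s -> i \notin s ->
  measurable_fun setT g -> measurable_fun setT h ->
  indep2 P (fun w => g (F (V i w))) (fun w => h (\sum_(j <- s) F (V j w))).
Proof.
move=> us is_ mg mh.
have mgF : measurable_fun setT (g \o F) by exact: measurableT_comp.
exact: (indep2_comp mgF mh (indep_leave_one_out mV indV mF us is_)).
Qed.

(** Cross terms vanish, since each summand is centered and independent of the
    sum of the others. *)
Lemma sum_moments s : uniq s ->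
  [/\ int (fun w => (\sum_(j <- s) F (V j w)) ^+ 2),
      \int[P]_w (\sum_(j <- s) F (V j w)) = 0 &
      \int[P]_w (\sum_(j <- s) F (V j w)) ^+ 2 = (size s)%:R * v].
Proof.
elim: s => [_|i s IH /= /andP[is_ us]].
  split.
  - under [X in _.-integrable _ X]eq_fun do rewrite /= big_nil.
    exact: integrable_cstR.
  - under eq_Rintegral do rewrite big_nil.
    by rewrite Rintegral_cst// mul0r.
  - under eq_Rintegral do rewrite big_nil expr0n/=.
    by rewrite Rintegral_cst// !mul0r.
have [iU2 EU EU2] := IH us.
set U := fun w => \sum_(j <- s) F (V j w).
have mU : measurable_fun setT U := measurable_sum_comp mV mF s.
have iU : int U by exact: integrable_of_sq.
have [iXU EXU] := expectation_indep (mFV i) mU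
  (indep_comp_sum us is_ (@measurable_id _ R _) (@measurable_id _ R _)) (iF i) iU.
rewrite EF0 mul0r in EXU.
have sqE w : (\sum_(j <- i :: s) F (V j w)) ^+ 2 =
    F (V i w) ^+ 2 + (2 * (F (V i w) * U w) + U w ^+ 2).
  by rewrite big_cons -/(U w); ring.
have i2 := integrable_scaleR 2 iXU.
split.
- under [X in _.-integrable _ X]eq_fun do rewrite /= sqE.
  by apply: integrable_addR => //; exact: integrable_addR.
- under eq_Rintegral do rewrite big_cons.
  by rewrite RintegralD// EF0 EU addr0.
- under eq_Rintegral do rewrite sqE.
  rewrite RintegralD//; last exact: integrable_addR.
  rewrite RintegralD// RintegralZl// EXU EF2 EU2 -natr1; ring.
Qed.

End sum_moments.

Section discrepancy.
Context {d d1} {T : measurableType d} {S : measurableType d1} {R : realType}.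
Variables (P : probability T R) (V : nat -> T -> S).
Local Notation int f := (P.-integrable setT (EFin \o f)).
Hypothesis mV : forall j, measurable_fun setT (V j).
Hypothesis indV : mutually_independent P V.
Variables (F : S -> R) (v kap : R).
Hypothesis mF : measurable_fun setT F.
Hypothesis iF4 : forall j, int (fun w => F (V j w) ^+ 4).
Hypothesis EF0 : forall j, \int[P]_w F (V j w) = 0.
Hypothesis EF2 : forall j, \int[P]_w F (V j w) ^+ 2 = v.
Hypothesis EF4 : forall j, \int[P]_w F (V j w) ^+ 4 <= kap.
Variables (f f' : R -> R) (C K eta e : R).
Hypothesis fD : forall x : R, is_derive x (1 : R) f (f' x).
Hypothesis f'c : continuous f'.
Hypothesis f'C : forall x, `|f' x| <= C.
Hypotheses (K0 : 0 < K) (eta0 : 0 < eta) (e0 : 0 <= e).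
Hypothesis f'e : forall u x, `|u| <= K -> `|x| <= eta -> `|f' (u + x) - f' u| <= e.

Let mFV j : measurable_fun setT (fun w => F (V j w)).
Proof. exact: measurableT_comp. Qed.

Let iF2 j : int (fun w => F (V j w) ^+ 2).
Proof.
apply: integrable_of_sq; first exact: measurable_funX.
by apply: eq_integrable (iF4 j) => // w _; rewrite /= -exprM.
Qed.

Let iF j : int (fun w => F (V j w)).
Proof. exact: integrable_of_sq. Qed.

Let C0 : 0 <= C. Proof. exact: le_trans (f'C 0). Qed.

Let fc : continuous f.
Proof.
by move=> y; apply: differentiable_continuous; apply/derivable1_diffP; case: (fD y).
Qed.

Let mf : measurable_fun setT f. Proof. exact: continuous_measurable_fun. Qed.
Let mf' : measurable_fun setT f'. Proof. exact: continuous_measurable_fun. Qed.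

Let v0 : 0 <= v.
Proof. by rewrite -(EF2 0); apply: Rintegral_ge0 => w _; rewrite sqr_ge0. Qed.

(** Here n counts the other summands: their sum has second moment n * v. *)
Definition leave_one_out_error n : R := 2 * e * v +
  C *+ 2 * (2 * (n%:R * v ^+ 2) / K ^+ 2 + (v ^+ 2 + kap) / eta ^+ 2).

(** Let S = U + X with X the i-th summand.  In the expansion
    X f(S) = X f(U) + X^2 f'(U) + r, independence of X and U makes the mean of
    the first term 0 and that of the second v E f'(U); the remainder r and the
    replacement of f'(U) by f'(S) cost only increment_bound. *)
Let leave_one_out i s : uniq s -> i \notin s ->
  let S w := \sum_(j <- i :: s) F (V j w) in
  [/\ int (fun w => F (V i w) * f (S w)),
      int (fun w => f' (S w)) &
  `|\int[P]_w (F (V i w) * f (S w)) - v * \int[P]_w f' (S w)| <=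
  leave_one_out_error (size s)].
Proof.
move=> us is_ S0.
have [iU2 EU EU2] := sum_moments mV indV mF iF2 EF0 EF2 us.
set X := fun w => F (V i w).
set U := fun w => \sum_(j <- s) F (V j w) in iU2 EU EU2.
have SE w : S0 w = U w + X w by rewrite /S0 big_cons addrC.
have mX : measurable_fun setT X by exact: mFV.
have mU : measurable_fun setT U := measurable_sum_comp mV mF s.
have mS : measurable_fun setT S0 := measurable_sum_comp mV mF _.
have iU : int U by exact: integrable_of_sq.
have iX2 : int (fun w => X w ^+ 2) := iF2 i.
have iX4 : int (fun w => X w ^+ 4) := iF4 i.
have mcmp (g : R -> R) (Y : T -> R) : measurable_fun setT g ->
  measurable_fun setT Y -> measurable_fun setT (fun w => g (Y w)).
  by move=> mg mY; exact: measurableT_comp.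
have if'g (Y : T -> R) : measurable_fun setT Y -> int (fun w => f' (Y w)).
  move=> mY; apply: (@dominated_integrable _ _ _ _ _ (fun=> C)) => //.
    exact: mcmp.
  exact: integrable_cstR.
have ifU : int (fun w => f (U w)).
  apply: (@dominated_integrable _ _ _ _ _ (fun w => `|f 0| + C * `|U w|)).
  - exact: mcmp.
  - by apply: integrable_addR; [exact: integrable_cstR|apply: integrable_scaleR; exact: integrable_norm iU].
  - move=> w; have := lipschitz_bound fD f'C 0 (U w); rewrite add0r => h.
    by rewrite -[f (U w)](subrK (f 0)) addrC (le_trans (ler_normD _ _))// lerD2l.
have [i1 E1] := expectation_indep mX (mcmp _ _ mf mU)
  (indep_comp_sum mV indV mF us is_ (@measurable_id _ R _) mf) (iF i) ifU.
rewrite EF0 mul0r in E1.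
have mX2 : measurable_fun setT (fun w => X w ^+ 2) by exact: measurable_funX.
have msq : measurable_fun setT (fun x : R => x ^+ 2) by exact: measurable_funX.
have [i2 E2] := expectation_indep mX2 (mcmp _ _ mf' mU)
  (indep_comp_sum mV indV mF us is_ msq mf') (iF2 i) (if'g _ mU).
rewrite EF2 in E2.
have [i3 E3] := expectation_indep mX2 (mcmp _ _ msq mU)
  (indep_comp_sum mV indV mF us is_ msq msq) (iF2 i) iU2.
rewrite EF2 EU2 in E3.
pose r w := X w * (f (U w + X w) - f (U w) - X w * f' (U w)).
pose b w := e * X w ^+ 2 + C *+ 2 *
  (K ^- 2 * (X w ^+ 2 * U w ^+ 2) + eta ^- 2 * X w ^+ 4).
have ib : int b.
  apply: integrable_addR; first exact: integrable_scaleR.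
  by apply: integrable_scaleR; apply: integrable_addR; exact: integrable_scaleR.
have rb w : `|r w| <= b w.
  rewrite /r normrM.
  apply: (@le_trans _ _ (`|X w| * (`|X w| * increment_bound C K eta e (U w) (X w)))).
    by rewrite ler_wpM2l// taylor_remainder_le.
  rewrite mulrA -expr2 real_normK ?num_real// /increment_bound /b le_eqVlt; apply/orP; left.
  by apply/eqP; field; rewrite !gt_eqF.
have mr : measurable_fun setT r.
  apply: measurable_funM => //; apply: measurable_funB.
    apply: measurable_funB; last exact: mcmp.
    by apply: mcmp => //; exact: measurable_funD.
  by apply: measurable_funM => //; exact: mcmp.
have ir : int r by exact: dominated_integrable ib _.
have Er : `|\int[P]_w r w| <= e * v + C *+ 2 * (K ^- 2 * (v * ((size s)%:R * v)) + eta ^- 2 * kap).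
  apply: le_trans (le_normr_Rintegral _ ir) _ => //.
  apply: (@le_trans _ _ (\int[P]_w b w)).
    by apply: le_Rintegral => //; exact: integrable_norm ir.
  have ib1 := integrable_scaleR (K ^- 2) i3.
  have ib2 := integrable_scaleR (eta ^- 2) iX4.
  rewrite RintegralD//; [|exact: integrable_scaleR|by apply: integrable_scaleR; exact: integrable_addR].
  rewrite RintegralZl// EF2 lerD2l RintegralZl//; last exact: integrable_addR.
  rewrite ler_wpM2l ?mulrn_wge0// RintegralD// RintegralZl// E3 lerD2l.
  by rewrite RintegralZl//; apply: ler_wpM2l; [rewrite invr_ge0 sqr_ge0|exact: EF4].
have XfS w : X w * f (S0 w) = X w * f (U w) + (X w ^+ 2 * f' (U w) + r w).
  by rewrite SE /r; ring.
have i12 : int (fun w => X w ^+ 2 * f' (U w) + r w) by exact: integrable_addR.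
have Ef'S : `|\int[P]_w f' (S0 w) - \int[P]_w f' (U w)| <=
    e + C *+ 2 * (K ^- 2 * ((size s)%:R * v) + eta ^- 2 * v).
  rewrite -RintegralB//; [|exact: if'g|exact: if'g].
  have id : int (fun w => f' (S0 w) - f' (U w)).
    by have := integrableB measurableT (if'g _ mS) (if'g _ mU); exact.
  pose c w := e + C *+ 2 * (K ^- 2 * U w ^+ 2 + eta ^- 2 * X w ^+ 2).
  have ic : int c.
    apply: integrable_addR; first exact: integrable_cstR.
    by apply: integrable_scaleR; apply: integrable_addR; exact: integrable_scaleR.
  apply: le_trans (le_normr_Rintegral _ id) _ => //.
  apply: (@le_trans _ _ (\int[P]_w c w)).
    apply: le_Rintegral => //; first exact: integrable_norm id.
    move=> w _; rewrite SE.
    apply: le_trans (derivative_increment_le f'C K0 eta0 e0 f'e _ _) _.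
    by rewrite /increment_bound /c !(mulrC (_ ^+ 2) (_ ^- 2)).
  have ib1 := integrable_scaleR (K ^- 2) iU2.
  have ib2 := integrable_scaleR (eta ^- 2) iX2.
  rewrite RintegralD//; [|exact: integrable_cstR|by apply: integrable_scaleR; exact: integrable_addR].
  rewrite Rintegral_cstP RintegralZl//; last exact: integrable_addR.
  by rewrite RintegralD// !RintegralZl// EU2 EF2.
split.
- under [Y in _.-integrable _ Y]eq_fun do rewrite /= -/(X _) XfS.
  exact: integrable_addR.
- exact: if'g.
- under eq_Rintegral do rewrite -/(X _) XfS.
  rewrite RintegralD// E1 add0r RintegralD// E2.
  rewrite (_ : _ + _ - _ = \int[P]_w r w - v * (\int[P]_w f' (S0 w) - \int[P]_w f' (U w))); last by ring.
  apply: (le_trans (ler_normB _ _)); rewrite normrM (ger0_norm v0).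
  apply: (le_trans (lerD Er (ler_wpM2l v0 Ef'S))).
  rewrite /leave_one_out_error le_eqVlt; apply/orP; left; apply/eqP; field.
  by rewrite !gt_eqF.
Qed.

(** Summing leave_one_out over the summands compares E S f(S) with
    n v E f'(S). *)
Lemma stein_discrepancy_le s (s2 : R) : uniq s ->
  `|\int[P]_w (s2 * f' (\sum_(j <- s) F (V j w)) -
     (\sum_(j <- s) F (V j w)) * f (\sum_(j <- s) F (V j w)))| <=
  `|s2 - (size s)%:R * v| * C + (size s)%:R * leave_one_out_error (size s).
Proof.
move=> us; pose S0 w := \sum_(j <- s) F (V j w).
rewrite [X in `|X|](_ : _ = \int[P]_w (s2 * f' (S0 w) - S0 w * f (S0 w)))//.
have mS : measurable_fun setT S0 := measurable_sum_comp mV mF _.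
have if'S : int (fun w => f' (S0 w)).
  apply: (@dominated_integrable _ _ _ _ _ (fun=> C)) => //.
    exact: measurableT_comp.
  exact: integrable_cstR.
have term i : i \in s -> int (fun w => F (V i w) * f (S0 w)) /\
   `|\int[P]_w (F (V i w) * f (S0 w)) - v * \int[P]_w f' (S0 w)| <=
   leave_one_out_error (size s).
  move=> is_.
  have SE w : S0 w = \sum_(j <- i :: rem i s) F (V j w).
    by rewrite /S0; apply: perm_big; exact: perm_to_rem.
  have irem : i \notin rem i s by rewrite mem_rem_uniqF.
  have [i1 _] := leave_one_out (rem_uniq i us) irem.
  under [Y in `|Y - _|]eq_Rintegral do rewrite -SE.
  under [Y in `|_ - _ * Y|]eq_Rintegral do rewrite -SE.
  move=> E; split.
    by apply: eq_integrable i1 => // w _; rewrite /= -SE.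
  apply: (le_trans E); rewrite /leave_one_out_error lerD2l ler_wpM2l ?mulrn_wge0// lerD2r.
  rewrite ler_wpM2r ?invr_ge0 ?sqr_ge0// ler_wpM2l// ler_wpM2r ?sqr_ge0//.
  by rewrite ler_nat size_rem// leq_pred.
have SfS w : S0 w * f (S0 w) = \sum_(i <- s) F (V i w) * f (S0 w).
  by rewrite {1}/S0 mulr_suml.
have acc : forall s', {subset s' <= s} ->
    int (fun w => \sum_(i <- s') F (V i w) * f (S0 w)) /\
    `|\int[P]_w (\sum_(i <- s') F (V i w) * f (S0 w)) -
       (size s')%:R * v * \int[P]_w f' (S0 w)| <= (size s')%:R * leave_one_out_error (size s).
  elim=> [_|i s' IH ss'].
    split.
      under [X in _.-integrable _ X]eq_fun do rewrite /= big_nil.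
      exact: integrable_cstR.
    under eq_Rintegral do rewrite big_nil.
    by rewrite Rintegral_cstP /= !mul0r subr0 normr0.
  have [|i1 E1] := IH; first by move=> j js; apply: ss'; rewrite in_cons js orbT.
  have [i2 E2] := term i (ss' _ (mem_head _ _)).
  split.
    under [X in _.-integrable _ X]eq_fun do rewrite /= big_cons.
    exact: integrable_addR.
  under eq_Rintegral do rewrite big_cons.
  rewrite RintegralD//= -natr1.
  set I := \int[P]_w f' _ in E1 E2 *.
  set A := Rintegral _ _ _ in E2 *; set B := Rintegral _ _ _ in E1 *.
  rewrite (_ : _ - _ = (B - (size s')%:R * v * I) + (A - v * I)); last by ring.
  by rewrite (le_trans (ler_normD _ _))// mulrDl mul1r lerD.
have [iSf ESf] := acc s (fun _ => id).
rewrite RintegralB//.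
- rewrite RintegralZl//; under [Y in `|_ - Y|]eq_Rintegral do rewrite SfS.
  set I := Rintegral _ _ (fun w => f' _) in ESf *.
  rewrite (_ : _ - _ = (s2 - (size s)%:R * v) * I -
     (\int[P]_x (\sum_(i <- s) F (V i x) * f (S0 x)) - (size s)%:R * v * I)); last by ring.
  rewrite (le_trans (ler_normB _ _))// lerD// normrM ler_wpM2l//.
  rewrite /I (le_trans (le_normr_Rintegral _ if'S))//.
  rewrite -[leRHS](Rintegral_cstP P); apply: le_Rintegral => //.
    exact: integrable_norm if'S.
  exact: integrable_cstR.
- exact: integrable_scaleR.
- by apply: eq_integrable iSf => // w _; rewrite /= -SfS.
Qed.

End discrepancy.

(** * Central limit theorem for arrays with vanishing fourth moments *)

Section clt.
Context {d d1} {T : measurableType d} {S : measurableType d1} {R : realType}.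
Variables (P : probability T R) (V : nat -> T -> S).
Local Notation int f := (P.-integrable setT (EFin \o f)).
Hypothesis mV : forall j, measurable_fun setT (V j).
Hypothesis indV : mutually_independent P V.
Variables (F : nat -> S -> R) (v kap : nat -> R) (s : R).
Hypothesis mF : forall N, measurable_fun setT (F N).
Hypothesis iF4 : forall N j, int (fun w => F N (V j w) ^+ 4).
Hypothesis EF0 : forall N j, \int[P]_w F N (V j w) = 0.
Hypothesis EF2 : forall N j, \int[P]_w F N (V j w) ^+ 2 = v N.
Hypothesis EF4 : forall N j, \int[P]_w F N (V j w) ^+ 4 <= kap N.
Hypothesis s0 : 0 < s.
Hypothesis vs : N%:R * v N @[N --> \oo] --> s ^+ 2.
Hypothesis kap0 : N%:R * kap N @[N --> \oo] --> 0.

(** Insert the solution of Stein's equation for h.  In the resulting bound b N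
    the terms carrying s^2 - N v, N v^2 or N kap vanish, and the two that remain
    in the limit are at most a quarter of eps each by the choice of e and of
    K. *)
Lemma clt_array (h : R -> R) (C : R) : continuous h -> (forall x, `|h x| <= C) ->
  \int[P]_w h (\sum_(j <- iota 0 N) F N (V j w)) @[N --> \oo] -->
  \int[lebesgue_measure]_t (h t * normal_pdf 0 s t).
Proof.
move=> ch hC; set m := \int[_]_t _.
have [f [f' [fD f'c f'C0 feq]]] := stein_solution s0 ch hC.
set C1 := C *+ 4 / s ^+ 2 in f'C0.
have C10 : 0 <= C1 by exact: le_trans (f'C0 0).
have diff N : \int[P]_w h (\sum_(j <- iota 0 N) F N (V j w)) - m =
  \int[P]_w (s ^+ 2 * f' (\sum_(j <- iota 0 N) F N (V j w)) -
     (\sum_(j <- iota 0 N) F N (V j w)) * f (\sum_(j <- iota 0 N) F N (V j w))).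
  rewrite -[in LHS](Rintegral_cstP P m) -RintegralB//.
  - by apply: eq_Rintegral => w _; rewrite feq.
  - apply: (@dominated_integrable _ _ _ _ _ (fun=> C)) => //.
      apply: (measurableT_comp (f := h)); first exact: continuous_measurable_fun.
      exact: (measurable_sum_comp mV (mF N)).
    exact: integrable_cstR.
  - exact: integrable_cstR.
have vv0 : N%:R * v N ^+ 2 @[N --> \oo] --> (0 : R).
  have inv0 : (N%:R)^-1 @[N --> \oo] --> (0 : R).
    rewrite gtr0_cvgV0; first exact: cvgr_idn.
    by near=> N; rewrite ltr0n; near: N; exact: nbhs_infty_gt.
  rewrite -(mulr0 (s ^+ 2 * s ^+ 2)).
  apply: (@cvg_trans _ ((N%:R * v N) * (N%:R * v N) * N%:R^-1 @[N --> \oo])); last first.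
    by apply: cvgM => //; exact: cvgM.
  apply: near_eq_cvg; near=> N.
  have N0 : N%:R != 0 :> R by rewrite pnatr_eq0 -lt0n; near: N; exact: nbhs_infty_gt.
  by field.
apply/cvgrPdist_le => eps eps0.
pose e := eps / (8 * s ^+ 2).
have s20 : 0 < s ^+ 2 by rewrite exprn_gt0.
have e0 : 0 < e by rewrite divr_gt0// mulr_gt0.
pose K := Num.sqrt (16 * (C1 + 1) * s ^+ 2 ^+ 2 / eps).
have K20 : 0 < 16 * (C1 + 1) * s ^+ 2 ^+ 2 / eps.
  by rewrite divr_gt0// !mulr_gt0// ?ltr_wpDl ?exprn_gt0.
have K0 : 0 < K by rewrite sqrtr_gt0.
have KE : K ^+ 2 = 16 * (C1 + 1) * s ^+ 2 ^+ 2 / eps by rewrite sqr_sqrtr// ltW.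
have [r r0 Hr] := uniform_continuity_on_compact f'c (@segment_compact R (- K) K) e0.
pose eta := r / 2.
have eta0 : 0 < eta by rewrite divr_gt0.
have f'e u x : `|u| <= K -> `|x| <= eta -> `|f' (u + x) - f' u| <= e.
  move=> uK xe; apply/ltW/Hr.
    by rewrite /= in_itv/= -ler_norml.
  by rewrite addrAC subrr add0r (le_lt_trans xe)// /eta ltr_pdivrMr// ltr_pMr// ltr1n.
pose b N : R := `|s ^+ 2 - N%:R * v N| * C1 + (2 * e * (N%:R * v N) +
  C1 *+ 2 * (2 * ((N%:R * v N) * (N%:R * v N)) / K ^+ 2 + (N%:R * v N ^+ 2 + N%:R * kap N) / eta ^+ 2)).
have bE N : `|\int[P]_w h (\sum_(j <- iota 0 N) F N (V j w)) - m| <= b N.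
  rewrite diff.
  have := stein_discrepancy_le mV indV (mF N) (iF4 N) (EF0 N) (EF2 N) (EF4 N) fD f'c
    f'C0 K0 eta0 (ltW e0) f'e (s ^+ 2) (iota_uniq 0 N).
  move=> /le_trans; apply; rewrite size_iota /b lerD2l le_eqVlt; apply/orP; left.
  by apply/eqP; rewrite /leave_one_out_error; field; rewrite !gt_eqF.
have bl : b N @[N --> \oo] --> `|s ^+ 2 - s ^+ 2| * C1 + (2 * e * s ^+ 2 +
  C1 *+ 2 * (2 * (s ^+ 2 * s ^+ 2) / K ^+ 2 + (0 + 0) / eta ^+ 2)).
  apply: cvgD.
    apply: cvgM; last exact: cvg_cst.
    by apply: cvg_norm; apply: cvgB => //; exact: cvg_cst.
  apply: cvgD; first by apply: cvgM => //; exact: cvg_cst.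
  apply: cvgM; first exact: cvg_cst.
  apply: cvgD.
    apply: cvgM; last exact: cvg_cst.
    by apply: cvgM; [exact: cvg_cst|exact: cvgM].
  by apply: cvgM; [exact: cvgD|exact: cvg_cst].
have : `|s ^+ 2 - s ^+ 2| * C1 + (2 * e * s ^+ 2 +
  C1 *+ 2 * (2 * (s ^+ 2 * s ^+ 2) / K ^+ 2 + (0 + 0) / eta ^+ 2)) < eps.
  rewrite subrr normr0 mul0r add0r addr0 mul0r addr0 KE.
  rewrite (_ : 2 * e * s ^+ 2 = eps / 4); last by rewrite /e; field; rewrite gt_eqF.
  rewrite (_ : C1 *+ 2 * _ = eps / 4 * (C1 / (C1 + 1))); last first.
    by field; rewrite !gt_eqF// ltr_wpDl.
  have : C1 / (C1 + 1) < 1 by rewrite ltr_pdivrMr ?mul1r ?ltrDl// ltr_wpDl.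
  move=> h1.
  have : eps / 4 * (C1 / (C1 + 1)) < eps / 4 * 1 by rewrite ltr_pM2l// divr_gt0.
  lra.
move=> /(cvgr_lt _ bl); apply: filterS => N bN.
by rewrite distrC (le_trans (bE N))// ltW.
Unshelve. all: by end_near. Qed.

End clt.

(** * Integrals weighted by a function of a random variable *)

Section weighted.
Context {d d'} {T : measurableType d} {S : measurableType d'} {R : realType}.
Variables (mu : {measure set T -> \bar R}) (A : T -> S) (Y : T -> R).
Hypothesis mA : measurable_fun setT A.
Hypothesis mY : measurable_fun setT Y.
Hypothesis Y0 : forall x, 0 <= Y x.

Import HBNNSimple.
Local Open Scope ereal_scope.

Lemma integral_weighted_nnsfun (h : {nnsfun S >-> R}) :
  \int[mu]_x ((h (A x))%:E * (Y x)%:E) =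
  \sum_(r \in range h) (r%:E * \int[mu]_(x in A @^-1` (h @^-1` [set r])) (Y x)%:E).
Proof.
have mAh r : measurable (A @^-1` (h @^-1` [set r])).
  by rewrite -[X in measurable X]setTI; exact: mA.
transitivity (\int[mu]_x (\sum_(r \in range h)
    ((r * \1_(h @^-1` [set r]) (A x))%:E * (Y x)%:E))).
  apply: eq_integral => x _; rewrite [in LHS](fimfunE h) -fsumEFin//.
  rewrite ge0_mule_fsuml// => r; rewrite EFinM; exact: nnfun_muleindic_ge0.
have mI r : measurable_fun setT (fun x => (\1_(h @^-1` [set r]) (A x) : R)).
  exact: measurableT_comp.
rewrite ge0_integral_fsum//; last 2 first.
- move=> r; apply/measurable_EFinP; apply: measurable_funM => //.
  exact: measurable_funM.
- move=> r x _; rewrite mule_ge0 ?lee_fin//.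
  by rewrite -lee_fin EFinM; exact: nnfun_muleindic_ge0.
apply: eq_fsbigr => r rh.
under eq_integral do rewrite EFinM -muleA.
rewrite ge0_integralZl//.
- congr (_ * _); rewrite [in RHS]integral_mkcond; apply: eq_integral => x _.
  rewrite patchE indicE (_ : (x \in A @^-1` _) = (A x \in h @^-1` [set r]))//.
  by case: ifP => _; rewrite ?mul1e ?mul0e.
- apply/measurable_EFinP; exact: measurable_funM.
- by move=> x _; rewrite mule_ge0 ?lee_fin// indicE.
- by move: rh; rewrite inE => -[t _ <-]; rewrite lee_fin.
Qed.

Lemma integral_weighted_lim (g : S -> R) (mg : measurable_fun setT (EFin \o g)) :
  (forall x, (0 <= g x)%R) ->
  \int[mu]_x ((g (A x))%:E * (Y x)%:E) =
  limn (fun n => \int[mu]_x ((nnsfun_approx measurableT mg n (A x))%:E * (Y x)%:E)).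
Proof.
move=> g0; rewrite -monotone_convergence//.
- apply: eq_integral => x _; apply/esym/cvg_lim => //.
  apply: cvgeZr => //.
  have mgA y : [set: S] y -> 0 <= (EFin \o g) y by rewrite lee_fin.
  exact: (cvg_nnsfun_approx measurableT mg mgA).
- move=> n; apply/measurable_EFinP; apply: measurable_funM => //.
  exact: measurableT_comp.
- by move=> n x _; rewrite mule_ge0 ?lee_fin.
- move=> x _ a b ab; rewrite lee_wpmul2r ?lee_fin//.
  exact/lefP/nd_nnsfun_approx.
Qed.

End weighted.

Section weighted_eq.
Import HBNNSimple.

(** The integrals of Y over the events A^-1(B) determine those of g(A) Y: both
    sides are increasing limits over the same simple functions approximating
    g.  With Y = 1 this is a change of variables, with Y a density it computes
    means under an absolutely continuous law, with Y an indicator it is the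
    pull-out property of conditional expectations. *)
Lemma integral_weighted_eq d1 d2 d' (T1 : measurableType d1)
    (T2 : measurableType d2) (S : measurableType d') (R : realType)
    (mu1 : {measure set T1 -> \bar R}) (mu2 : {measure set T2 -> \bar R})
    (A1 : T1 -> S) (A2 : T2 -> S) (Y1 : T1 -> R) (Y2 : T2 -> R) :
  measurable_fun setT A1 -> measurable_fun setT A2 ->
  measurable_fun setT Y1 -> measurable_fun setT Y2 ->
  (forall x, 0 <= Y1 x) -> (forall x, 0 <= Y2 x) ->
  (forall B, measurable B -> (\int[mu1]_(x in A1 @^-1` B) (Y1 x)%:E =
                              \int[mu2]_(x in A2 @^-1` B) (Y2 x)%:E)%E) ->
  forall g : S -> R, measurable_fun setT g -> (forall x, 0 <= g x) ->
  (\int[mu1]_x (g (A1 x) * Y1 x)%:E = \int[mu2]_x (g (A2 x) * Y2 x)%:E)%E.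
Proof.
move=> mA1 mA2 mY1 mY2 Y10 Y20 H g mg g0.
under eq_integral do rewrite EFinM.
under [RHS]eq_integral do rewrite EFinM.
have mg' : measurable_fun setT (EFin \o g) by exact/measurable_EFinP.
rewrite !(integral_weighted_lim mu1 mA1 mY1 Y10 mg' g0)//.
rewrite (integral_weighted_lim mu2 mA2 mY2 Y20 mg' g0)//.
congr (limn _); apply/funext => n; rewrite !integral_weighted_nnsfun//.
by apply: eq_fsbigr => r _; rewrite H.
Qed.

End weighted_eq.

(** * Moments, thinning and convolution of the Poisson law *)

Section poisson.
Context {R : realType}.
Implicit Types (mu p : R) (g : nat -> R).

(** The mean of g under the Poisson law; it is extended-real, so that sums can
    be rearranged without discussing convergence. *)
Definition Epois mu g : \bar R := (\sum_(0 <= k <oo) (g k * poisson_pmf mu k)%:E)%E.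

Lemma poisson_pmfE mu k : 0 < mu ->
  poisson_pmf mu k = mu ^+ k * k`!%:R^-1 * expR (- mu).
Proof. by rewrite /poisson_pmf => ->. Qed.

Lemma Epois1 mu : 0 < mu -> Epois mu (fun=> 1) = 1%E.
Proof.
move=> mu0; rewrite /Epois.
transitivity (poisson_prob mu 0 [set: nat]); last exact: probability_setT.
rewrite /poisson_prob mu0 -nneseries_esumT; last first.
  by move=> n; rewrite lee_fin poisson_pmf_ge0.
by apply: eq_eseriesr => k _; rewrite mul1r.
Qed.

Lemma poisson_pmfS mu k : 0 < mu ->
  k.+1%:R * poisson_pmf mu k.+1 = mu * poisson_pmf mu k.
Proof.
move=> mu0; rewrite !poisson_pmfE// factS natrM exprS; field.
by rewrite nat1r !pnatr_eq0 -lt0n fact_gt0.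
Qed.

Lemma EpoisD mu g h : (forall k, 0 <= g k) -> (forall k, 0 <= h k) ->
  Epois mu (fun k => g k + h k) = (Epois mu g + Epois mu h)%E.
Proof.
move=> g0 h0; rewrite /Epois -nneseriesD.
- by apply: eq_eseriesr => k _; rewrite -EFinD mulrDl.
- by move=> k _ _; rewrite lee_fin mulr_ge0// poisson_pmf_ge0.
- by move=> k _ _; rewrite lee_fin mulr_ge0// poisson_pmf_ge0.
Qed.

Lemma EpoisZ mu g (c : R) : 0 <= c -> (forall k, 0 <= g k) ->
  Epois mu (fun k => c * g k) = (c%:E * Epois mu g)%E.
Proof.
move=> c0 g0; rewrite /Epois -nneseriesZl.
- by apply: eq_eseriesr => k _; rewrite -EFinM mulrA.
- by move=> k _; rewrite lee_fin mulr_ge0// poisson_pmf_ge0.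
Qed.

Lemma eq_Epois mu g h : (forall k, g k = h k) -> Epois mu g = Epois mu h.
Proof. by move=> gh; apply: eq_eseriesr => k _; rewrite gh. Qed.

(** The identity E[X g(X)] = mu E[g(X + 1)], from which the moments
    and, by induction on b, the thinning property follow. *)
Lemma Epois_shift mu g : 0 < mu -> (forall k, 0 <= g k) ->
  Epois mu (fun k => k%:R * g k) = (mu%:E * Epois mu (fun k => g k.+1))%E.
Proof.
move=> mu0 g0; rewrite -EpoisZ//; last exact: ltW.
have pos k : (0 <= (k%:R * g k * poisson_pmf mu k)%:E)%E.
  by rewrite lee_fin !mulr_ge0// poisson_pmf_ge0.
rewrite /Epois nneseries_recl// !mul0r add0e -(nneseries_addn 1)//.
apply: eq_eseriesr => k _; rewrite addn1 mulrAC poisson_pmfS//.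
by congr EFin; ring.
Qed.

Lemma Epois_cst mu c : 0 < mu -> 0 <= c -> Epois mu (fun=> c) = c%:E.
Proof.
move=> mu0 c0; rewrite (eq_Epois _ (h := fun k => c * 1)); last by move=> k; rewrite mulr1.
by rewrite EpoisZ// Epois1// mule1.
Qed.

Lemma Epois_id mu : 0 < mu -> Epois mu (fun k => k%:R) = mu%:E.
Proof.
move=> mu0; rewrite (eq_Epois _ (h := fun k => k%:R * 1)); last by move=> k; rewrite mulr1.
by rewrite Epois_shift// Epois1// mule1.
Qed.

Lemma Epois_sq mu : 0 < mu -> Epois mu (fun k => k%:R ^+ 2) = (mu ^+ 2 + mu)%:E.
Proof.
move=> mu0; rewrite Epois_shift//.
rewrite (eq_Epois _ (h := fun k => k%:R + 1)); last by move=> k; rewrite natr1.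
by rewrite EpoisD// Epois_id// Epois_cst// -EFinD -EFinM; congr EFin; ring.
Qed.

Lemma Epois_cube mu : 0 < mu ->
  Epois mu (fun k => k%:R ^+ 3) = (mu ^+ 3 + 3 * mu ^+ 2 + mu)%:E.
Proof.
move=> mu0; rewrite (eq_Epois _ (h := fun k => k%:R * k%:R ^+ 2)); last by move=> k; ring.
rewrite Epois_shift//.
rewrite (eq_Epois _ (h := fun k => k%:R ^+ 2 + (2 * k%:R + 1))); last first.
  by move=> k; rewrite -natr1; ring.
rewrite !EpoisD//; try by move=> k; rewrite ?addr_ge0 ?mulr_ge0 ?exprn_ge0.
rewrite EpoisZ// Epois_sq// Epois_id// Epois_cst//.
by rewrite -?EFinM -?EFinD -?EFinM -?EFinD -?EFinM -?EFinD -?EFinM; congr EFin; ring.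
Qed.

Lemma Epois_four mu : 0 < mu ->
  Epois mu (fun k => k%:R ^+ 4) = (mu ^+ 4 + 6 * mu ^+ 3 + 7 * mu ^+ 2 + mu)%:E.
Proof.
move=> mu0; rewrite (eq_Epois _ (h := fun k => k%:R * k%:R ^+ 3)); last by move=> k; ring.
rewrite Epois_shift//.
rewrite (eq_Epois _ (h := fun k => k%:R ^+ 3 + (3 * k%:R ^+ 2 + (3 * k%:R + 1)))); last first.
  by move=> k; rewrite -natr1; ring.
rewrite !EpoisD//; try by move=> k; rewrite ?addr_ge0 ?mulr_ge0 ?exprn_ge0.
rewrite !EpoisZ//; try by move=> k; rewrite ?exprn_ge0.
rewrite Epois_cube// Epois_sq// Epois_id// Epois_cst//.
by rewrite -?EFinM -?EFinD -?EFinM -?EFinD -?EFinM -?EFinD -?EFinM; congr EFin; ring.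
Qed.

Let cancel_fin (x : \bar R) (a b : R) : (x + a%:E = b%:E)%E -> x = (b - a)%:E.
Proof. by case: x => [x|//|//] [<-]; rewrite addrK. Qed.

Lemma Epois_variance mu : 0 < mu -> Epois mu (fun k => (k%:R - mu) ^+ 2) = mu%:E.
Proof.
move=> mu0; have mu0' := ltW mu0.
have : (Epois mu (fun k => (k%:R - mu) ^+ 2)%R + (2 * mu * mu)%:E =
   (mu ^+ 2 + mu + mu ^+ 2)%:E)%E.
  rewrite EFinM -(Epois_id mu0) -EpoisZ//; last exact: mulr_ge0.
  rewrite -EpoisD//; last 2 first.
    by move=> k; rewrite sqr_ge0.
    by move=> k; rewrite !mulr_ge0.
  rewrite (eq_Epois _ (h := fun k => k%:R ^+ 2 + mu ^+ 2)); last by move=> k; ring.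
  rewrite EpoisD//; try by move=> k; rewrite sqr_ge0.
  by rewrite Epois_sq// Epois_cst// sqr_ge0.
by move=> /cancel_fin ->; congr EFin; ring.
Qed.

Lemma Epois_central4 mu : 0 < mu ->
  Epois mu (fun k => (k%:R - mu) ^+ 4) = (3 * mu ^+ 2 + mu)%:E.
Proof.
move=> mu0; have mu0' := ltW mu0.
have p4 (x : R) : 0 <= x ^+ 4 by rewrite (exprM x 2 2) sqr_ge0.
have : (Epois mu (fun k => (k%:R - mu) ^+ 4)%R +
   (4 * mu * (mu ^+ 3 + 3 * mu ^+ 2 + mu) + 4 * mu ^+ 3 * mu)%:E =
   (mu ^+ 4 + 6 * mu ^+ 3 + 7 * mu ^+ 2 + mu + (6 * mu ^+ 2 * (mu ^+ 2 + mu) + mu ^+ 4))%:E)%E.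
  transitivity (Epois mu (fun k => k%:R ^+ 4 + (6 * mu ^+ 2 * k%:R ^+ 2 + mu ^+ 4))); last first.
    rewrite !EpoisD// ?EpoisZ//; try by move=> k; rewrite ?addr_ge0 ?mulr_ge0 ?exprn_ge0.
      by rewrite Epois_four// Epois_sq// Epois_cst// ?exprn_ge0.
    by rewrite !mulr_ge0 ?exprn_ge0.
  rewrite [RHS](eq_Epois _ (h := fun k => (k%:R - mu) ^+ 4 + (4 * mu * k%:R ^+ 3 + 4 * mu ^+ 3 * k%:R))); last first.
    by move=> k; ring.
  rewrite [RHS]EpoisD//; last by move=> k; rewrite ?addr_ge0 ?mulr_ge0 ?exprn_ge0.
  congr (_ + _)%E.
  rewrite EpoisD//; try by move=> k; rewrite ?mulr_ge0 ?exprn_ge0.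
  rewrite !EpoisZ//; try by move=> *; rewrite ?mulr_ge0 ?exprn_ge0.
  by rewrite Epois_cube// Epois_id.
by move=> /cancel_fin ->; congr EFin; ring.
Qed.

Lemma binomial_pmfE n p k :
  binomial_pmf n p k = p ^+ k * (1 - p) ^+ (n - k) *+ 'C(n, k).
Proof. by []. Qed.

(** A Poisson number of individuals, each kept with probability p, is Poisson:
    the step from b to b.+1 uses (b.+1) C(m, b.+1) = m C(m.-1, b) and the shift
    identity, which reproduce the recursion [poisson_pmfS] of the Poisson
    weights. *)
Lemma poisson_thinning mu p b : 0 < mu -> 0 < p < 1 ->
  Epois mu (fun m => binomial_pmf m p b) = (poisson_pmf (mu * p) b)%:E.
Proof.
move=> mu0 /andP[p0 p1]; have q0 : 0 < 1 - p by rewrite subr_gt0.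
have bge0 m k : 0 <= binomial_pmf m p k by rewrite binomial_pmf_ge0// !ltW.
elim: b => [|b IH].
  rewrite /Epois.
  transitivity ((expR (- (mu * p)))%:E * Epois (mu * (1 - p)) (fun=> 1%R))%E.
    rewrite -EpoisZ ?expR_ge0//; apply: eq_eseriesr => k _; congr EFin.
    rewrite !poisson_pmfE ?mulr_gt0// mulr1 binomial_pmfE bin0 mulr1n subn0 expr0 mul1r.
    rewrite exprMn (_ : expR (- mu) = expR (- (mu * p)) * expR (- (mu * (1 - p)))).
      ring.
    by rewrite -expRD; congr expR; ring.
  rewrite Epois1 ?mulr_gt0// mule1 poisson_pmfE ?mulr_gt0//.
  by rewrite expr0 fact0 invr1 !mul1r.
have b1 : b.+1%:R != 0 :> R by rewrite pnatr_eq0.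
rewrite (eq_Epois _ (h := fun m => m%:R * (p / b.+1%:R * binomial_pmf m.-1 p b))); last first.
  case=> [|m]; first by rewrite mul0r binomial_pmfE bin0n mulr0n.
  rewrite !binomial_pmfE subSS /=.
  have /(congr1 (fun n => n%:R : R)) := mul_bin_diag m.+1 b.
  rewrite /= !natrM -!(mulr_natr (_ * _ : R)) exprS => h.
  rewrite [RHS](_ : _ = (p ^+ b * (1 - p) ^+ (m - b) * p / b.+1%:R) * (m.+1%:R * 'C(m, b)%:R)); last by ring.
  by rewrite h; field.
rewrite Epois_shift//=; last first.
  by move=> k; rewrite !mulr_ge0 ?invr_ge0// ltW.
rewrite EpoisZ ?mulr_ge0 ?invr_ge0 ?(ltW p0)// IH -!EFinM; congr EFin.
have := poisson_pmfS b (mulr_gt0 mu0 p0) => h.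
apply: (mulfI b1); rewrite h; field.
by rewrite nat1r b1.
Qed.

Lemma poisson_convolution (a b : R) u : 0 < a -> 0 < b ->
  \sum_(v < u.+1) poisson_pmf a (u - v) * poisson_pmf b v = poisson_pmf (a + b) u.
Proof.
move=> a0 b0; rewrite poisson_pmfE ?addr_gt0// exprDn !mulr_suml.
apply: eq_bigr => v _; rewrite !poisson_pmfE// opprD expRD.
have vu : (v <= u)%N by rewrite -ltnS.
have /(congr1 (fun n => n%:R : R)) := bin_fact vu; rewrite !natrM => <-.
rewrite -mulr_natr; field.
by rewrite !pnatr_eq0 -!lt0n !fact_gt0 bin_gt0 vu.
Qed.

End poisson.

(** * Conditional law of the INAR(1) process given its coefficient *)

Lemma measurable_invr {R : realType} : measurable_fun setT (@GRing.inv R).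
Proof.
rewrite (_ : GRing.inv = fun x : R => x * (x ^+ 2) `^ (-1)); last first.
  apply/funext => x; rewrite powR_inv1 ?sqr_ge0//.
  have [->|x0] := eqVneq x 0; first by rewrite mul0r invr0.
  by rewrite expr2 invfM mulrA mulfV// mul1r.
apply: measurable_funM => //.
apply: (measurableT_comp (f := fun x : R => x `^ (-1)) (g := fun x : R => x ^+ 2)).
  exact: measurable_powR.
exact: measurable_funX.
Qed.

Section inar_law.
Context {d} {T : measurableType d} {R : realType} (P : probability T R).
Variables (lambda : R) (alpha : {RV P >-> R})
    (X0 : {RV P >-> nat}) (xi : nat -> nat -> {RV P >-> nat})
    (eps : nat -> {RV P >-> nat}).
Hypothesis lambda0 : 0 < lambda.
Hypothesis H : randomized_inar1_inputs lambda alpha X0 xi eps.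

Let idx : eqType := option (nat * nat + nat).
Let Y : idx -> T -> nat := inar1_inputs X0 (fun k j => xi k j) eps.

Definition bern_pmf (p : R) (v : nat) : R :=
  if v is v'.+1 then (if v' is 0%N then p else 0) else 1 - p.

Definition stat_rate (a : R) : R := lambda / (1 - a).

(** The conditional weights, given alpha = a, that the hypotheses assign to the
    inputs of the recursion. *)
Definition input_pmf (i : idx) (v : nat) (a : R) : R :=
  match i with
  | None => poisson_pmf (stat_rate a) v
  | Some (inl _) => bern_pmf a v
  | Some (inr _) => poisson_pmf lambda v
  end.

Let a01 w : 0 < alpha w < 1 := inar1_alpha01 H w.

Lemma stat_rate_gt0 a : a < 1 -> 0 < stat_rate a.
Proof. by move=> a1; rewrite divr_gt0// subr_gt0. Qed.

Lemma measurable_stat_rate : measurable_fun setT stat_rate.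
Proof.
apply: measurable_funM => //; apply: (measurableT_comp measurable_invr).
exact: measurable_funB.
Qed.

Lemma measurable_poisson_rate (r : R -> R) v : measurable_fun setT r ->
  measurable_fun setT (fun a => poisson_pmf (r a) v).
Proof.
move=> mr; apply: (measurableT_comp (f := fun r : R => poisson_pmf r v)) => //.
exact: measurable_poisson_pmf.
Qed.

Lemma measurable_input_pmf i v : measurable_fun setT (input_pmf i v).
Proof.
case: i => [[i|k]|].
- case: v => [|[|v]]; [exact: measurable_funB|exact: measurable_id|exact: measurable_cst].
- exact: measurable_cst.
- exact: measurable_poisson_rate measurable_stat_rate.
Qed.

Lemma input_pmf_ge0 i v a : 0 < a < 1 -> 0 <= input_pmf i v a.
Proof.
move=> /andP[a0 a1]; case: i => [[i|k]|] /=; try exact: poisson_pmf_ge0.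
by case: v => [|[|v]] //=; [rewrite subr_ge0 ltW|exact: ltW].
Qed.

Let cyl (s : seq idx) (y : idx -> nat) : set T :=
  \bigcap_(i in [set` s]) (Y i @^-1` [set y i]).

Let mYi i : measurable_fun setT (Y i).
Proof. by case: i => [[[k j]|k]|]; exact: measurable_funP. Qed.

Let mY1 i v : measurable (Y i @^-1` [set v]).
Proof. exact: measurable_preimage. Qed.

Let mcyl s y : measurable (cyl s y).
Proof. by apply: fin_bigcap_measurable => // i _; exact: mY1. Qed.

Let malpha B : measurable B -> measurable (alpha @^-1` B).
Proof. by move=> mB; exact: measurable_preimage. Qed.

Let prod_pmf (s : seq idx) (y : idx -> nat) (a : R) : R :=
  \prod_(i <- s) input_pmf i (y i) a.

Let mprod s y : measurable_fun setT (prod_pmf s y).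
Proof. by apply: measurable_prod => i _; exact: measurable_input_pmf. Qed.

Let prod_ge0 s y a : 0 < a < 1 -> 0 <= prod_pmf s y a.
Proof. by move=> ha; apply: prodr_ge0 => i _; exact: input_pmf_ge0. Qed.

(** Given alpha, the event E has probability g(alpha) and is independent of the
    inputs with index in J, all of which take their prescribed laws.  Stated for
    point events only, this propagates along the recursion by intersections
    and countable disjoint unions. *)
Definition cond_density (E : set T) (g : R -> R) (J : pred idx) : Prop :=
  [/\ measurable E, measurable_fun setT g, (forall a, 0 < a < 1 -> 0 <= g a) &
    forall s y B, uniq s -> {subset s <= J} -> measurable B ->
      P (E `&` cyl s y `&` alpha @^-1` B) =
      (\int[P]_(w in alpha @^-1` B) (g (alpha w) * prod_pmf s y (alpha w))%:E)%E].

Lemma cond_densityW E g g' J J' : cond_density E g J ->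
  measurable_fun setT g' -> (forall a, 0 < a < 1 -> g a = g' a) ->
  {subset J' <= J} -> cond_density E g' J'.
Proof.
move=> [mE mg g0 h] mg' gg' J'J; split => //.
  by move=> a ha; rewrite -gg'// g0.
move=> s y B us sJ mB; rewrite h// => [|i is_]; last exact/J'J/sJ.
by apply: eq_integral => w _; rewrite gg'.
Qed.

(** For thinning variables, the masses of 0 and 1 being 1 - alpha and alpha
    leave nothing for the other values. *)
Let input_cond_prob i v :
  is_cond_probability P alpha (Y i @^-1` [set v]) (fun w => input_pmf i v (alpha w)).
Proof.
case: i => [[[k j]|k]|] /=; [|exact: (inar1_eps H)|exact: (inar1_X0 H)].
case: v => [|[|v]] /=; [exact: (inar1_xi0 H)|exact: (inar1_xi1 H)|].
have p0 := inar1_xi0 H k j; have p1 := inar1_xi1 H k j.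
have pv : P (xi k j @^-1` [set v.+2]) = 0%E.
  have m01 v' : measurable (xi k j @^-1` [set v']) by exact: measurable_preimage.
  have ii v' : (\int[P]_(w in alpha @^-1` setT) (\1_(xi k j @^-1` [set v']) w)%:E =
      P (xi k j @^-1` [set v']))%E.
    by rewrite preimage_setT integral_indic// setIT.
  case: p0 => _ _ /(_ setT measurableT); case: p1 => _ _ /(_ setT measurableT).
  rewrite !ii preimage_setT => h1 h0.
  have : (P (xi k j @^-1` [set 0%N]) + P (xi k j @^-1` [set 1%N]) = 1)%E.
    rewrite h0 h1 -ge0_integralD//=.
    - under eq_integral do rewrite -EFinD subrK.
      by rewrite integral_cst// mul1e; exact: probability_setT.
    - by move=> w _; rewrite lee_fin subr_ge0; case/andP: (a01 w) => _ /ltW.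
    - by apply/measurable_EFinP; exact: measurable_funB.
    - by move=> w _; rewrite lee_fin; case/andP: (a01 w) => /ltW.
    - exact/measurable_EFinP.
  rewrite -measureU//; last first.
    by apply/seteqP; split => // w [/= -> ].
  move=> h; have := probability_setC P (measurableU _ _ (m01 0%N) (m01 1%N)).
  rewrite h subee// => h2.
  apply/eqP; rewrite eq_le measure_ge0 andbT -h2; apply: le_measure.
  - by rewrite inE.
  - by rewrite inE; apply: measurableC; exact: measurableU.
  - by move=> w /= ->; case.
split.
- exact: measurable_cst.
- exact: aeW.
- move=> B mB; rewrite integral_indic; last 2 first.
    exact: malpha.
    exact: measurable_preimage.
  rewrite integral0; apply/eqP; rewrite eq_le measure_ge0 andbT.
  rewrite -pv; apply: le_measure; rewrite ?inE//.
  - by apply: measurableI; [exact: measurable_preimage|exact: malpha].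
  - exact: measurable_preimage.
Qed.

Lemma cond_density_init : cond_density setT (fun=> 1) predT.
Proof.
split => // s y B us _ mB; rewrite setTI.
have := inar1_indep H us (B := fun i => [set y i])
  (fun i _ => input_cond_prob i (y i)).
case=> _ _ /(_ B mB); rewrite integral_indic; [|exact: malpha|exact: (mcyl s y)].
move=> h; transitivity (P (cyl s y `&` alpha @^-1` B)); first by [].
rewrite h; apply: eq_integral => w _; by rewrite mul1r.
Qed.

(** Fixing the value of an input uses it up: it leaves J and contributes its
    weight to g. *)
Lemma cond_density_step E g (J : pred idx) i v : cond_density E g J -> J i ->
  cond_density (E `&` Y i @^-1` [set v]) (fun a => g a * input_pmf i v a)
    [pred j | J j & j != i].
Proof.
move=> [mE mg g0 h] Ji; split.
- exact: measurableI.
- by apply: measurable_funM => //; exact: measurable_input_pmf.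
- by move=> a ha; rewrite mulr_ge0 ?g0// input_pmf_ge0.
- move=> s y B us sJ mB.
  have is_ : i \notin s by apply/negP => /sJ; rewrite inE /= eqxx andbF.
  pose y' j := if j == i then v else y j.
  have yy' j : j \in s -> y' j = y j.
    by rewrite /y'; case: eqP => // -> js; rewrite js in is_.
  have -> : E `&` Y i @^-1` [set v] `&` cyl s y = E `&` cyl (i :: s) y'.
    rewrite -setIA; congr (_ `&` _); apply/seteqP; split => w /=.
      move=> [Yi c] j /=; rewrite in_cons => /orP[/eqP ->|js].
        by rewrite /y' eqxx.
      by rewrite yy'//; exact: c.
    move=> c; split; first by have := c i; rewrite /= mem_head /y' eqxx; exact.
    by move=> j /= js; have := c j; rewrite /= in_cons js orbT yy'//; exact.
  rewrite h//=.
  - apply: eq_integral => w _; rewrite /prod_pmf big_cons /y' eqxx.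
    congr EFin; rewrite -mulrA; congr (_ * (_ * _)).
    rewrite [LHS]big_seq [RHS]big_seq; apply: eq_bigr => j js.
    by rewrite -/(y' j) yy'.
  - by rewrite is_ us.
  - by move=> j; rewrite in_cons => /orP[/eqP ->//|/sJ]; rewrite inE => /andP[].
Qed.

Lemma cond_density_bigcup (E : nat -> set T) (g : nat -> R -> R) g0 J :
  (forall n, cond_density (E n) (g n) J) -> trivIset setT E ->
  measurable_fun setT g0 ->
  (forall a, 0 < a < 1 -> (\sum_(0 <= n <oo) (g n a)%:E)%E = (g0 a)%:E) ->
  cond_density (\bigcup_n E n) g0 J.
Proof.
move=> h tE mg0 gg0; split => //.
- by apply: bigcup_measurable => n _; case: (h n).
- move=> a ha; rewrite -lee_fin -gg0//; apply: nneseries_ge0 => n _ _.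
  by rewrite lee_fin; case: (h n) => _ _ /(_ a ha).
- move=> s y B us sJ mB.
  have mE n : measurable (E n `&` (cyl s y `&` alpha @^-1` B)).
    by apply: measurableI; [case: (h n)|apply: measurableI; [exact: mcyl|exact: malpha]].
  rewrite -setIA setI_bigcupl measure_semi_bigcup//; last 2 first.
  + exact: trivIset_setIr.
  + by apply: bigcup_measurable => n _; exact: mE.
  transitivity (\sum_(0 <= n <oo) \int[P]_(w in alpha @^-1` B) (g n (alpha w) * prod_pmf s y (alpha w))%:E)%E.
    by apply: eq_eseriesr => n _; case: (h n) => _ _ _ <-//; rewrite setIA.
  rewrite -integral_nneseries//; last 3 first.
  + exact: malpha.
  + move=> n; apply/measurable_EFinP/measurable_funTS.
    apply: (measurableT_comp (f := fun a => g n a * prod_pmf s y a)) => //.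
    by apply: measurable_funM => //; case: (h n).
  + move=> n w _; rewrite lee_fin mulr_ge0 ?prod_ge0//.
    by case: (h n) => _ _ /(_ _ (a01 w)).
  apply: eq_integral => w _; rewrite EFinM -gg0//.
  rewrite muleC -nneseriesZl//.
  + by apply: eq_eseriesr => n _; rewrite -EFinM mulrC.
  + by move=> n _; rewrite lee_fin; case: (h n) => _ _ /(_ _ (a01 w)).
Qed.

Lemma cond_density0 J : cond_density set0 (fun=> 0) J.
Proof.
split => // s y B _ _ mB; rewrite !set0I measure0.
by under eq_integral do rewrite mul0r; rewrite integral0.
Qed.

(** A sum S + Y i with a fresh input splits according to the value of Y i, which
    gives the convolution of the weights. *)
Lemma cond_density_conv E (S : T -> nat) (g : nat -> R -> R) (J : pred idx) i : J i ->
  (forall u, cond_density (E `&` S @^-1` [set u]) (g u) J) ->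
  forall u, cond_density (E `&` (fun w => (S w + Y i w)%N) @^-1` [set u])
    (fun a => \sum_(v < u.+1) g (u - v)%N a * input_pmf i v a)
    [pred j | J j & j != i].
Proof.
move=> Ji h u.
pose En v := if (v <= u)%N then E `&` S @^-1` [set (u - v)%N] `&` Y i @^-1` [set v] else set0.
pose gn v a := if (v <= u)%N then g (u - v)%N a * input_pmf i v a else 0.
have -> : E `&` (fun w => (S w + Y i w)%N) @^-1` [set u] = \bigcup_v En v.
  apply/seteqP; split => w.
    move=> [Ew /= Su]; exists (Y i w) => //; rewrite /En.
    rewrite -Su leq_addl; split => //; split => //=.
    by rewrite addnK.
  move=> [v _]; rewrite /En; case: ifP => // vu [[Ew /= Sw] Yw]; split => //=.
  by rewrite Sw Yw subnK.
apply: (cond_density_bigcup (g := gn)).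
- move=> v; rewrite /En /gn; case: ifP => _; last exact: cond_density0.
  exact: cond_density_step.
- apply/trivIsetP => v v' _ _ vv'; rewrite /En.
  case: ifP => _; last by rewrite set0I.
  case: ifP => _; last by rewrite setI0.
  apply/seteqP; split => // w /= [[_ Yv] [_ Yv']]; move: vv'.
  by rewrite -Yv -Yv' eqxx.
- apply: measurable_sum => v; apply: measurable_funM; last exact: measurable_input_pmf.
  by case: (h (u - v)%N).
- move=> a ha; rewrite (nneseries_split 0 u.+1)%N; last first.
    move=> v _; rewrite lee_fin /gn; case: ifP => // _.
    by rewrite mulr_ge0 ?input_pmf_ge0//; case: (h (u - v)%N) => _ _ /(_ a ha).
  rewrite eseries0 ?adde0; last first.
    by move=> v /=; rewrite add0n /gn ltnNge => /negbTE -> .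
  rewrite add0n big_mkord sumEFin; congr EFin; apply: eq_bigr => v _.
  by rewrite /gn -ltnS ltn_ord.
Qed.

Let X : nat -> T -> nat := inar1 X0 (fun k j => xi k j) eps.

(** The inputs that the recursion has not read when it has computed X_k. *)
Let Jk (k : nat) : pred idx := fun i =>
  match i with
  | None => false
  | Some (inl kj) => (k <= kj.1)%N
  | Some (inr k') => (k <= k')%N
  end.

Let notxi (k m : nat) : pred idx := fun i =>
  if i is Some (inl kj) then ~~ ((kj.1 == k) && (kj.2 < m)%N) else true.

Lemma bern_binomial (a : R) m u :
  \sum_(v < u.+1) binomial_pmf m a (u - v)%N * bern_pmf a v = binomial_pmf m.+1 a u.
Proof.
case: u => [|u].
  by rewrite big_ord1 /= !binomial_pmfE !bin0 !subn0 !expr0 !mul1r !mulr1n exprSr.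
rewrite !big_ord_recl /= big1 ?addr0; last by move=> i _; rewrite mulr0.
rewrite subn0 /bump /= subSS subn0 !binomial_pmfE binS mulrnDr subSS.
congr (_ + _); last by rewrite mulrnAl mulrC mulrA -exprS.
have [um|mu] := ltnP u m; last by rewrite bin_small ?ltnS// !mulr0n mul0r.
by rewrite mulrnAl -mulrA -exprSr (subnSK um).
Qed.

Lemma measurable_binomial (m u : nat) :
  measurable_fun setT (fun a : R => binomial_pmf m a u).
Proof. exact: measurable_binomial_pmf. Qed.

(** The number of survivors among m individuals is binomial; the m thinning
    variables are added one at a time. *)
Lemma thin_density E g (J : pred idx) k m u : cond_density E g J ->
  (forall j, J (Some (inl (k, j)))) ->
  cond_density (E `&` (fun w => \sum_(j < m) xi k j w)%N @^-1` [set u])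
    (fun a => g a * binomial_pmf m a u)
    [pred i | J i & notxi k m i].
Proof.
move=> hE hJ; have mg : measurable_fun setT g by case: hE.
have mgb m' u' : measurable_fun setT (fun a => g a * binomial_pmf m' a u').
  by apply: measurable_funM => //; exact: measurable_binomial.
elim: m u => [|m IH] u.
  have S0 : (fun w => \sum_(j < 0) xi k j w)%N = cst 0%N.
    by apply/funext => w; rewrite big_ord0.
  case: u => [|u].
    rewrite (_ : _ `&` _ = E); last first.
      by rewrite S0; apply/seteqP; split => w //=; case.
    apply: cond_densityW hE _ _ _ => //.
      by move=> a _; rewrite binomial_pmfE bin0 mulr1n !expr0 !mulr1.
    by move=> i /andP[].
  rewrite (_ : _ `&` _ = set0); last first.
    by rewrite S0; apply/seteqP; split => w //=; case.
  apply: cond_densityW (cond_density0 xpredT) _ _ _ => //.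
  by move=> a _; rewrite binomial_pmfE bin0n mulr0n mulr0.
have Ji : [pred i | J i & notxi k m i] (Some (inl (k, m))).
  by rewrite /= hJ /= eqxx ltnn.
have := cond_density_conv Ji IH u.
rewrite (_ : (fun w => (\sum_(j < m) xi k j w + Y (Some (inl (k, m))) w)%N) =
             (fun w => \sum_(j < m.+1) xi k j w)%N); last first.
  by apply/funext => w; rewrite big_ord_recr.
move=> h; apply: cond_densityW h _ _ _ => //.
  move=> a _; rewrite -bern_binomial mulr_sumr.
  by apply: eq_bigr => v _; rewrite mulrA.
move=> i /andP[Ji' ni]; rewrite !inE Ji' /=.
case: i Ji' ni => [[[k' j]|k']|] //= _; rewrite ltnS leq_eqVlt.
case: (k' =P k) => [->|kk _] /=; last by apply/eqP => -[].
by rewrite negb_or => /andP[jm ->] /=; apply: contra jm => /eqP[->].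
Qed.

Let thinned k w : nat := (\sum_(j < X k w) xi k j w)%N.

Let stationary_density k x :=
  cond_density (X k @^-1` [set x]) (fun a => poisson_pmf (stat_rate a) x) (Jk k).

(** Split according to the value m of X_k and apply Poisson thinning: since
    X_k is Poisson with mean rate(a), the survivors are Poisson with mean
    a rate(a). *)
Lemma thinned_density k : (forall x, stationary_density k x) ->
  forall u, cond_density (thinned k @^-1` [set u])
    (fun a => poisson_pmf (stat_rate a * a) u)
    [pred i | Jk k.+1 i || (i == Some (inr k))].
Proof.
move=> h u.
pose E m := X k @^-1` [set m] `&` (fun w => \sum_(j < m) xi k j w)%N @^-1` [set u].
have -> : thinned k @^-1` [set u] = \bigcup_m E m.
  apply/seteqP; split => w.
    by move=> tu; exists (X k w).
  by move=> [m _ [/= Xm Sm]]; rewrite /thinned Xm.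
apply: (cond_density_bigcup (g := fun m a => poisson_pmf (stat_rate a) m * binomial_pmf m a u)).
- move=> m; apply: cond_densityW (thin_density m u (h m) _) _ _ _ => //.
  + by move=> j /=.
  + apply: measurable_funM; last exact: measurable_binomial.
    exact: measurable_poisson_rate measurable_stat_rate.
  + move=> [[[k' j]|k']|] /=; rewrite !inE//=.
      by rewrite orbF => kk; rewrite ltnW//= gtn_eqF.
    by move=> /orP[/ltnW ->//|/eqP[->]]; rewrite leqnn.
- apply/trivIsetP => m m' _ _ mm'; apply/seteqP; split => w // [[/= Xm _] [Xm' _]].
  by move: mm'; rewrite -Xm -Xm' eqxx.
- apply: measurable_poisson_rate; apply: measurable_funM => //.
  exact: measurable_stat_rate.
- move=> a /[dup] ha /andP[a0 a1].
  rewrite -(poisson_thinning _ (stat_rate_gt0 a1) ha).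
  by apply: eq_eseriesr => m _; rewrite mulrC.
Qed.

(** Survivors Poisson(a rate(a)) and immigrants Poisson(lambda) are independent
    given alpha = a, and a rate(a) + lambda = rate(a). *)
Lemma inar_stationary k x : stationary_density k x.
Proof.
elim: k x => [|k IH] x.
  have h := cond_density_step x cond_density_init (isT : predT (None : idx)).
  rewrite /stationary_density (_ : X 0 @^-1` _ = setT `&` Y None @^-1` [set x]); last by rewrite setTI.
  apply: cond_densityW h _ _ _.
  - exact: measurable_poisson_rate measurable_stat_rate.
  - by move=> a _; rewrite mul1r.
  - by move=> [[[k' j]|k']|] //=; rewrite !inE.
have hJ : [pred i | Jk k.+1 i || (i == Some (inr k))] (Some (inr k) : idx).
  by rewrite /= eqxx orbT.
have hS u : cond_density (setT `&` thinned k @^-1` [set u])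
    (fun a => poisson_pmf (stat_rate a * a) u)
    [pred i | Jk k.+1 i || (i == Some (inr k))].
  by rewrite setTI; exact: thinned_density.
have := cond_density_conv hJ hS x; rewrite setTI => h.
apply: cond_densityW h _ _ _.
- exact: measurable_poisson_rate measurable_stat_rate.
- move=> a /andP[a0 a1]; have m0 := stat_rate_gt0 a1.
  have E : stat_rate a * a + lambda = stat_rate a.
    by rewrite /stat_rate; field; rewrite subr_eq0 gt_eqF.
  transitivity (poisson_pmf (stat_rate a * a + lambda) x); last by rewrite E.
  exact: (poisson_convolution x (mulr_gt0 m0 a0) lambda0).
- move=> [[[k' j]|k']|] //=; rewrite !inE ?orbF ?andbT//.
  rewrite unfold_in /= => kk; rewrite kk /=; apply/eqP => -[] kE.
  by rewrite kE ltnn in kk.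
Qed.

(** Those who die are selected with probability 1 - a, hence are Poisson with
    mean (1 - a) rate(a) = lambda, which no longer depends on a. *)
Lemma deaths_density k dd :
  cond_density [set w | (thinned k w + dd)%N = X k w] (fun=> poisson_pmf lambda dd) pred0.
Proof.
pose E m := if (dd <= m)%N then
  X k @^-1` [set m] `&` (fun w => \sum_(j < m) xi k j w)%N @^-1` [set (m - dd)%N] else set0.
pose g m a := if (dd <= m)%N then
  poisson_pmf (stat_rate a) m * binomial_pmf m a (m - dd) else 0.
have -> : [set w | (thinned k w + dd)%N = X k w] = \bigcup_m E m.
  apply/seteqP; split => w /=.
    move=> tX; exists (X k w) => //; rewrite /E -{1}tX leq_addl; split => //=.
    by rewrite -/(thinned k w) -tX addnK.
  move=> [m _]; rewrite /E; case: ifP => // dm [/= Xm].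
  by rewrite /thinned Xm => ->; rewrite subnK.
apply: (cond_density_bigcup (g := g)).
- move=> m; rewrite /E /g; case: ifP => _; last exact: cond_density0.
  apply: cond_densityW (thin_density m (m - dd) (inar_stationary k m) _) _ _ _ => //.
    by move=> j /=.
  apply: measurable_funM; last exact: measurable_binomial.
  exact: measurable_poisson_rate measurable_stat_rate.
- apply/trivIsetP => m m' _ _ mm'; rewrite /E.
  case: ifP => _; last by rewrite set0I.
  case: ifP => _; last by rewrite setI0.
  apply/seteqP; split => w // [[/= Xm _] [Xm' _]].
  by move: mm'; rewrite -Xm -Xm' eqxx.
- by [].
- move=> a /[dup] ha /andP[a0 a1].
  have ha' : 0 < 1 - a < 1 by rewrite subr_gt0 a1 ltrBlDr ltrDl.
  have -> : lambda = stat_rate a * (1 - a).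
    by rewrite /stat_rate divfK// subr_eq0 gt_eqF.
  rewrite -(poisson_thinning _ (stat_rate_gt0 a1) ha').
  apply: eq_eseriesr => m _; congr EFin; rewrite /g; case: ifP => dm.
    rewrite mulrC; congr (_ * _).
    by rewrite !binomial_pmfE bin_sub// subKn// [1 - (1 - a)]subKr mulrC.
  by rewrite binomial_pmfE bin_small ?mulr0n ?mul0r// ltnNge dm.
Qed.

End inar_law.

(** * Moments of increments and of truncated values *)

Lemma measurable_nat_comp d d' (T : measurableType d) (S : measurableType d')
    (Y : T -> nat) (h : nat -> S) :
  (forall x, measurable (Y @^-1` [set x])) -> measurable_fun setT (h \o Y).
Proof.
move=> mY _ B mB; rewrite setTI.
rewrite (_ : _ @^-1` B = \bigcup_(x in h @^-1` B) (Y @^-1` [set x])); last first.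
  apply/seteqP; split => w /=; first by move=> hB; exists (Y w).
  by move=> [x hx /= ->].
by apply: bigcup_measurable => x _; exact: mY.
Qed.

Section joint.
Context {d} {T : measurableType d} {R : realType} (P : probability T R).
Variables (A : T -> R) (Y : T -> nat) (p : nat -> R -> R).
Hypothesis mA : measurable_fun setT A.
Hypothesis mY : forall x, measurable (Y @^-1` [set x]).
Hypothesis mp : forall x, measurable_fun setT (p x).
Hypothesis p0 : forall x w, 0 <= p x (A w).
Hypothesis law : forall x B, measurable B ->
  P (Y @^-1` [set x] `&` A @^-1` B) = (\int[P]_(w in A @^-1` B) (p x (A w))%:E)%E.

(** Decompose according to the value of Y; each term is an integral weighted by
    an indicator. *)
Lemma joint_law (phi : R -> nat -> R) :
  (forall x, measurable_fun setT (phi ^~ x)) -> (forall a x, 0 <= phi a x) ->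
  (\int[P]_w (phi (A w) (Y w))%:E =
   \int[P]_w \sum_(0 <= x <oo) (phi (A w) x * p x (A w))%:E)%E.
Proof.
move=> mphi phi0.
have mphiA x : measurable_fun setT (fun w => phi (A w) x).
  exact: (measurableT_comp (mphi x)).
transitivity (\int[P]_w \sum_(0 <= x <oo) (phi (A w) x * \1_(Y @^-1` [set x]) w)%:E)%E.
  apply: eq_integral => w _; rewrite (nneseriesD1 (n := Y w))//; last first.
    by move=> x _; rewrite lee_fin mulr_ge0.
  rewrite indicE mem_set// mulr1 eseries0 ?adde0// => x _ /= xY.
  rewrite indicE memNset ?mulr0//= => Yx; by rewrite Yx eqxx in xY.
rewrite integral_nneseries//; last 2 first.
- by move=> x; apply/measurable_EFinP; apply: measurable_funM.
- by move=> x w _; rewrite lee_fin mulr_ge0.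
rewrite integral_nneseries//; last 2 first.
- move=> x; apply/measurable_EFinP; apply: measurable_funM => //.
  exact: (measurableT_comp (mp x)).
- by move=> x w _; rewrite lee_fin mulr_ge0.
apply: eq_eseriesr => x _.
have W := @integral_weighted_eq _ _ _ _ _ _ _ P P A A (\1_(Y @^-1` [set x]))
  (fun w => p x (A w)) mA mA (measurable_indic (mY x)) (measurableT_comp (mp x) mA)
  _ _ _ (phi ^~ x).
apply: W => //.
move=> B mB; rewrite integral_indic//; first exact: law.
exact: measurable_preimage.
Qed.

End joint.

Section poisson_rv.
Context {d} {T : measurableType d} {R : realType} (P : probability T R).
Local Notation int f := (P.-integrable setT (EFin \o f)).

Lemma poisson_rv_moments (Y : T -> nat) (lambda : R) : 0 < lambda ->
  (forall x, measurable (Y @^-1` [set x])) ->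
  (forall x, P (Y @^-1` [set x]) = (poisson_pmf lambda x)%:E) ->
  int (fun w => (Y w)%:R ^+ 2) /\ \int[P]_w (Y w)%:R = lambda.
Proof.
move=> l0 mY law.
have mYR : measurable_fun setT (fun w => (Y w)%:R : R).
  exact: measurable_nat_comp.
have e (g : nat -> R) : (forall x, 0 <= g x) ->
    (\int[P]_w (g (Y w))%:E = Epois lambda g)%E.
  move=> g0.
  rewrite (@joint_law _ _ _ P (cst 0) Y (fun x _ => poisson_pmf lambda x) _ mY _ _ _
    (fun _ => g))//.
  - by rewrite integral_cst//= -[RHS]mule1; congr (_ * _)%E; exact: probability_setT.
  - by move=> x w; exact: poisson_pmf_ge0.
  - move=> x B mB; rewrite integral_cst/=; last first.
      by rewrite preimage_cst; case: ifP.
    rewrite preimage_cst; case: ifP => _.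
      by rewrite setIT law -[LHS]mule1; congr (_ * _)%E; rewrite -(probability_setT P).
    by rewrite setI0 !measure0 mule0.
split.
- apply/integrableP; split.
    by apply/measurable_EFinP; exact: measurable_funX.
  under eq_integral do rewrite /= ger0_norm ?sqr_ge0//.
  rewrite (e (fun x => x%:R ^+ 2)); last by move=> x; rewrite sqr_ge0.
  by rewrite Epois_sq// ltry.
- by rewrite /Rintegral (e (fun x => x%:R))// Epois_id.
Qed.

End poisson_rv.

Section truncation.
Context {R : realType}.

Definition trunc_ind (delta a : R) : R := (a <= 1 - delta)%R%:R.

Lemma measurable_trunc_ind delta : measurable_fun setT (trunc_ind delta).
Proof.
have -> : trunc_ind delta = \1_`]-oo, 1 - delta].
  apply/funext => a; rewrite indicE /trunc_ind.
  case: (leP a (1 - delta)) => h; first by rewrite mem_set//= in_itv.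
  by rewrite memNset//= in_itv/= leNgt h.
by apply: measurable_indic; exact: measurable_itv.
Qed.

Lemma trunc_ind01 delta a : 0 <= trunc_ind delta a <= 1.
Proof. by rewrite /trunc_ind; case: (a <= _) => /=; rewrite ?lexx ?ler01. Qed.

Lemma trunc_indX delta a n : trunc_ind delta a ^+ n.+1 = trunc_ind delta a.
Proof. by rewrite /trunc_ind; case: (a <= _); rewrite ?expr1n ?expr0n. Qed.

(** Truncation makes the unbounded rate bounded, by a multiple of 1 / delta. *)
Lemma trunc_rate_le (lambda delta a : R) : 0 < lambda -> 0 < delta -> a < 1 ->
  stat_rate lambda a * trunc_ind delta a <= lambda / delta.
Proof.
move=> l0 d0 a1; rewrite /trunc_ind.
case: (leP a (1 - delta)) => h; last by rewrite mulr0 divr_ge0 ?ltW.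
rewrite mulr1 /stat_rate ler_pM2l// lef_pV2 ?posrE ?subr_gt0//.
by rewrite lerBrDl addrC -lerBrDl.
Qed.

Lemma integrable_trunc_rate d (T : measurableType d) (P : probability T R)
    (alpha : T -> R) (lambda delta : R) :
  measurable_fun setT alpha -> (forall w, 0 < alpha w < 1) ->
  0 < lambda -> 0 < delta ->
  P.-integrable setT
    (EFin \o (fun w => stat_rate lambda (alpha w) * trunc_ind delta (alpha w))).
Proof.
move=> ma a01 l0 d0.
apply: (@dominated_integrable _ _ _ _ _ (fun=> lambda / delta)).
- apply: measurable_funM.
    exact: (measurableT_comp (measurable_stat_rate lambda)).
  exact: (measurableT_comp (measurable_trunc_ind delta)).
- exact: integrable_cstR.
- move=> w; have [_ a1] := andP (a01 w).
  by rewrite ger0_norm ?trunc_rate_le// mulr_ge0// ?(ltW (stat_rate_gt0 _ _)).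
Qed.

End truncation.

Section inar_consequences.
Context {d} {T : measurableType d} {R : realType} (P : probability T R).
Variables (lambda : R) (alpha : {RV P >-> R})
    (X0 : {RV P >-> nat}) (xi : nat -> nat -> {RV P >-> nat})
    (eps : nat -> {RV P >-> nat}).
Local Notation int f := (P.-integrable setT (EFin \o f)).
Hypothesis lambda0 : 0 < lambda.
Hypothesis H : randomized_inar1_inputs lambda alpha X0 xi eps.

Local Notation X := (inar1 X0 (fun k j => xi k j) eps).
Local Notation rate := (stat_rate lambda).

Let a01 w : 0 < alpha w < 1 := inar1_alpha01 H w.

Lemma measurable_inar k x : measurable (X k @^-1` [set x]).
Proof. by case: (inar_stationary lambda0 H k x). Qed.

Lemma cond_density_law E g J B : cond_density lambda alpha X0 xi eps E g J ->
  measurable B ->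
  P (E `&` alpha @^-1` B) = (\int[P]_(w in alpha @^-1` B) (g (alpha w))%:E)%E.
Proof.
move=> [_ _ _ h] mB; have := h [::] (fun=> 0%N) B isT (fun _ => ltac:(by [])) mB.
rewrite (_ : bigcap _ _ = setT) ?setIT; last by apply/seteqP; split => // w _ i.
by move=> ->; apply: eq_integral => w _; rewrite big_nil mulr1.
Qed.

Lemma inar_law k x B : measurable B ->
  P (X k @^-1` [set x] `&` alpha @^-1` B) =
  (\int[P]_(w in alpha @^-1` B) (poisson_pmf (rate (alpha w)) x)%:E)%E.
Proof. by move=> mB; exact: (cond_density_law (inar_stationary lambda0 H k x) mB). Qed.

Lemma inar_joint k (phi : R -> nat -> R) :
  (forall x, measurable_fun setT (phi ^~ x)) -> (forall a x, 0 <= phi a x) ->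
  (\int[P]_w (phi (alpha w) (X k w))%:E =
   \int[P]_w Epois (rate (alpha w)) (phi (alpha w)))%E.
Proof.
move=> mphi phi0.
apply: (@joint_law _ _ _ P alpha (X k) (fun x a => poisson_pmf (rate a) x)) => //.
- exact: measurable_inar.
- by move=> x; exact: measurable_poisson_rate (measurable_stat_rate _).
- by move=> x w; exact: poisson_pmf_ge0.
- by move=> x B mB; exact: inar_law.
Qed.

(** The subtraction is truncated: the thinning variables are 0 or 1 only almost
    surely, so survivors may outnumber X_k on the null event bad k. *)
Let deaths k w : nat := (X k w - \sum_(j < X k w) xi k j w)%N.
Let survivors k w : nat := (\sum_(j < X k w) xi k j w)%N.
Let Dset k v := [set w | (survivors k w + v)%N = X k w].

Let mDset k v : measurable (Dset k v).
Proof. by case: (deaths_density lambda0 H k v). Qed.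

Let PDset k v : P (Dset k v) = (poisson_pmf lambda v)%:E.
Proof.
have := cond_density_law (deaths_density lambda0 H k v) measurableT.
rewrite preimage_setT setIT => ->.
by rewrite integral_cst// -[RHS]mule1; congr (_ * _)%E; exact: probability_setT.
Qed.

Let bad k := ~` \bigcup_v Dset k v.

Let mbad k : measurable (bad k).
Proof. by apply: measurableC; exact: bigcup_measurable. Qed.

Let bad0 k : P (bad k) = 0%E.
Proof.
rewrite probability_setC; last exact: bigcup_measurable.
rewrite measure_semi_bigcup//; last 2 first.
- apply/trivIsetP => v v' _ _ vv'; apply/seteqP; split => // w [/= h h'].
  by move: vv'; rewrite -(eqn_add2l (survivors k w)) h h' eqxx.
- exact: bigcup_measurable.
rewrite (_ : (\sum_(i <oo) _)%E = 1%E) ?subee//.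
rewrite -(Epois1 lambda0); apply: eq_eseriesr => v _.
by rewrite mul1r; exact: PDset.
Qed.

Let badE k w : bad k w <-> (X k w < survivors k w)%N.
Proof.
split => [h|h [v _ /= E]].
  rewrite ltnNge; apply/negP => SX; apply: h; exists (X k w - survivors k w)%N => //=.
  by rewrite /Dset /= subnKC.
by move: h; rewrite -E ltnNge leq_addr.
Qed.

Let mdeaths k v : measurable (deaths k @^-1` [set v]) /\
  P (deaths k @^-1` [set v]) = (poisson_pmf lambda v)%:E.
Proof.
case: v => [|v].
  have -> : deaths k @^-1` [set 0%N] = Dset k 0 `|` bad k.
    apply/seteqP; split => w /=.
      move=> /eqP; rewrite subn_eq0 leq_eqVlt => /orP[/eqP h|h].
        by left; rewrite /Dset /= addn0.
      by right; apply/badE.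
    move=> [h|/badE h].
      by rewrite /deaths -/(survivors k w) -[X in (X - _)%N]h addn0 subnn.
    by apply/eqP; rewrite subn_eq0 ltnW.
  split; first exact: measurableU.
  by rewrite (measureU0 (mDset k 0) (mbad k) (bad0 k)); exact: PDset.
have -> : deaths k @^-1` [set v.+1] = Dset k v.+1.
  apply/seteqP; split => w /=; rewrite /deaths /Dset/= -/(survivors k w).
    by move=> h; rewrite -h subnKC// ltnW// -subn_gt0 h.
  by move=> <-; rewrite addKn.
by split => //; exact: PDset.
Qed.

Let eps_law k v : P (eps k @^-1` [set v]) = (poisson_pmf lambda v)%:E.
Proof.
case: (inar1_eps H k v) => _ _ /(_ setT measurableT).
rewrite preimage_setT integral_indic//; last exact: measurable_preimage.
rewrite setIT => ->.
by rewrite integral_cst// -[RHS]mule1; congr (_ * _)%E; exact: probability_setT.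
Qed.

Lemma measurable_inarR k : measurable_fun setT (fun w => (X k w)%:R : R).
Proof.
by apply: (measurable_nat_comp (fun n => n%:R : R)) => x; exact: measurable_inar.
Qed.

(** Outside bad k the increment is immigrants minus deaths, a difference of two
    Poisson(lambda) variables.  This is what makes it square integrable, while
    X_k itself may have infinite mean. *)
Lemma inar_increment k :
  int (fun w => ((X k.+1 w)%:R - (X k w)%:R) ^+ 2) /\
  \int[P]_w ((X k.+1 w)%:R - (X k w)%:R : R) = 0.
Proof.
have me v : measurable (eps k @^-1` [set v]) by exact: measurable_preimage.
have [ie Ee] := poisson_rv_moments lambda0 me (eps_law k).
have [iD ED] := poisson_rv_moments lambda0 (fun v => (mdeaths k v).1) (fun v => (mdeaths k v).2).
have meR : measurable_fun setT (fun w => (eps k w)%:R : R).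
  exact: (measurable_nat_comp (fun n => n%:R : R)).
have mDR : measurable_fun setT (fun w => (deaths k w)%:R : R).
  by apply: (measurable_nat_comp (fun n => n%:R : R)) => v; case: (mdeaths k v).
pose f w := (X k.+1 w)%:R - (X k w)%:R : R.
pose g w := (eps k w)%:R - (deaths k w)%:R : R.
have mf : measurable_fun setT f by apply: measurable_funB; exact: measurable_inarR.
have mg : measurable_fun setT g by exact: measurable_funB.
have fg : ae_eq P setT f g.
  exists (bad k); split; [exact: mbad|exact: bad0|].
  move=> w /= h; apply/badE; rewrite ltnNge; apply/negP => SX; apply: h => _.
  by rewrite /f /g /= -/(survivors k w) /deaths -/(survivors k w) natrB// natrD; ring.
have ig2 : int (fun w => g w ^+ 2).
  apply: (@dominated_integrable _ _ _ _ _ (fun w => 2 * (eps k w)%:R ^+ 2 + 2 * (deaths k w)%:R ^+ 2)).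
  - exact: measurable_funX.
  - by apply: integrable_addR; exact: integrable_scaleR.
  - move=> w; rewrite ger0_norm ?sqr_ge0//.
    have : 0 <= ((eps k w)%:R + (deaths k w)%:R : R) ^+ 2 by rewrite sqr_ge0.
    by rewrite /g sqrrB sqrrD; lra.
split.
- case/integrableP: ig2 => mg2 ig2; apply/integrableP; split.
    by apply/measurable_EFinP; exact: measurable_funX.
  apply: le_lt_trans ig2; rewrite le_eqVlt; apply/orP; left; apply/eqP.
  apply: ae_eq_integral => //.
  + apply: measurableT_comp => //; apply/measurable_EFinP; exact: measurable_funX.
  + exact: measurableT_comp.
  + by apply: filterS fg => w h /h E; rewrite /= -/(f w) E.
- have ie1 : int (fun w => (eps k w)%:R) by exact: integrable_of_sq.
  have iD1 : int (fun w => (deaths k w)%:R) by exact: integrable_of_sq.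
  transitivity (\int[P]_w g w).
    congr fine; apply: ae_eq_integral => //; [exact/measurable_EFinP|exact/measurable_EFinP|].
    by apply: filterS fg => w h /h; rewrite /f => ->.
  by rewrite RintegralB// Ee ED subrr.
Qed.

Lemma inar_displacement k :
  int (fun w => ((X k w)%:R - (X 0 w)%:R) ^+ 2) /\
  \int[P]_w ((X k w)%:R - (X 0 w)%:R : R) = 0.
Proof.
elim: k => [|k [i2 E]].
  split.
    under [Y in _.-integrable _ Y]eq_fun do rewrite /= subrr expr0n/=.
    exact: integrable_cstR.
  by under eq_Rintegral do rewrite subrr; rewrite Rintegral_cstP.
have [j2 F] := inar_increment k.
have mk k' k'' : measurable_fun setT (fun w => (X k' w)%:R - (X k'' w)%:R : R).
  by apply: measurable_funB; exact: measurable_inarR.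
have i1 : int (fun w => (X k w)%:R - (X 0 w)%:R) by exact: integrable_of_sq.
have j1 : int (fun w => (X k.+1 w)%:R - (X k w)%:R) by exact: integrable_of_sq.
have XE w : (X k.+1 w)%:R - (X 0 w)%:R =
    ((X k.+1 w)%:R - (X k w)%:R) + ((X k w)%:R - (X 0 w)%:R) :> R.
  by rewrite addrA subrK.
split; last first.
  by under eq_Rintegral do rewrite XE; rewrite RintegralD// E F addr0.
apply: (@dominated_integrable _ _ _ _ _ (fun w => 2 * ((X k.+1 w)%:R - (X k w)%:R) ^+ 2 +
   2 * ((X k w)%:R - (X 0 w)%:R) ^+ 2)).
- exact: measurable_funX.
- by apply: integrable_addR; exact: integrable_scaleR.
- move=> w; rewrite ger0_norm ?sqr_ge0// XE.
  move: (_ - _) (_ - _) => a b.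
  have : 0 <= (a - b) ^+ 2 by rewrite sqr_ge0.
  by rewrite sqrrB sqrrD; lra.
Qed.

Definition trunc_centered (delta a : R) (x : nat) : R :=
  (x%:R - rate a) * trunc_ind delta a.

Section trunc.
Variable delta : R.
Hypothesis delta0 : 0 < delta.
Let I w := trunc_ind delta (alpha w).
Let mu w := rate (alpha w).

Let mI : measurable_fun setT I.
Proof. exact: (measurableT_comp (measurable_trunc_ind delta)). Qed.

Let mmu : measurable_fun setT mu.
Proof. exact: (measurableT_comp (measurable_stat_rate lambda)). Qed.

Let mu0 w : 0 < mu w.
Proof. by rewrite stat_rate_gt0//; case/andP: (a01 w). Qed.

Let trunc_rate_leI w : mu w * I w <= lambda / delta.
Proof. by apply: trunc_rate_le => //; case/andP: (a01 w). Qed.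

Let irate : int (fun w => mu w * I w).
Proof. by apply: integrable_trunc_rate => //; exact: measurable_funP. Qed.

(** Conditional moments of X_k given alpha are Poisson moments of parameter
    rate(alpha), and truncation is a function of alpha. *)
Let phi_moment k (g : nat -> R -> R) (G : R -> R) :
  (forall x, measurable_fun setT (g x)) -> (forall x a, 0 <= g x a) ->
  (forall m, 0 < m -> Epois m (fun x => g x m) = (G m)%:E) ->
  (\int[P]_w (g (X k w) (mu w) * I w)%:E = \int[P]_w (G (mu w) * I w)%:E)%E.
Proof.
move=> mg g0 gG.
have i0 a : 0 <= trunc_ind delta a by case/andP: (trunc_ind01 delta a).
rewrite (inar_joint k (phi := fun a x => g x (rate a) * trunc_ind delta a)).
- apply: eq_integral => w _; rewrite -/(mu w) -/(I w).
  rewrite (eq_Epois _ (h := fun x => I w * g x (mu w))); last by move=> x; rewrite mulrC.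
  by rewrite EpoisZ ?i0// gG// -EFinM mulrC.
- move=> x; apply: measurable_funM; last exact: measurable_trunc_ind.
  exact: (measurableT_comp (mg x) (measurable_stat_rate lambda)).
- by move=> a x; rewrite mulr_ge0.
Qed.

Lemma trunc_moment2 k :
  (\int[P]_w (trunc_centered delta (alpha w) (X k w) ^+ 2)%:E =
   \int[P]_w (mu w * I w)%:E)%E.
Proof.
rewrite -(@phi_moment k (fun x m => (x%:R - m) ^+ 2) (fun m => m)).
- by apply: eq_integral => w _; rewrite /trunc_centered exprMn trunc_indX.
- by move=> x; apply: measurable_funX; exact: measurable_funB.
- by move=> x a; rewrite sqr_ge0.
- exact: Epois_variance.
Qed.

Lemma trunc_moment4 k :
  (\int[P]_w (trunc_centered delta (alpha w) (X k w) ^+ 4)%:E =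
   \int[P]_w ((3 * mu w ^+ 2 + mu w) * I w)%:E)%E.
Proof.
rewrite -(@phi_moment k (fun x m => (x%:R - m) ^+ 4) (fun m => 3 * m ^+ 2 + m)).
- by apply: eq_integral => w _; rewrite /trunc_centered exprMn trunc_indX.
- by move=> x; apply: measurable_funX; exact: measurable_funB.
- by move=> x a; rewrite (exprM _ 2 2) sqr_ge0.
- exact: Epois_central4.
Qed.

(** The conditional fourth central moment is 3 mu^2 + mu, and mu <= lambda / delta
    on the truncation event. *)
Lemma trunc_moment4_le k :
  int (fun w => trunc_centered delta (alpha w) (X k w) ^+ 4) /\
  \int[P]_w trunc_centered delta (alpha w) (X k w) ^+ 4 <=
  (3 * lambda / delta + 1) * \int[P]_w (mu w * I w).
Proof.
have mt : measurable_fun setT (fun w => trunc_centered delta (alpha w) (X k w)).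
  apply: measurable_funM; last exact: mI.
  by apply: measurable_funB; [exact: measurable_inarR|exact: mmu].
have I0 w : 0 <= I w by case/andP: (trunc_ind01 delta (alpha w)).
have bnd w : (3 * mu w ^+ 2 + mu w) * I w <= (3 * lambda / delta + 1) * (mu w * I w).
  rewrite (_ : _ * I w = (3 * (mu w * I w) + 1) * (mu w * I w)); last first.
    have : I w ^+ 2 = I w by exact: trunc_indX.
    move=> h; transitivity (3 * mu w ^+ 2 * I w ^+ 2 + mu w * I w); last by ring.
    by rewrite h; ring.
  apply: ler_wpM2r; first by rewrite mulr_ge0// ltW.
  by rewrite lerD2r -mulrA ler_wpM2l// trunc_rate_leI.
have ib := integrable_scaleR (3 * lambda / delta + 1) irate.
have i4 : int (fun w => (3 * mu w ^+ 2 + mu w) * I w).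
  apply: dominated_integrable ib _.
    apply: measurable_funM => //; apply: measurable_funD => //.
    by apply: measurable_funM => //; exact: measurable_funX.
  move=> w; rewrite ger0_norm ?bnd//; have m0 := ltW (mu0 w).
  by apply: mulr_ge0 => //; apply: addr_ge0 => //; apply: mulr_ge0 => //; exact: sqr_ge0.
split.
- apply/integrableP; split; first by apply/measurable_EFinP; exact: measurable_funX.
  under eq_integral do rewrite /= (exprM _ 2 2) ger0_norm ?sqr_ge0// -(exprM _ 2 2).
  rewrite trunc_moment4.
  exact: (integrable_lty measurableT i4).
- rewrite {1}/Rintegral trunc_moment4 -/(Rintegral _ _ _).
  rewrite -RintegralZl//.
  by apply: le_Rintegral.
Qed.

Lemma trunc_mean0 k : \int[P]_w trunc_centered delta (alpha w) (X k w) = 0.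
Proof.
have E : (\int[P]_w ((X k w)%:R * I w)%:E = \int[P]_w (mu w * I w)%:E)%E.
  rewrite -(@phi_moment k (fun x _ => x%:R) (fun m => m))//.
  exact: Epois_id.
have i1 := irate.
have I0 w : 0 <= I w by case/andP: (trunc_ind01 delta (alpha w)).
have iX : int (fun w => (X k w)%:R * I w).
  apply/integrableP; split.
    by apply/measurable_EFinP; apply: measurable_funM => //; exact: measurable_inarR.
  under eq_integral do rewrite /= ger0_norm ?mulr_ge0//.
  rewrite E; exact: (integrable_lty measurableT i1).
under eq_Rintegral do rewrite /trunc_centered mulrBl.
by rewrite RintegralB// {1}/Rintegral E subrr.
Qed.

End trunc.

Lemma inar_cond_mean k B : measurable B ->
  (\int[P]_(w in alpha @^-1` B) ((X k w)%:R : R)%:E =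
   \int[P]_(w in alpha @^-1` B) (rate (alpha w))%:E)%E.
Proof.
move=> mB; rewrite [LHS]integral_mkcond [RHS]integral_mkcond.
transitivity (\int[P]_w (\1_B (alpha w) * (X k w)%:R)%:E)%E.
  apply: eq_integral => w _; rewrite patchE indicE (_ : (w \in _) = (alpha w \in B))//.
  by case: ifP; rewrite ?mul1r ?mul0r.
rewrite (inar_joint k (phi := fun a x => \1_B a * x%:R)).
- apply: eq_integral => w _; rewrite patchE indicE (_ : (w \in _) = (alpha w \in B))//.
  rewrite EpoisZ//= Epois_id ?stat_rate_gt0//; last by case/andP: (a01 w).
  by case: ifP; rewrite ?mul1e ?mul0e.
- by move=> x; apply: measurable_funM => //; exact: measurable_indic.
- by move=> a x; rewrite mulr_ge0// indicE.
Qed.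

End inar_consequences.

(** * The truncated mean rate grows like a logarithm *)

Lemma integral_inv_onem {R : realType} (eta delta : R) : 0 < delta -> delta < eta ->
  (\int[lebesgue_measure]_(x in `](1 - eta)%R, (1 - delta)%R]) ((1 - x)^-1)%:E =
   (ln eta - ln delta)%:E)%E.
Proof.
move=> d0 de; have e0 := lt_trans d0 de.
have cont (x : R) : x < 1 -> {for x, continuous (fun x : R => (1 - x)^-1)}.
  move=> x1; apply: cvgV; first by rewrite gt_eqF// subr_gt0.
  by apply: cvgB; [exact: cvg_cst|exact: cvg_id].
have D (x : R) : x < 1 -> is_derive x (1 : R) (fun x : R => - ln (1 - x)) (1 - x)^-1.
  move=> x1; have x10 : 0 < 1 - x by rewrite subr_gt0.
  have h1 : is_derive x (1 : R) (fun x : R => 1 - x) (- 1).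
    have := @is_deriveB _ _ _ _ _ _ _ _ _ (is_derive_cst (1 : R) x (1 : R)) (is_derive_id x (1 : R)).
    by rewrite sub0r.
  have h0 : is_derive ((fun x : R => 1 - x) x) (1 : R) (@ln R) (1 - x)^-1 by exact: is_derive1_ln.
  have h := @is_derive1_comp _ (@ln R) (fun x : R => 1 - x) _ _ _ h0 h1.
  have := is_deriveN h => h2; apply: (is_derive_eq (f := fun x : R => - ln (1 - x)) h2).
  by rewrite mulrN1 opprK.
have lt1 (x : R) : x <= 1 - delta -> x < 1.
  by move=> h; rewrite (le_lt_trans h)// ltrBlDr ltrDl.
rewrite integral_itv_obnd_cbnd; last first.
  apply/measurable_EFinP; apply: measurable_funTS.
  by apply: (measurableT_comp measurable_invr); exact: measurable_funB.
rewrite (@continuous_FTC2 _ _ (fun x => - ln (1 - x))).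
- by rewrite !subKr -EFinB opprK addrC.
- by rewrite ltrD2l ltrN2.
- apply: continuous_in_subspaceT => x /set_mem; rewrite /= in_itv/= => /andP[_ h].
  exact/cont/lt1.
- have dc (x : R) : x < 1 -> {for x, continuous (fun x : R => - ln (1 - x))}.
    move=> x1; apply: differentiable_continuous; apply/derivable1_diffP.
    by case: (D x x1).
  split.
  + by move=> x; rewrite in_itv/= => /andP[_ /ltW/lt1 h]; case: (D x h).
  + by apply: cvg_at_right_filter; apply: dc; rewrite ltrBlDr ltrDl.
  + by apply: cvg_at_left_filter; apply: dc; rewrite ltrBlDr ltrDl.
- move=> x; rewrite in_itv/= => /andP[_ /ltW/lt1 h].
  by rewrite derive1E; case: (D x h).
Qed.

Lemma cvg_inv_ln_nat {R : realType} : (ln N%:R)^-1 @[N --> \oo] --> (0 : R).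
Proof.
have lny : ln N%:R @[N --> \oo] --> (+oo : set_system R).
  apply/cvgryPge => A; near=> N.
  have eN : expR A <= N%:R by near: N; exact: nbhs_infty_ger.
  by rewrite -[A]expRK ler_ln ?posrE ?expR_gt0// (lt_le_trans _ eN)// expR_gt0.
rewrite gtr0_cvgV0//; near=> N; rewrite ln_gt0// ltr1n.
by near: N; exact: nbhs_infty_gt.
Unshelve. all: by end_near. Qed.

Section density.
Context {d} {T : measurableType d} {R : realType} (P : probability T R).
Notation leb := (@lebesgue_measure R).
Local Notation int f := (P.-integrable setT (EFin \o f)).
Variables (alpha : T -> R) (lambda psi1 : R) (psi : R -> R).
Hypothesis malpha : measurable_fun setT alpha.
Hypothesis a01 : forall w, 0 < alpha w < 1.
Hypothesis lambda0 : 0 < lambda.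
Hypothesis psi10 : 0 < psi1.
Hypothesis dens : has_density_on P alpha `]0, 1[ (fun x => psi x * (1 - x) `^ 0).
Hypothesis psi_cvg : psi x @[x --> 1^'-] --> psi1.

Let f x := psi x * (1 - x) `^ 0.
Let fE x : f x = psi x. Proof. by rewrite /f powRr0 mulr1. Qed.

Lemma density_integral (g : R -> R) : measurable_fun setT g -> (forall x, 0 <= g x) ->
  (\int[P]_w (g (alpha w))%:E = \int[leb]_(x in `]0%R, 1%R[) (g x * psi x)%:E)%E.
Proof.
move=> mg g0; case: dens => mf f0 law.
have m01 : measurable (`]0, 1[%classic : set R) by exact: measurable_itv.
pose Y2 : R -> R := f \_ `]0, 1[.
have mY2 : measurable_fun setT Y2 by exact/(measurable_restrictT _ m01).
have Y20 x : 0 <= Y2 x by rewrite /Y2 patchE; case: ifP => // /set_mem/f0.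
transitivity (\int[P]_w (g (alpha w) * 1)%:E)%E.
  by apply: eq_integral => w _; rewrite mulr1.
rewrite (@integral_weighted_eq _ _ _ _ _ _ _ P leb alpha id (fun=> 1) Y2 malpha
  (@measurable_id _ _ setT) (@measurable_cst _ _ _ _ setT (1 : R)) mY2 _ Y20 _ g mg g0)//.
- rewrite [RHS]integral_mkcond; apply: eq_integral => x _.
  rewrite /Y2 !patchE; case: ifP => _; last by rewrite mulr0.
  by rewrite fE.
- move=> B mB; rewrite integral_cst ?mul1e; last exact: measurable_preimage.
  transitivity (P (alpha @^-1` B)); first by [].
  rewrite law// integral_mkcondr; apply: eq_integral => x _.
  by rewrite /Y2 !patchE; case: ifP.
Qed.

Let psi_near e : 0 < e -> exists2 eta : R, 0 < eta < 1 &
  forall x, 1 - eta < x < 1 -> `|psi x - psi1| <= e.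
Proof.
move=> e0; move/cvgrPdist_le : psi_cvg => /(_ e e0).
rewrite /at_left near_withinE => /nbhs_normP [r /= r0 h].
exists (Num.min (r / 2) (1 / 2)).
  by rewrite lt_min gt_min !divr_gt0//=; apply/orP; right; lra.
move=> x /andP[x1 x2]; rewrite distrC; apply: h => //=.
rewrite ger0_norm ?subr_ge0 ?ltW// ltrBlDr -ltrBlDl (lt_trans _ x1)// ltrD2l ltrN2.
by rewrite gt_min; apply/orP; left; lra.
Qed.

Lemma tail_prob : exists2 eta : R, 0 < eta < 1 & forall delta, 0 < delta < eta ->
  (P [set w | (1 - delta < alpha w)%R] <= ((psi1 + 1) * delta)%:E)%E.
Proof.
have [eta eta01 h] := psi_near ltr01; exists eta => // delta /andP[d0 de].
have [e0 e1] := andP eta01.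
case: dens => mf f0 law.
have -> : [set w | 1 - delta < alpha w] = alpha @^-1` `]1 - delta, 1[.
  apply/seteqP; split => w /=; rewrite in_itv/= => hw; last by case/andP: hw.
  by rewrite hw; case/andP: (a01 w).
rewrite law; last exact: measurable_itv.
have -> : `]1 - delta, 1[%classic `&` `]0, 1[%classic = `]1 - delta, 1[%classic :> set R.
  apply: setIidl => x /=; rewrite !in_itv/= => /andP[x1 x2].
  by rewrite x2 andbT (lt_trans _ x1)// subr_gt0 (lt_trans de).
apply: (@le_trans _ _ (\int[leb]_(x in `](1 - delta)%R, 1%R[) (psi1 + 1)%:E)%E).
  apply: ge0_le_integral => //.
  - by move=> x; rewrite /= in_itv/= => /andP[x1 x2]; rewrite lee_fin f0//= in_itv/= x2 andbT (lt_trans _ x1)// subr_gt0 (lt_trans de).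
  - apply/measurable_EFinP; apply: measurable_funS mf; first exact: measurable_itv.
    move=> x /=; rewrite !in_itv/= => /andP[x1 x2].
    by rewrite x2 andbT (lt_trans _ x1)// subr_gt0 (lt_trans de).
  - move=> x; rewrite /= in_itv/= => /andP[x1 x2]; rewrite lee_fin -/(f x) fE.
    have := h x; rewrite x2 andbT (lt_trans _ x1)/=; last by rewrite ltrD2l ltrN2.
    by move=> /(_ isT); rewrite ler_distl => /andP[_].
rewrite integral_cst; last exact: measurable_itv.
have lm : leb (`](1 - delta), 1[%classic : set R) = delta%:E.
  rewrite lebesgue_measure_itv/= lte_fin ltrBlDr ltrDl d0 -EFinD.
  by rewrite opprB addrCA subrr addr0.
by rewrite [X in ((psi1 + 1)%:E * X)%E](_ : _ = delta%:E).
Qed.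

Let rate := stat_rate lambda.
Definition trunc_mean delta := \int[P]_w (rate (alpha w) * trunc_ind delta (alpha w)).

Let itrunc delta : 0 < delta -> int (fun w => rate (alpha w) * trunc_ind delta (alpha w)).
Proof. by move=> d0; exact: integrable_trunc_rate. Qed.

(** Only alpha near 1 matters: beyond 1 - eta the density lies between psi1 - e
    and psi1 + e, and lambda / (1 - x) integrates to lambda (ln eta - ln delta)
    over the interval from 1 - eta to 1 - delta.  What is left of 1 - eta
    contributes the constant K. *)
Lemma trunc_mean_bounds e : 0 < e < psi1 -> exists eta K : R, 0 < eta < 1 /\
  forall delta, 0 < delta < eta ->
  lambda * (psi1 - e) * (ln eta - ln delta) <= trunc_mean delta
    <= K + lambda * (psi1 + e) * (ln eta - ln delta).
Proof.
move=> /andP[e0 ep]; have [eta eta01 h] := psi_near e0.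
have [eta0 eta1] := andP eta01.
exists eta, (trunc_mean eta); split => // delta /andP[d0 de].
pose g x := rate x * \1_`]1 - eta, 1 - delta] x.
have mitv : measurable (`]1 - eta, 1 - delta]%classic : set R) by exact: measurable_itv.
have mg : measurable_fun setT g.
  apply: measurable_funM; first exact: measurable_stat_rate.
  exact: measurable_indic.
have gE w : rate (alpha w) * trunc_ind delta (alpha w) =
    rate (alpha w) * trunc_ind eta (alpha w) + g (alpha w).
  rewrite /g -mulrDr; congr (_ * _); rewrite /trunc_ind indicE.
  have [h1|h1] := leP (alpha w) (1 - eta).
    rewrite (le_trans h1) ?lerD2l ?lerN2 ?(ltW de)// memNset ?addr0//=.
    by rewrite in_itv/= ltNge h1.
  rewrite add0r; have [h2|h2] := leP (alpha w) (1 - delta).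
    by rewrite mem_set//= in_itv/= h1.
  by rewrite memNset//= in_itv/= h1 leNgt h2.
have ig : int (fun w => g (alpha w)).
  have := integrableB measurableT (itrunc d0) (itrunc eta0).
  apply: eq_integrable => // w _; rewrite /= -EFinB; congr EFin.
  by rewrite gE addrC addKr.
have -> : trunc_mean delta = trunc_mean eta + \int[P]_w g (alpha w).
  rewrite /trunc_mean; under eq_Rintegral do rewrite gE.
  by rewrite RintegralD//; exact: itrunc.
have tm0 : 0 <= trunc_mean eta.
  apply: Rintegral_ge0 => w _; case/andP: (a01 w) => _ a1.
  by rewrite mulr_ge0// ltW// stat_rate_gt0.
have lt1 (x : R) : x <= 1 - delta -> x < 1.
  by move=> hx; rewrite (le_lt_trans hx)// ltrBlDr ltrDl.
have sub01 : `]1 - eta, 1 - delta]%classic `<=` (`]0, 1[%classic : set R).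
  move=> x /=; rewrite !in_itv/= => /andP[x1 x2]; rewrite lt1// andbT.
  by rewrite (lt_trans _ x1)// subr_gt0.
have m01 : measurable (`]0, 1[%classic : set R) by exact: measurable_itv.
have g0 x : x <= 1 -> 0 <= g x.
  move=> x1; rewrite mulr_ge0 ?indicE// /rate /stat_rate divr_ge0 ?subr_ge0// ltW//.
have mpsi : measurable_fun (`]0, 1[%classic : set R) psi.
  by case: dens => mf _ _; apply: eq_measurable_fun mf => x _; exact: fE.
have EG : (\int[P]_w (g (alpha w))%:E =
    \int[leb]_(x in `](1 - eta)%R, (1 - delta)%R]) (lambda / (1 - x) * psi x)%:E)%E.
  transitivity (\int[P]_w (`|g (alpha w)|)%:E)%E.
    apply: eq_integral => w _; rewrite ger0_norm// g0// ltW//.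
    by case/andP: (a01 w).
  rewrite (density_integral (g := fun x => `|g x|))//; last exact: measurableT_comp.
  rewrite [LHS]integral_mkcond [RHS]integral_mkcond; apply: eq_integral => x _.
  rewrite !patchE /g indicE.
  case: ifPn => h01; case: ifPn => hi //=.
  - rewrite mulr1 ger0_norm// /rate /stat_rate divr_ge0 ?(ltW lambda0)// subr_ge0.
    by move: h01; rewrite inE/= in_itv/= => /andP[_ /ltW].
  - by rewrite mulr0 normr0 mul0r.
  - by move: h01; rewrite (mem_set (sub01 x (set_mem hi))).
have mlam : measurable_fun (`]1 - eta, 1 - delta]%classic : set R) (fun x : R => lambda / (1 - x)).
  by apply: measurable_funTS; exact: measurable_stat_rate.
have mpsi' : measurable_fun (`]1 - eta, 1 - delta]%classic : set R) psi by exact: measurable_funS mpsi.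
have lo (c : R) : 0 <= c ->
    (\int[leb]_(x in `](1 - eta)%R, (1 - delta)%R]) (lambda / (1 - x) * c)%:E =
     (lambda * c * (ln eta - ln delta))%:E)%E.
  move=> c0; rewrite EFinM -integral_inv_onem//.
  rewrite -ge0_integralZl//.
  - by apply: eq_integral => x _; rewrite -EFinM; congr EFin; ring.
  - apply/measurable_EFinP; apply: measurable_funTS.
    by apply: (measurableT_comp measurable_invr); exact: measurable_funB.
  - move=> x; rewrite /= in_itv/= => /andP[_ x2].
    by rewrite lee_fin invr_ge0 subr_ge0 ltW// lt1.
  - by rewrite lee_fin mulr_ge0// ltW.
have pe x : (`]1 - eta, 1 - delta]%classic : set R) x ->
    [/\ 0 <= lambda / (1 - x), psi1 - e <= psi x & psi x <= psi1 + e].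
  rewrite /= in_itv/= => /andP[x1 x2].
  have := h x; rewrite x1 lt1//= => /(_ isT); rewrite ler_distl => /andP[? ?].
  by split => //; rewrite divr_ge0 ?(ltW lambda0)// subr_ge0 ltW// lt1.
have pe0 : 0 <= psi1 - e by rewrite subr_ge0 ltW.
have pe1 : 0 <= psi1 + e by rewrite addr_ge0// ltW.
have fin : (\int[P]_w (g (alpha w))%:E)%E \is a fin_num.
  exact: integrable_fin_num ig.
apply/andP; split.
- rewrite -[leLHS]add0r lerD// -lee_fin /Rintegral fineK// EG -lo//.
  apply: ge0_le_integral => //.
  + by move=> x /pe[? _ _]; rewrite lee_fin mulr_ge0.
  + by apply/measurable_EFinP; apply: measurable_funM.
  + by apply/measurable_EFinP; apply: measurable_funM.
  + by move=> x /pe[? ? _]; rewrite lee_fin ler_wpM2l.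
- rewrite lerD2l -lee_fin /Rintegral fineK// EG -lo//.
  apply: ge0_le_integral => //.
  + by move=> x /pe[? ? _]; rewrite lee_fin mulr_ge0// (le_trans pe0).
  + by apply/measurable_EFinP; apply: measurable_funM.
  + by apply/measurable_EFinP; apply: measurable_funM.
  + by move=> x /pe[? _ ?]; rewrite lee_fin ler_wpM2l.
Qed.

(** For delta = 1 / (b N), ln (1 / delta) = ln N + ln b, and the constants
    disappear after division by ln N. *)
Lemma trunc_mean_cvg (b : R) : 0 < b ->
  trunc_mean (b * N%:R)^-1 / ln N%:R @[N --> \oo] --> lambda * psi1.
Proof.
move=> b0.
have Linv : (ln N%:R)^-1 @[N --> \oo] --> (0 : R) by exact: cvg_inv_ln_nat.
apply/cvgrPdist_le => ep ep0.
pose e := Num.min (ep / (2 * lambda)) (psi1 / 2).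
have e0 : 0 < e by rewrite lt_min !divr_gt0// mulr_gt0.
have e1 : e < psi1.
  by rewrite gt_min; apply/orP; right; rewrite ltr_pdivrMr// ltr_pMr// ltr1n.
have le_ep : lambda * e < ep.
  apply: (@le_lt_trans _ _ (lambda * (ep / (2 * lambda)))).
    by rewrite ler_wpM2l ?(ltW lambda0)// ge_min lexx.
  rewrite (_ : lambda * _ = ep / 2); last by field; rewrite gt_eqF.
  lra.
have [|eta [K [/andP[eta0 _] h]]] := @trunc_mean_bounds e; first by rewrite e0.
pose k := ln eta + ln b.
have up : (K + lambda * (psi1 + e) * k) * (ln N%:R)^-1 + lambda * (psi1 + e) @[N --> \oo]
    --> 0 + lambda * (psi1 + e).
  apply: cvgD; last exact: cvg_cst.
  rewrite -(mulr0 (K + lambda * (psi1 + e) * k)).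
  by apply: cvgM => //; exact: cvg_cst.
have lo : lambda * (psi1 - e) * k * (ln N%:R)^-1 + lambda * (psi1 - e) @[N --> \oo]
    --> 0 + lambda * (psi1 - e).
  apply: cvgD; last exact: cvg_cst.
  rewrite -(mulr0 (lambda * (psi1 - e) * k)).
  by apply: cvgM => //; exact: cvg_cst.
have up' : 0 + lambda * (psi1 + e) < lambda * psi1 + ep by rewrite mulrDr; lra.
have lo' : lambda * psi1 - ep < 0 + lambda * (psi1 - e) by rewrite mulrBr; lra.
near=> N.
have N1 : 1 < N%:R :> R by rewrite ltr1n; near: N; exact: nbhs_infty_gt.
have N0 : 0 < N%:R :> R by rewrite (lt_trans _ N1).
have L0 : 0 < ln N%:R :> R by rewrite ln_gt0.
have dN : (b * N%:R)^-1 < eta.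
  rewrite -[ltRHS]invrK ltf_pV2 ?posrE ?invr_gt0 ?mulr_gt0// mulrC -ltr_pdivrMr//.
  by near: N; exact: nbhs_infty_gtr.
have := h (b * N%:R)^-1; rewrite dN invr_gt0 mulr_gt0// => /(_ isT).
rewrite lnV ?posrE ?mulr_gt0// lnM ?posrE// opprK addrA -/k => /andP[h1 h2].
rewrite ler_distlC; apply/andP; split.
- apply: (@le_trans _ _ (lambda * (psi1 - e) * k * (ln N%:R)^-1 + lambda * (psi1 - e))).
    by apply: ltW; near: N; exact: (cvgr_gt _ lo).
  rewrite ler_pdivlMr//; apply: le_trans h1; rewrite le_eqVlt; apply/orP; left.
  by apply/eqP; field; rewrite gt_eqF.
- apply: (@le_trans _ _ ((K + lambda * (psi1 + e) * k) * (ln N%:R)^-1 + lambda * (psi1 + e))); last first.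
    by apply: ltW; near: N; exact: (cvgr_lt _ up).
  rewrite ler_pdivrMr//; apply: (le_trans h2); rewrite le_eqVlt; apply/orP; left.
  by apply/eqP; field; rewrite gt_eqF.
Unshelve. all: by end_near. Qed.

End density.

(** * Uniqueness of conditional means, transfer between equal laws *)

Section cond_uniqueness.
Context {d} {T : measurableType d} {R : realType} (P : probability T R).
Variables (A : T -> R).
Hypothesis mA : measurable_fun setT A.
Local Notation TA := (g_sigma_algebra_preimageType A).

Lemma preimage_measurable_fun (M : T -> R) :
  measurable_fun [set: TA] M -> measurable_fun setT M.
Proof.
move=> mM _ B mB; have [C mC CE] := mM measurableT B mB.
by rewrite -CE; exact: mA.
Qed.

(** The bound K makes M integrable on this event, which belongs to the sigma-algebra
    of A.  There M' - M is positive with integral 0, so the event is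
    negligible. *)
Lemma cond_mean_le (M M' : T -> R) K :
  measurable_fun [set: TA] M -> measurable_fun [set: TA] M' ->
  (forall B, measurable B ->
    (\int[P]_(w in A @^-1` B) (M w)%:E = \int[P]_(w in A @^-1` B) (M' w)%:E)%E) ->
  P.-negligible [set w | 0 <= M w <= K /\ M w < M' w].
Proof.
move=> mM mM' H; set E := [set w | _].
have mEA : measurable (E : set TA).
  have -> : E = (M @^-1` `[0, K]) `&` (fun w => M' w - M w) @^-1` `]0, +oo[ :> set TA.
    apply/seteqP; split => w; rewrite /E /= !in_itv/= andbT subr_gt0 //.
  apply: measurableI; rewrite -[X in measurable X]setTI.
    by apply: mM => //; exact: measurable_itv.
  by apply: (measurable_funB mM' mM) => //; exact: measurable_itv.
have [B mB] := mEA; rewrite setTI => BE.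
have mE : measurable E by rewrite -BE; exact: measurable_preimage.
have mMT := preimage_measurable_fun mM.
have mMT' := preimage_measurable_fun mM'.
have iM : P.-integrable E (EFin \o M).
  apply: measurable_bounded_integrable => //.
  - by rewrite (le_lt_trans (probability_le1 _ _))// ltry.
  - exact: measurable_funTS.
  - exists `|K|; split; first exact: num_real.
    move=> x Kx w [/andP[M0 MK] _]; rewrite /= ger0_norm//.
    by rewrite (le_trans MK)// (le_trans (ler_norm K))// ltW.
have M0 w : E w -> 0 <= M w by move=> [/andP[]].
have M'0 w : E w -> 0 <= M' w by move=> Ew; rewrite (le_trans (M0 w Ew))// ltW//; case: Ew.
have HE := H B mB; rewrite BE in HE.
have iM' : P.-integrable E (EFin \o M').
  apply/integrableP; split; first by apply/measurable_EFinP; exact: measurable_funTS.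
  rewrite (_ : integral _ _ _ = \int[P]_(w in E) (M' w)%:E)%E; last first.
    by apply: eq_integral => w /set_mem Ew; rewrite /= ger0_norm// M'0.
  rewrite -HE; exact: integrable_lty iM.
have I0 : (\int[P]_(w in E) `|(M' w - M w)%:E|)%E = 0%E.
  transitivity (\int[P]_(w in E) ((M' w)%:E - (M w)%:E))%E.
    apply: eq_integral => w /set_mem [_ MM'].
    by rewrite -EFinB /= ger0_norm// subr_ge0 ltW.
  by rewrite integralB// HE subee//; exact: integrable_fin_num iM'.
have mD : measurable_fun E (fun w => (M' w - M w)%:E).
  by apply/measurable_EFinP; apply: measurable_funTS; exact: measurable_funB.
have /(ae_eq_integral_abs P mE mD)/negligibleS : (\int[P]_(w in E) `|(M' w - M w)%:E|)%E = 0%E by [].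
apply => w Ew /= /(_ Ew) /eqP; rewrite eqe subr_eq0 => /eqP MM'.
by case: Ew => _; rewrite MM' ltxx.
Qed.

(** M and M' may have infinite integrals; the events where they differ are
    therefore exhausted by events on which the smaller one is bounded. *)
Lemma cond_mean_unique (M M' : T -> R) :
  measurable_fun [set: TA] M -> measurable_fun [set: TA] M' ->
  {ae P, forall w, 0 <= M w} -> (forall w, 0 <= M' w) ->
  (forall B, measurable B ->
    (\int[P]_(w in A @^-1` B) (M w)%:E = \int[P]_(w in A @^-1` B) (M' w)%:E)%E) ->
  {ae P, forall w, M w = M' w}.
Proof.
move=> mM mM' M0 M'0 H.
have Hs B : measurable B ->
    (\int[P]_(w in A @^-1` B) (M' w)%:E = \int[P]_(w in A @^-1` B) (M w)%:E)%E.
  by move=> mB; rewrite H.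
have N1 : P.-negligible (\bigcup_(k : nat) [set w | 0 <= M w <= k%:R /\ M w < M' w]).
  by apply: negligible_bigcup => k; exact: cond_mean_le.
have N2 : P.-negligible (\bigcup_(k : nat) [set w | 0 <= M' w <= k%:R /\ M' w < M w]).
  by apply: negligible_bigcup => k; exact: cond_mean_le.
apply: negligibleS (negligibleU M0 (negligibleU N1 N2)) => w /= MM'.
have [Mw|nMw] := pselect (0 <= M w); last by left.
have nat_le (x : R) : 0 <= x -> exists k : nat, x <= k%:R.
  by move=> x0; exists (Num.truncn x).+1; rewrite ltW// truncnS_gt.
right; case: (ltgtP (M w) (M' w)) => h; last by [].
- by left; have [k hk] := nat_le _ Mw; exists k => //=; rewrite Mw.
- by right; have [k hk] := nat_le _ (M'0 w); exists k => //=; rewrite M'0.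
Qed.

End cond_uniqueness.

Section transfer.
Context {d d1 d2} {S : measurableType d} {T1 : measurableType d1}
  {T2 : measurableType d2} {R : realType}.
Variables (P1 : probability T1 R) (P2 : probability T2 R).
Variables (V1 : T1 -> S) (V2 : T2 -> S).
Hypotheses (mV1 : measurable_fun setT V1) (mV2 : measurable_fun setT V2).
Hypothesis law : same_law P1 V1 P2 V2.

Lemma same_law_integral (Phi : S -> \bar R) (D : set S) : measurable D ->
  measurable_fun D Phi -> (forall x, D x -> 0 <= Phi x)%E ->
  (\int[P1]_(w in V1 @^-1` D) Phi (V1 w) = \int[P2]_(w in V2 @^-1` D) Phi (V2 w))%E.
Proof.
move=> mD mPhi Phi0.
pose W1 : {mfun T1 >-> S} := HB.pack V1 (isMeasurableFun.Build _ _ _ _ V1 mV1).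
pose W2 : {mfun T2 >-> S} := HB.pack V2 (isMeasurableFun.Build _ _ _ _ V2 mV2).
have p0 : {in D, forall y, (0 <= Phi y)%E} by move=> y /set_mem /Phi0.
transitivity (\int[distribution P1 W1]_(x in D) Phi x)%E.
  by rewrite /distribution ge0_integral_pushforward.
transitivity (\int[distribution P2 W2]_(x in D) Phi x)%E; last first.
  by rewrite /distribution ge0_integral_pushforward.
by apply: eq_measure_integral => E mE _; exact: law.
Qed.

Lemma same_law_integrable (Phi : S -> R) : measurable_fun setT Phi ->
  P2.-integrable setT (EFin \o (Phi \o V2)) ->
  P1.-integrable setT (EFin \o (Phi \o V1)) /\
  \int[P1]_w Phi (V1 w) = \int[P2]_w Phi (V2 w).
Proof.
move=> mPhi /integrableP[_ fin].
have H g : measurable_fun setT g -> (forall x, 0 <= g x)%E ->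
    (\int[P1]_w g (V1 w) = \int[P2]_w g (V2 w))%E.
  by move=> mg g0; have := @same_law_integral g setT measurableT mg (fun x _ => g0 x).
have mE : measurable_fun setT (EFin \o Phi) by exact/measurable_EFinP.
split.
  apply/integrableP; split.
    by apply/measurable_EFinP; exact: measurableT_comp.
  by rewrite (H (fun x => `|(Phi x)%:E|)%E)//; exact: measurableT_comp.
rewrite /Rintegral; congr fine; rewrite !(integralE _ _ (fun w => (Phi _)%:E)).
have Hp := H ((EFin \o Phi)^\+)%E (measurable_funepos mE) (fun x => funepos_ge0 _ x).
have Hn := H ((EFin \o Phi)^\-)%E (measurable_funeneg mE) (fun x => funeneg_ge0 _ x).
by congr (_ - _)%E; [move: Hp|move: Hn] => h;
  (etransitivity; [|etransitivity; [exact: h|]]); apply: eq_integral => w _;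
  rewrite ?funeposE ?funenegE.
Qed.

End transfer.

(** * Measurability and continuity of finite-dimensional functionals *)

Lemma measurable_coef_trajectory {d} {T : measurableType d} {R : realType}
    (alpha : T -> R) (X : nat -> T -> nat) :
  measurable_fun setT alpha -> (forall k x, measurable (X k @^-1` [set x])) ->
  measurable_fun setT (coef_trajectory alpha X).
Proof.
move=> malpha mX.
have mXs : measurable_fun setT (fun w => X^~ w : g_sigma_algebraType cylinders).
  apply: (@measurability _ _ T (g_sigma_algebraType cylinders) setT (fun w => X^~ w)
    cylinders erefl) => _ [_ [k [B ->]] <-].
  rewrite setTI (_ : _ @^-1` _ = \bigcup_(x in B) (X k @^-1` [set x])); last first.
    by apply/seteqP; split => w /=; [move=> Bx; exists (X k w)|move=> [x Bx /= ->]].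
  by apply: bigcup_measurable.
exact: measurable_fun_pair.
Qed.

Lemma measurable_coef_coord {R : realType} k :
  measurable_fun setT (fun v : R * g_sigma_algebraType cylinders => (v.2 k)%:R : R).
Proof.
apply: (measurableT_comp (f := fun x : g_sigma_algebraType cylinders => (x k)%:R : R) _
  measurable_snd).
move=> _ B mB; rewrite setTI; apply: sub_sigma_algebra.
by exists k, [set x | B x%:R].
Qed.

Section rows.
Context {R : realType} (m : nat).

Lemma row_mx_norm_le (u : 'rV[R]_m) e : 0 <= e ->
  (`|u| <= e) <-> (forall i, `|u ord0 i| <= e).
Proof.
move=> e0; rewrite (_ : `|u| = mx_norm u)// mx_normrE; split.
  move=> h i; apply: le_trans h; exact: (le_bigmax _ (fun ij : 'I_1 * 'I_m => `|u ij.1 ij.2|) (ord0, i)).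
move=> h; apply/bigmax_leP; split => // -[i j] _ /=.
by rewrite (ord1 i).
Qed.

(** Rounding the coordinates down to multiples of 1 / (q + 1) gives functions of
    countably many values, hence measurable ones, which converge pointwise as
    f is continuous. *)
Lemma measurable_row_comp {d} {T : measurableType d} (f : 'rV[R]_m -> R)
    (y : 'I_m -> T -> R) : continuous f -> (forall i, measurable_fun setT (y i)) ->
  measurable_fun setT (fun w => f (\row_i y i w)).
Proof.
move=> cf my.
pose fl (q : nat) (x : R) : int := Num.floor (q.+1%:R * x).
pose yq q w : 'rV[R]_m := \row_i ((fl q (y i w))%:~R / q.+1%:R).
have mfl q i (z : int) : measurable [set w | fl q (y i w) = z].
  rewrite (_ : [set w | _] = setT `&` (fun w => q.+1%:R * y i w) @^-1` `[z%:~R, (z + 1)%:~R[).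
    by apply: measurable_funM.
  rewrite setTI; apply/seteqP; split => w /=; rewrite in_itv/=.
    by move=> <-; rewrite floor_le_tmp floorD1_gt.
  by move=> h; apply: floor_def.
apply: (@measurable_fun_cvg _ _ _ _ (fun q w => f (yq q w))) => [q|w _].
  move=> _ B mB; rewrite setTI.
  rewrite (_ : _ @^-1` B = \bigcup_(z : {ffun 'I_m -> int})
      ((\bigcap_i [set w | fl q (y i w) = z i]) `&`
       [set _ | B (f (\row_i ((z i)%:~R / q.+1%:R)))])); last first.
    apply/seteqP; split => w /=.
      move=> Bw; exists [ffun i => fl q (y i w)] => //; split => [i _|] /=; rewrite ?ffunE//.
      by under eq_mx do rewrite ffunE.
    move=> [z _ [/= hz]]; rewrite /yq (_ : \row__ _ = \row_i ((z i)%:~R / q.+1%:R))//.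
    by apply/rowP => i; rewrite !mxE hz.
  apply: countable_bigcupT_measurable => [|z]; first exact: countableP.
  apply: measurableI; first by apply: fin_bigcap_measurable => // i _; exact: mfl.
  have [Bz|nBz] := pselect (B (f (\row_i ((z i)%:~R / q.+1%:R)))).
    by rewrite (_ : [set _ | _] = setT)//; apply/seteqP; split.
  by rewrite (_ : [set _ | _] = set0)//; apply/seteqP; split.
apply: continuous_cvg; first exact: cf.
apply/cvgrPdist_le => e e0.
near=> q.
apply/row_mx_norm_le; first exact: ltW.
move=> i; rewrite !mxE.
have := floor_itv (q.+1%:R * y i w); rewrite -/(fl q (y i w)) => /andP[h1 h2].
have q0 : 0 < q.+1%:R :> R by [].
rewrite ger0_norm ?subr_ge0 ?ler_pdivrMr// 1?mulrC//.
apply: (@le_trans _ _ q.+1%:R^-1); last first.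
  by near: q; apply: filterS (near_infty_natSinv_lt (PosNum e0)) => q /ltW.
rewrite lerBlDl -[X in _ + X]mulr1 -mulrDr ler_pdivlMl// ltW//.
by move: h2; rewrite intrD.
Unshelve. all: by end_near. Qed.

(** A row whose coordinates are almost proportional to a is almost on the line
    directed by a, and the part of this line with |u| <= B is compact. *)
Lemma row_near_line (f : 'rV[R]_m -> R) (a : 'I_m -> R) (B e : R) :
  continuous f -> 0 < e -> exists2 eta : R, 0 < eta & forall (u : R) (y : 'rV[R]_m),
    `|u| <= B -> (forall i, `|y ord0 i - a i * u| <= eta) ->
    `|f y - f (\row_i (a i * u))| < e.
Proof.
move=> cf e0.
pose K : set 'rV[R]_m := [set v | forall i, `|v ord0 i| <= `|a i| * B].
have cK : compact K.
  rewrite (_ : K = [set v : 'rV[R]_m | forall i, `[(- (`|a i| * B)), (`|a i| * B)]%classic (v ord0 i)]).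
    apply: (@rV_compact _ _ (fun i => `[(- (`|a i| * B)), (`|a i| * B)]%classic)) => i.
    exact: segment_compact.
  by apply/seteqP; split => v /= h i; have := h i; rewrite /= in_itv/= ler_norml.
have [r r0 H] := uniform_continuity_on_compact cf cK e0.
exists (r / 2); first by rewrite divr_gt0.
move=> u y uB hy; apply: H.
  by move=> i; rewrite mxE normrM ler_wpM2l.
apply: (@le_lt_trans _ _ (r / 2)); last by rewrite ltr_pdivrMr// mulr_natr mulr2n ltrDl.
apply/row_mx_norm_le; first by rewrite ltW// divr_gt0.
by move=> i; rewrite !mxE hy.
Qed.

Lemma continuous_row_line (a : 'I_m -> R) (f : 'rV[R]_m -> R) :
  continuous f -> continuous (fun u => f (\row_i (a i * u))).
Proof.
move=> cf u; apply: (continuous_comp (f := fun u => \row_i (a i * u))); last exact: cf.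
apply/cvgrPdist_le => e e0.
have S0 : 0 < \sum_j `|a j| + 1 by rewrite ltr_wpDl// sumr_ge0.
have e'0 : 0 < e / (\sum_j `|a j| + 1) by rewrite divr_gt0.
have /cvgrPdist_le/(_ _ e'0) : v @[v --> u] --> u by exact: cvg_id.
apply: filterS => v uv.
apply/row_mx_norm_le; first exact: ltW.
move=> i; rewrite !mxE -mulrBr normrM.
rewrite ler_pdivlMr// mulrC in uv; apply: le_trans uv; rewrite ler_wpM2r//.
by rewrite (bigD1 i)//= -addrA lerDl addr_ge0// sumr_ge0.
Qed.

End rows.

(** * Independent copies: the limit in the number of copies *)

Lemma Rintegral_sum_seq {d} {T : measurableType d} {R : realType} (P : probability T R)
    (I : Type) (s : seq I) (g : I -> T -> R) :
  (forall i, P.-integrable setT (EFin \o g i)) ->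
  P.-integrable setT (EFin \o (fun w => \sum_(i <- s) g i w)) /\
  \int[P]_w \sum_(i <- s) g i w = \sum_(i <- s) \int[P]_w g i w.
Proof.
move=> ig; elim: s => [|i s [is_ IH]].
  split; first by under [Y in _.-integrable _ Y]eq_fun do rewrite /= big_nil;
    exact: integrable_cstR.
  by under eq_Rintegral do rewrite big_nil; rewrite big_nil Rintegral_cstP.
split.
  by under [Y in _.-integrable _ Y]eq_fun do rewrite /= big_cons; exact: integrable_addR.
by under eq_Rintegral do rewrite big_cons; rewrite RintegralD// IH big_cons.
Qed.

Section copies.
Context {R : realType} {d0 : measure_display} {T0 : measurableType d0}
  {P0 : probability T0 R} {d : measure_display} {T : measurableType d}
  {P : probability T R}.
Variables (lambda psi1 : R) (psi : R -> R)
    (alpha : {RV P0 >-> R}) (X0 : {RV P0 >-> nat})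
    (xi : nat -> nat -> {RV P0 >-> nat}) (eps : nat -> {RV P0 >-> nat})
    (alphac : nat -> {RV P >-> R}) (Xc : nat -> nat -> {RV P >-> nat})
    (M : nat -> nat -> T -> R).
Local Notation X := (inar1 X0 (fun k j => xi k j) eps).
Local Notation V j := (coef_trajectory (alphac j) (fun k => Xc j k)).
Local Notation V0 := (coef_trajectory alpha X).
Local Notation S := (R * g_sigma_algebraType cylinders)%type.
Local Notation rate := (stat_rate lambda).
Hypothesis lambda0 : 0 < lambda.
Hypothesis psi10 : 0 < psi1.
Hypothesis dens : has_density_on P0 alpha `]0, 1[ (fun x => psi x * (1 - x) `^ 0).
Hypothesis psi_cvg : psi x @[x --> 1^'-] --> psi1.
Hypothesis inputs : randomized_inar1_inputs lambda alpha X0 xi eps.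
Hypothesis law : forall j, same_law P (V j) P0 V0.
Hypothesis indep : mutually_independent P (fun j => V j).
Hypothesis condM : forall j k,
  is_cond_expectation P (alphac j) (fun w => (Xc j k w)%:R) (M j k).

Let a01 w : 0 < alpha w < 1 := inar1_alpha01 inputs w.
Let malpha : measurable_fun setT alpha. Proof. exact: measurable_funPT. Qed.
Let mac j : measurable_fun setT (alphac j). Proof. exact: measurable_funPT. Qed.

Let mXc j k x : measurable (Xc j k @^-1` [set x]).
Proof. exact: measurable_preimage. Qed.

Let mXcR j k : measurable_fun setT (fun w => (Xc j k w)%:R : R).
Proof. exact: (measurable_nat_comp (fun n => n%:R : R)). Qed.

Let mV j : measurable_fun setT (V j).
Proof. by apply: measurable_coef_trajectory => // k x; exact: mXc. Qed.

Let mV0 : measurable_fun setT V0.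
Proof. by apply: measurable_coef_trajectory => // k x; exact: measurable_inar inputs k x. Qed.

Let mrate : measurable_fun setT rate. Proof. exact: measurable_stat_rate. Qed.

Let mrateN : measurable_fun setT (fun a => `|rate a|).
Proof. exact: measurableT_comp. Qed.

Lemma copy_alpha_lt1 j : {ae P, forall w, alphac j w < 1}.
Proof.
exists (alphac j @^-1` `[1, +oo[); split.
- by apply: measurable_preimage; [exact: mac|exact: measurable_itv].
- have := @law j (fst @^-1` `[1, +oo[) _; rewrite (_ : V j @^-1` _ = alphac j @^-1` `[1, +oo[)//.
  move=> ->; last by rewrite -[X in measurable X]setTI; apply: measurable_fst => //; exact: measurable_itv.
  rewrite (_ : _ @^-1` _ = set0) ?measure0//; apply/seteqP; split => w //=.
  by rewrite in_itv/= andbT leNgt; case/andP: (a01 w) => _ ->.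
- by move=> w /= /negP; rewrite -leNgt in_itv/= andbT.
Qed.

(** The law of a copy determines the integrals of X_k over events of alpha, so
    rate(alpha) is a version of the conditional mean.  The absolute value makes
    it nonnegative everywhere: the alpha of a copy lies below 1 only almost
    surely. *)
Lemma copy_cond_mean j k : {ae P, forall w, M j k w = rate (alphac j w)}.
Proof.
have [mM M0 HM] := condM j k.
have E : {ae P, forall w, M j k w = `|rate (alphac j w)|}.
  apply: (cond_mean_unique (A := alphac j) _ mM) => //.
    move=> _ B mB; exists ((fun a => `|rate a|) @^-1` B) => //.
    by rewrite -[X in measurable X]setTI; exact: mrateN.
  move=> B mB; rewrite -HM//.
  have mD : measurable (fst @^-1` B : set S).
    by rewrite -[X in measurable X]setTI; apply: measurable_fst.
  have m2 : measurable_fun (fst @^-1` B : set S) (fun v : S => ((v.2 k)%:R : R)%:E).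
    by apply/measurable_EFinP; apply: measurable_funTS; exact: measurable_coef_coord.
  have m1 : measurable_fun (fst @^-1` B : set S) (fun v : S => `|rate v.1|%:E).
    apply/measurable_EFinP; apply: measurable_funTS.
    by apply: (measurableT_comp mrateN).
  have E1 := @same_law_integral _ _ _ _ _ _ _ P P0 _ _ (mV j) mV0 (@law j)
     (fun v : S => ((v.2 k)%:R : R)%:E) _ mD m2 (fun _ _ => ler0n _ _).
  have E2 := @same_law_integral _ _ _ _ _ _ _ P P0 _ _ (mV j) mV0 (@law j)
     (fun v : S => `|rate v.1|%:E) _ mD m1 (fun _ _ => normr_ge0 _).
  etransitivity; first exact: E1.
  etransitivity; last by symmetry; exact: E2.
  etransitivity; first exact: (inar_cond_mean lambda0 inputs k mB).
  apply: eq_integral => w _ /=; rewrite ger0_norm//.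
  by case/andP: (a01 w) => _ h; rewrite ltW// stat_rate_gt0.
apply: filterS2 E (copy_alpha_lt1 j) => w -> h.
by rewrite ger0_norm// ltW// stat_rate_gt0.
Qed.

Definition displacement k (v : S) : R := (v.2 k)%:R - (v.2 0%N)%:R.
Definition trunc_term delta (v : S) : R := trunc_centered lambda delta v.1 (v.2 0%N).

Let mdisp k : measurable_fun setT (displacement k).
Proof. by apply: measurable_funB; exact: measurable_coef_coord. Qed.

Let mtrunc delta : measurable_fun setT (trunc_term delta).
Proof.
apply: measurable_funM.
  apply: measurable_funB; first exact: measurable_coef_coord.
  exact: (measurableT_comp mrate measurable_fst).
exact: (measurableT_comp (measurable_trunc_ind delta) measurable_fst).
Qed.

Definition disp_var k : R := \int[P0]_w ((X k w)%:R - (X 0 w)%:R) ^+ 2.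

Local Notation int f := (P.-integrable setT (EFin \o f)).

Lemma copy_displacement j k :
  [/\ int (fun w => displacement k (V j w) ^+ 2),
   \int[P]_w displacement k (V j w) = 0 &
   \int[P]_w displacement k (V j w) ^+ 2 = disp_var k].
Proof.
have [i2 E0] := inar_displacement lambda0 inputs k.
have m2 : measurable_fun setT (fun v => displacement k v ^+ 2) by exact: measurable_funX.
have [j2 F2] := same_law_integrable (mV j) mV0 (@law j) m2 i2.
split => //.
have i1 : P0.-integrable setT (EFin \o (displacement k \o V0)).
  apply: integrable_of_sq => //; exact: (measurableT_comp (mdisp k) mV0).
by have [_ ->] := same_law_integrable (mV j) mV0 (@law j) (mdisp k) i1.
Qed.

Local Notation tmean delta := (trunc_mean P0 alpha lambda delta).

Lemma copy_trunc delta j : 0 < delta ->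
  [/\ int (fun w => trunc_term delta (V j w) ^+ 4),
   \int[P]_w trunc_term delta (V j w) = 0,
   \int[P]_w trunc_term delta (V j w) ^+ 2 = tmean delta &
   \int[P]_w trunc_term delta (V j w) ^+ 4 <= (3 * lambda / delta + 1) * tmean delta].
Proof.
move=> dl0.
have [i4 E4] := trunc_moment4_le lambda0 inputs dl0 0.
have mt2 : measurable_fun setT (fun w => trunc_term delta (V0 w) ^+ 2).
  by apply: measurable_funX; exact: (measurableT_comp (mtrunc delta) mV0).
have i2 : P0.-integrable setT (EFin \o ((fun v => trunc_term delta v ^+ 2) \o V0)).
  apply: integrable_of_sq => //=.
  by under [Y in _.-integrable _ Y]eq_fun do rewrite /= -exprM.
have i1 : P0.-integrable setT (EFin \o (trunc_term delta \o V0)).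
  apply: integrable_of_sq => //=; exact: (measurableT_comp (mtrunc delta) mV0).
have m2 n : measurable_fun setT (fun v => trunc_term delta v ^+ n) by exact: measurable_funX.
have [j4 F4] := same_law_integrable (mV j) mV0 (@law j) (m2 4) i4.
have [_ F2] := same_law_integrable (mV j) mV0 (@law j) (m2 2) i2.
have [_ F1] := same_law_integrable (mV j) mV0 (@law j) (mtrunc delta) i1.
split => //.
- by rewrite F1; exact: trunc_mean0.
- by rewrite F2 /Rintegral trunc_moment2.
- by rewrite F4.
Qed.

Lemma copy_tail : exists2 eta : R, 0 < eta & forall delta j, 0 < delta < eta ->
  \int[P]_w (1 - trunc_ind delta (alphac j w)) <= (psi1 + 1) * delta.
Proof.
have [eta /andP[e0 _] tail] := tail_prob a01 dens psi_cvg.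
exists eta => // delta j dl; have [dl0 _] := andP dl.
have := tail _ dl.
have -> : [set w | 1 - delta < alpha w] = V0 @^-1` (fst @^-1` `]1 - delta, +oo[).
  by apply/seteqP; split => w /=; rewrite in_itv/= andbT.
rewrite -(@law j); last first.
  by rewrite -[X in measurable X]setTI; apply: measurable_fst => //; exact: measurable_itv.
have mE : measurable (alphac j @^-1` `]1 - delta, +oo[).
  by apply: measurable_preimage => //; exact: measurable_itv.
move=> h; rewrite -lee_fin; apply: le_trans h.
rewrite (_ : P _ = \int[P]_w (1 - trunc_ind delta (alphac j w))%:E)%E; last first.
  transitivity (\int[P]_w (\1_(alphac j @^-1` `]1 - delta, +oo[) w)%:E)%E.
    by rewrite integral_indic// setIT.
  apply: eq_integral => w _; rewrite indicE /trunc_ind; congr (_%:E).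
  case: leP => h; last by rewrite mem_set ?subr0//= in_itv/= h.
  by rewrite subrr memNset//= in_itv/= andbT; apply/negP; rewrite -leNgt.
rewrite /Rintegral fineK//; apply: integrable_fin_num => //.
apply: (@dominated_integrable _ _ _ _ _ (fun=> 1)).
- apply: measurable_funB => //.
  exact: (measurableT_comp (measurable_trunc_ind delta)).
- exact: integrable_cstR.
- move=> w; have /andP[h0 h1] := trunc_ind01 delta (alphac j w).
  by rewrite ger0_norm ?subr_ge0// lerBlDr lerDl.
Qed.


(** At N = 0 and N = 1 this is 0, as is the inverse of ln N, so the identities
    below hold for all N. *)
Definition scaling N : R := (N%:R * ln N%:R) `^ (- 2^-1).

Lemma scaling_sq N : scaling N ^+ 2 = (N%:R * ln N%:R)^-1.
Proof.
have x0 : 0 <= N%:R * ln N%:R :> R.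
  by case: N => [|N]; rewrite ?mul0r// mulr_ge0// ln_ge0// ler1n.
rewrite /scaling -powR_mulrn ?powR_ge0// -powRrM (_ : - 2^-1 * 2%:R = -1 :> R).
  by rewrite powR_inv1.
by rewrite mulNr mulVf.
Qed.

Lemma natmul_scaling_sq N : N%:R * scaling N ^+ 2 = (ln N%:R)^-1.
Proof.
rewrite scaling_sq; case: N => [|N]; first by rewrite mul0r ln0// invr0.
by rewrite invfM mulrA divff ?mul1r.
Qed.

(** The truncation level 1 / (b N), kept positive at N = 0. *)
Definition trunc_level (b : R) N : R := (b * N.-1.+1%:R)^-1.

Lemma trunc_level_gt0 b N : 0 < b -> 0 < trunc_level b N.
Proof. by move=> b0; rewrite invr_gt0 mulr_gt0. Qed.

Lemma trunc_mean_level_cvg b : 0 < b ->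
  tmean (trunc_level b N) / ln N%:R @[N --> \oo] --> lambda * psi1.
Proof.
move=> b0; have := trunc_mean_cvg malpha a01 lambda0 psi10 dens psi_cvg b0.
apply: cvg_trans; apply: near_eq_cvg; near=> N.
by rewrite /trunc_level prednK//; near: N; exact: nbhs_infty_gt.
Unshelve. all: by end_near. Qed.

Definition trunc_sum b N w := \sum_(j <- iota 0 N) scaling N * trunc_term (trunc_level b N) (V j w).

(** The row variance tends to lambda psi1.  The sum of the fourth moments is at most
    scaling^4 N (3 lambda b N + 1) times the truncated mean rate, that is, a
    convergent quantity times (3 lambda b + 1 / N) / ln N. *)
Lemma trunc_sum_cvg b (h : R -> R) C : 0 < b -> continuous h ->
  (forall x, `|h x| <= C) ->
  \int[P]_w h (trunc_sum b N w) @[N --> \oo] -->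
  \int[lebesgue_measure]_t (h t * normal_pdf 0 (Num.sqrt (lambda * psi1)) t).
Proof.
move=> b0 ch hC.
have lp0 : 0 < lambda * psi1 by rewrite mulr_gt0.
pose dl := trunc_level b; have dl0 N := trunc_level_gt0 N b0.
pose F N v := scaling N * trunc_term (dl N) v.
pose v N := scaling N ^+ 2 * tmean (dl N).
pose kap N := scaling N ^+ 4 * ((3 * lambda / dl N + 1) * tmean (dl N)).
have FX N n j : (fun w => F N (V j w) ^+ n) =
    (fun w => scaling N ^+ n * trunc_term (dl N) (V j w) ^+ n).
  by apply/funext => w; rewrite exprMn.
have i4 N j := let: And4 h _ _ _ := copy_trunc j (dl0 N) in h.
have mt N j : measurable_fun setT (fun w => trunc_term (dl N) (V j w)).
  exact: (measurableT_comp (mtrunc _) (mV j)).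
have i2 N j : int (fun w => trunc_term (dl N) (V j w) ^+ 2).
  apply: integrable_of_sq; first by apply: measurable_funX; exact: mt.
  by under [Y in _.-integrable _ Y]eq_fun do rewrite /= -exprM; exact: i4.
have i1 N j : int (fun w => trunc_term (dl N) (V j w)).
  by apply: integrable_of_sq; [exact: mt|exact: i2].
have s0 : 0 < Num.sqrt (lambda * psi1) by rewrite sqrtr_gt0.
have mF N : measurable_fun setT (F N) by exact: measurable_funM.
have tl := trunc_mean_level_cvg b0.
apply: (clt_array mV indep (F := F) (v := v) (kap := kap) mF _ _ _ _ s0 _ _ ch hC).
- by move=> N j; rewrite FX; apply: integrable_scaleR.
- move=> N j; rewrite RintegralZl//; have [_ -> _ _] := copy_trunc j (dl0 N).
  by rewrite mulr0.
- move=> N j; rewrite FX RintegralZl//; have [_ _ -> _] := copy_trunc j (dl0 N).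
  by [].
- move=> N j; rewrite FX RintegralZl//; have [_ _ _] := copy_trunc j (dl0 N).
  by move=> hle; rewrite ler_wpM2l// (exprM _ 2 2) sqr_ge0.
- rewrite sqr_sqrtr; last exact: ltW.
  under eq_fun do rewrite /v mulrA natmul_scaling_sq mulrC.
  exact: tl.
- have E : (tmean (dl N) / ln N%:R) * ((3 * lambda * b + N%:R^-1) * (ln N%:R)^-1)
     @[N --> \oo] --> lambda * psi1 * ((3 * lambda * b + 0) * 0).
    apply: cvgM => //; apply: cvgM; last exact: cvg_inv_ln_nat.
    apply: cvgD; first exact: cvg_cst.
    by rewrite gtr0_cvgV0; [exact: cvgr_idn|near=> N; rewrite ltr0n; near: N; exact: nbhs_infty_gt].
  rewrite mulr0 mulr0 in E; apply: cvg_trans E; apply: near_eq_cvg; near=> N.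
  have N1 : (1 < N)%N by near: N; exact: nbhs_infty_gt.
  have L0 : ln N%:R != 0 :> R by rewrite gt_eqF// ln_gt0// ltr1n.
  have N0 : N%:R != 0 :> R by rewrite pnatr_eq0 -lt0n ltnW.
  rewrite /kap (exprM _ 2 2) expr2 scaling_sq /dl.
  have -> : 3 * lambda / trunc_level b N = 3 * lambda * (b * N%:R).
    by rewrite /trunc_level prednK ?invrK// ltnW.
  move: (N%:R : R) N0 L0 (tmean _) => n n0; move: (ln n) => L L0 tm.
  by field; rewrite L0 n0.
Unshelve. all: by end_near. Qed.

Definition disp_sum k N w := \sum_(j <- iota 0 N) scaling N * displacement k (V j w).

(** The second moment of X_k - X_0 is finite, so its normalized sum over the
    copies is of order 1 / (ln N)^(1/2). *)
Lemma disp_sum_moment k N : int (fun w => disp_sum k N w ^+ 2) /\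
  \int[P]_w disp_sum k N w ^+ 2 = disp_var k / ln N%:R.
Proof.
have i1 j : int (fun w => displacement k (V j w)).
  apply: integrable_of_sq; first exact: (measurableT_comp (mdisp _) (mV j)).
  by have [] := copy_displacement j k.
have [//||||i2 _ E] := sum_moments mV indep (F := fun v => scaling N * displacement k v)
  (v := scaling N ^+ 2 * disp_var k) (measurable_funM _ (mdisp k)) _ _ _ (iota_uniq 0 N).
- move=> j; under [Y in _.-integrable _ Y]eq_fun do rewrite /= exprMn.
  by apply: integrable_scaleR; have [] := copy_displacement j k.
- by move=> j; rewrite RintegralZl//; have [_ -> _] := copy_displacement j k; rewrite mulr0.
- move=> j; under eq_Rintegral do rewrite exprMn.
  by have [i E0 E2] := copy_displacement j k; rewrite RintegralZl// E2.
split => //; rewrite E size_iota mulrA natmul_scaling_sq mulrC//.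
Qed.


Lemma trunc_sum_moment b N : 0 < b -> int (fun w => trunc_sum b N w ^+ 2) /\
  \int[P]_w trunc_sum b N w ^+ 2 = tmean (trunc_level b N) / ln N%:R.
Proof.
move=> b0; have dl0 := trunc_level_gt0 N b0; set dl := trunc_level b N in dl0 *.
have mt j : measurable_fun setT (fun w => trunc_term dl (V j w)).
  exact: (measurableT_comp (mtrunc _) (mV j)).
have i2 j : int (fun w => trunc_term dl (V j w) ^+ 2).
  apply: integrable_of_sq; first by apply: measurable_funX; exact: mt.
  under [Y in _.-integrable _ Y]eq_fun do rewrite /= -exprM.
  by have [] := copy_trunc j dl0.
have i1 j : int (fun w => trunc_term dl (V j w)).
  by apply: integrable_of_sq; [exact: mt|exact: i2].
have [//||||j2 _ E] := sum_moments mV indep (F := fun v => scaling N * trunc_term dl v)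
  (v := scaling N ^+ 2 * tmean dl) (measurable_funM _ (mtrunc dl)) _ _ _ (iota_uniq 0 N).
- by move=> j; under [Y in _.-integrable _ Y]eq_fun do rewrite /= exprMn; exact: integrable_scaleR.
- by move=> j; rewrite RintegralZl//; have [_ -> _ _] := copy_trunc j dl0; rewrite mulr0.
- move=> j; under eq_Rintegral do rewrite exprMn.
  by rewrite RintegralZl//; have [_ _ -> _] := copy_trunc j dl0.
by split => //; rewrite E size_iota mulrA natmul_scaling_sq mulrC.
Qed.

Section fixed_times.
Variables (n m : nat) (t : 'I_m -> {nonneg R}) (f : 'rV[R]_m -> R) (C : R).
Hypothesis n0 : (0 < n)%N.
Hypothesis cf : continuous f.
Hypothesis fC : forall x, `|f x| <= C.

Local Notation K i := (Num.truncn (n%:R * (t i)%:num)).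
Local Notation a i := ((K i)%:R / n%:R : R).
Local Notation Kmax := (\sum_i K i)%N.

Definition centered_sum N i w : R :=
  \sum_(1 <= k < (K i).+1) n%:R^-1 *
    \sum_(j <- iota 0 N) scaling N * ((Xc j k w)%:R - rate (alphac j w)).

Definition scaled_aggregate N i w : R :=
  n%:R^-1 * scaling N * aggregated (fun j k => Xc j k) M N n (t i) w.

Lemma scaled_aggregateE N :
  {ae P, forall w, forall i, scaled_aggregate N i w = centered_sum N i w}.
Proof.
have E : {ae P, forall w, forall j k, M j k w = rate (alphac j w)}.
  by apply: ae_foralln => j; apply: ae_foralln => k; exact: copy_cond_mean.
apply: filterS E => w E i; rewrite /scaled_aggregate /centered_sum /aggregated.
rewrite exchange_big/= mulr_sumr; apply: eq_bigr => k _.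
rewrite -mulrA; congr (_ * _); rewrite mulr_sumr.
rewrite -(big_mkord xpredT (fun j => scaling N * ((Xc j k w)%:R - M j k w))).
rewrite /index_iota subn0; apply: eq_bigr => j _; by rewrite E.
Qed.

(** When no copy is truncated, each time k contributes the sum at time 0 and a
    displacement. *)
Lemma centered_sumE b N i w :
  (forall j, (j < N)%N -> trunc_ind (trunc_level b N) (alphac j w) = 1) ->
  centered_sum N i w - a i * trunc_sum b N w =
  \sum_(1 <= k < (K i).+1) n%:R^-1 * disp_sum k N w.
Proof.
move=> h; have -> : a i * trunc_sum b N w =
    \sum_(1 <= k < (K i).+1) n%:R^-1 * trunc_sum b N w.
  by rewrite sumr_const_nat subn1/= -[RHS]mulr_natl mulrA.
rewrite /centered_sum -sumrB; apply: eq_bigr => k _; rewrite -mulrBr; congr (_ * _).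
rewrite /trunc_sum -sumrB; apply: eq_big_seq => j; rewrite mem_iota => /andP[_ jN].
by rewrite -mulrBr /trunc_term /trunc_centered /displacement /= h// mulr1; congr (_ * _); ring.
Qed.

Definition bad_terms b N w := \sum_(j <- iota 0 N) (1 - trunc_ind (trunc_level b N) (alphac j w)).
Definition disp_terms N w := \sum_(k <- iota 0 Kmax.+1) disp_sum k N w ^+ 2.

(** Either one of three events happens, and one of the terms multiplied by 2 C
    is at least 1: some copy is truncated, |U| > B, or some displacement sum is
    larger than eta / (Kmax + 1).  Or none does, and the finite-dimensional row
    is within eta of the line through (a_i) at the point U, where |U| <= B. *)
Lemma finite_dim_error b B eta e N w : 0 < B -> 0 < eta -> 0 < e ->
  (forall (u : R) (y : 'rV[R]_m), `|u| <= B ->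
     (forall i, `|y ord0 i - a i * u| <= eta) -> `|f y - f (\row_i (a i * u))| < e) ->
  `|f (\row_i centered_sum N i w) - f (\row_i (a i * trunc_sum b N w))| <=
  e + 2 * C * (bad_terms b N w + trunc_sum b N w ^+ 2 / B ^+ 2 +
     disp_terms N w / (eta / Kmax.+1%:R) ^+ 2).
Proof.
move=> B0 eta0 e0 near_line.
set eta' := eta / _; have eta'0 : 0 < eta' by rewrite divr_gt0.
have C0 : 0 <= C by exact: le_trans (fC 0).
have ind01 j : 0 <= trunc_ind (trunc_level b N) (alphac j w) <= 1 by exact: trunc_ind01.
have bad0 : 0 <= bad_terms b N w.
  by apply: sumr_ge0 => j _; rewrite subr_ge0; case/andP: (ind01 j).
have disp0 : 0 <= disp_terms N w by apply: sumr_ge0 => k _; exact: sqr_ge0.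
have T1 : 0 <= trunc_sum b N w ^+ 2 / B ^+ 2 by rewrite mulr_ge0// ?invr_ge0 sqr_ge0.
have T2 : 0 <= disp_terms N w / eta' ^+ 2 by rewrite mulr_ge0// invr_ge0 sqr_ge0.
have crude (x : R) : 1 <= x ->
    `|f (\row_i centered_sum N i w) - f (\row_i (a i * trunc_sum b N w))| <= e + 2 * C * x.
  move=> x1; apply: (@le_trans _ _ (C + C)).
    by rewrite (le_trans (ler_normB _ _))// lerD.
  have Cx : C <= C * x by rewrite ler_peMr.
  rewrite (_ : 2 * C * x = C * x + C * x); last by ring.
  by rewrite -[leLHS]add0r lerD ?(ltW e0)// lerD.
have [good|] := pselect (forall j, (j < N)%N -> trunc_ind (trunc_level b N) (alphac j w) = 1);
    last first.
  move=> /existsNP[j] /not_implyP[jN hj]; apply: crude.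
  rewrite -addrA -[leLHS]addr0 lerD ?addr_ge0//.
  rewrite /bad_terms (bigD1_seq j) ?iota_uniq ?mem_iota//=.
  rewrite (_ : trunc_ind _ (alphac j w) = 0); last first.
    by move: hj; rewrite /trunc_ind; case: (_ <= _).
  by rewrite subr0 lerDl sumr_ge0// => i _; rewrite subr_ge0; case/andP: (ind01 i).
have [UB|UB] := leP `|trunc_sum b N w| B; last first.
  apply: crude; rewrite -addrA addrCA -[leLHS]addr0 lerD ?addr_ge0//.
  rewrite ler_pdivlMr ?exprn_gt0// mul1r -[leRHS]real_normK ?num_real//.
  by rewrite ler_pXn2r ?nnegrE// ltW.
have [small|] := pselect (forall k, (k < Kmax.+1)%N -> `|disp_sum k N w| <= eta'); last first.
  move=> /existsNP[k] /not_implyP[kK /negP]; rewrite -ltNge => hk; apply: crude.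
  rewrite -[leLHS]add0r lerD ?addr_ge0//.
  rewrite ler_pdivlMr ?exprn_gt0// mul1r /disp_terms (bigD1_seq k) ?iota_uniq ?mem_iota//=.
  rewrite -[leLHS]addr0 lerD ?sumr_ge0// => [|i _]; last exact: sqr_ge0.
  by rewrite -[leRHS]real_normK ?num_real// ler_pXn2r ?nnegrE// ltW.
apply: (@le_trans _ _ e); last by rewrite lerDl !mulr_ge0// !addr_ge0.
apply/ltW/near_line => // i; rewrite mxE (centered_sumE _ good).
have KK : (K i <= Kmax)%N by rewrite (bigD1 i)//= leq_addr.
apply: (@le_trans _ _ (\sum_(1 <= k < (K i).+1) n%:R^-1 * eta')).
  apply: (le_trans (ler_norm_sum _ _ _)); apply: ler_sum_nat => k /andP[_ kK].
  rewrite normrM ger0_norm ?invr_ge0// ler_wpM2l ?invr_ge0//.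
  by apply: small; rewrite (leq_trans kK).
rewrite sumr_const_nat subn1/= -[leLHS]mulr_natr /eta'.
apply: (@le_trans _ _ (1 * (eta / Kmax.+1%:R) * Kmax.+1%:R)); last by rewrite mul1r divfK.
rewrite ler_pM ?mulr_ge0 ?invr_ge0 ?(ltW eta0) ?ler_nat ?(leqW KK)//.
by rewrite ler_wpM2r ?(ltW eta'0)// invf_le1 ?ler1n ?ltr0n.
Qed.


Let mind b N j : measurable_fun setT (fun w => 1 - trunc_ind (trunc_level b N) (alphac j w)).
Proof.
by apply: measurable_funB => //; exact: (measurableT_comp (measurable_trunc_ind _)).
Qed.

Let iind b N j : int (fun w => 1 - trunc_ind (trunc_level b N) (alphac j w)).
Proof.
apply: (@dominated_integrable _ _ _ _ _ (fun=> 1)).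
- exact: mind.
- exact: integrable_cstR.
- move=> w; have /andP[h0 h1] := trunc_ind01 (trunc_level b N) (alphac j w).
  by rewrite ger0_norm ?subr_ge0// lerBlDr lerDl.
Qed.

Let mcentered N i : measurable_fun setT (centered_sum N i).
Proof.
apply: measurable_sum => k; apply: measurable_funM => //.
apply: measurable_sum => j; apply: measurable_funM => //.
by apply: measurable_funB => //; exact: (measurableT_comp mrate).
Qed.

Let mtsum b N : measurable_fun setT (trunc_sum b N).
Proof.
apply: measurable_sum => j; apply: measurable_funM => //.
exact: (measurableT_comp (mtrunc _) (mV j)).
Qed.

Let bounded_int (g : T -> R) : measurable_fun setT g -> (forall w, `|g w| <= C) -> int g.
Proof. by move=> mg gC; apply: (dominated_integrable mg (integrable_cstR P C)). Qed.

(** Markov's and Chebyshev's inequalities in disguise: integrate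
    finite_dim_error. *)
Lemma fdd_copies_error b B eta e eta1 N : 0 < b -> 0 < B -> 0 < eta -> 0 < e ->
  (forall (u : R) (y : 'rV[R]_m), `|u| <= B ->
     (forall i, `|y ord0 i - a i * u| <= eta) -> `|f y - f (\row_i (a i * u))| < e) ->
  (forall delta j, 0 < delta < eta1 ->
     \int[P]_w (1 - trunc_ind delta (alphac j w)) <= (psi1 + 1) * delta) ->
  trunc_level b N < eta1 ->
  `|\int[P]_w f (\row_i centered_sum N i w) - \int[P]_w f (\row_i (a i * trunc_sum b N w))| <=
  e + 2 * C * ((psi1 + 1) / b + tmean (trunc_level b N) / ln N%:R / B ^+ 2 +
     (\sum_(k <- iota 0 Kmax.+1) disp_var k) / ln N%:R / (eta / Kmax.+1%:R) ^+ 2).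
Proof.
move=> b0 B0 eta0 e0 near_line tail lvl.
have C0 : 0 <= C by exact: le_trans (fC 0).
have mf1 : measurable_fun setT (fun w => f (\row_i centered_sum N i w)).
  by apply: measurable_row_comp => // i; exact: mcentered.
have mf2 : measurable_fun setT (fun w => f (\row_i (a i * trunc_sum b N w))).
  by apply: measurable_row_comp => // i; apply: measurable_funM => //; exact: mtsum.
have i1 := bounded_int mf1 (fun w => fC _).
have i2 := bounded_int mf2 (fun w => fC _).
rewrite -RintegralB//; apply: le_trans (le_normr_Rintegral _ _) _ => //.
  by have := integrableB measurableT i1 i2.
have [ib Eb] := Rintegral_sum_seq (iota 0 N) (iind b N).
have [iU EU] := trunc_sum_moment N b0.
have [iD ED] := Rintegral_sum_seq (iota 0 Kmax.+1) (fun k => (disp_sum_moment k N).1).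
have iU' : int (fun w => trunc_sum b N w ^+ 2 / B ^+ 2).
  by under [Y in _.-integrable _ Y]eq_fun do rewrite /= mulrC; exact: integrable_scaleR.
have iD' : int (fun w => disp_terms N w / (eta / Kmax.+1%:R) ^+ 2).
  by under [Y in _.-integrable _ Y]eq_fun do rewrite /= mulrC; exact: integrable_scaleR.
have i3 : int (fun w => bad_terms b N w + trunc_sum b N w ^+ 2 / B ^+ 2).
  exact: integrable_addR.
have i4 := integrable_addR i3 iD'.
have i5 := integrable_scaleR (2 * C) i4.
have ie := integrable_cstR P e.
apply: (@le_trans _ _ (\int[P]_w (e + 2 * C * (bad_terms b N w + trunc_sum b N w ^+ 2 / B ^+ 2 +
     disp_terms N w / (eta / Kmax.+1%:R) ^+ 2)))).
  apply: le_Rintegral => //.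
  - have := integrable_abse (integrableB measurableT i1 i2).
    by apply: eq_integrable => // w _.
  - exact: integrable_addR.
  - by move=> w _; exact: finite_dim_error.
rewrite RintegralD// Rintegral_cstP lerD2l RintegralZl// ler_wpM2l ?mulr_ge0//.
rewrite RintegralD// RintegralD// lerD//; last first.
  rewrite RintegralZr// ED ler_wpM2r ?invr_ge0 ?sqr_ge0// big_distrl/=.
  rewrite le_eqVlt; apply/orP; left; apply/eqP; apply: eq_bigr => k _.
  by rewrite (disp_sum_moment k N).2.
rewrite lerD//; last by rewrite RintegralZr// EU.
rewrite /bad_terms Eb.
apply: (@le_trans _ _ (\sum_(j <- iota 0 N) (psi1 + 1) * trunc_level b N)).
  by apply: ler_sum => j _; apply: tail; rewrite trunc_level_gt0.
rewrite big_const_seq count_predT size_iota iter_addr_0 -mulr_natr -mulrA ler_wpM2l ?addr_ge0 ?(ltW psi10)//.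
rewrite /trunc_level; case: N lvl {mf1 mf2 i1 i2 ib Eb iU EU iD ED iU' iD' i3 i4 i5} => [|N] _.
  by rewrite mulr0 invr_ge0 ltW.
by rewrite /= invfM -mulrA mulVf ?mulr1.
Qed.


Let mM j k : measurable_fun setT (M j k).
Proof. by apply: (preimage_measurable_fun (mac j)); have [] := condM j k. Qed.

Lemma measurable_scaled_aggregate N i : measurable_fun setT (scaled_aggregate N i).
Proof.
apply: measurable_funM => //; rewrite /aggregated.
apply: measurable_sum => j; apply: measurable_sum => k.
exact: measurable_funB.
Qed.

(** A fifth of the error is allowed to each of five sources: the truncated
    copies, which determine b; the event |U| > B, which determines B; the
    oscillation of f within eta of the line, which determines eta once B is
    fixed; and, both for large N only, the displacements and the replacement of
    the truncated sum by its normal limit. *)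
Lemma fdd_limit_copies :
  \int[P]_w f (\row_i scaled_aggregate N i w) @[N --> \oo] -->
  \int[lebesgue_measure]_u
    (f (\row_i (a i * u)) * normal_pdf 0 (Num.sqrt (lambda * psi1)) u).
Proof.
have C0 : 0 <= C by exact: le_trans (fC 0).
have lp0 : 0 < lambda * psi1 by rewrite mulr_gt0.
have ae_row N : \int[P]_w f (\row_i scaled_aggregate N i w) =
    \int[P]_w f (\row_i centered_sum N i w).
  rewrite /Rintegral; congr fine; apply: ae_eq_integral => //.
  - apply/measurable_EFinP; apply: measurable_row_comp => // i.
    exact: measurable_scaled_aggregate.
  - by apply/measurable_EFinP; apply: measurable_row_comp => // i; exact: mcentered.
  - apply: filterS (scaled_aggregateE N) => w E _; congr (f _)%:E.
    by apply/rowP => i; rewrite !mxE E.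
under eq_fun do rewrite ae_row.
apply/cvgrPdist_le => ep ep0.
pose e := ep / 5; have e0 : 0 < e by rewrite divr_gt0.
have [eta1 eta10 tail] := copy_tail.
have [C1 C10 CC1] : exists2 C1, 0 < C1 & C <= C1.
  by exists (C + 1); rewrite ?ltr_wpDl// lerDl.
pose b := 2 * C1 * (psi1 + 1) / e.
have b0 : 0 < b by rewrite divr_gt0// !mulr_gt0// ltr_wpDr.
pose B := 2 * C1 * (lambda * psi1 + 1) / e + 1.
have B0' : 0 < 2 * C1 * (lambda * psi1 + 1) / e by rewrite divr_gt0// !mulr_gt0// ltr_wpDr// ltW.
have B0 : 0 < B by rewrite ltr_wpDr.
have [eta eta0 near_line] := row_near_line (fun i => a i) B cf e0.
pose G := \sum_(k <- iota 0 Kmax.+1) disp_var k.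
have cD : 2 * C * (G / ln N%:R / (eta / Kmax.+1%:R) ^+ 2) @[N --> \oo] --> 0.
  have -> : (fun N : nat => 2 * C * (G / ln N%:R / (eta / Kmax.+1%:R) ^+ 2)) =
      (fun N : nat => 2 * C * G / (eta / Kmax.+1%:R) ^+ 2 * (ln N%:R)^-1).
    by apply/funext => N; rewrite -!mulrA; congr (_ * (_ * (_ * _))); rewrite mulrC.
  rewrite -[X in _ --> X](mulr0 (2 * C * G / (eta / Kmax.+1%:R) ^+ 2)).
  by apply: cvgM; [exact: cvg_cst|exact: cvg_inv_ln_nat].
have cU := @trunc_sum_cvg b _ C b0 (continuous_row_line (a := fun i => a i) cf) (fun x => fC _).
have cT := trunc_mean_level_cvg b0.
near=> N.
have lvl : trunc_level b N < eta1.
  have bN0 : 0 < b * N.-1.+1%:R by exact: mulr_gt0 b0 (ltr0Sn _ _).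
  rewrite /trunc_level invf_plt ?posrE//.
  rewrite -ltr_pdivrMl// prednK; last by near: N; exact: nbhs_infty_gt.
  by near: N; exact: nbhs_infty_gtr.
have err := fdd_copies_error b0 B0 eta0 e0 near_line tail lvl.
have h1 : `|\int[lebesgue_measure]_u
    (f (\row_i (a i * u)) * normal_pdf 0 (Num.sqrt (lambda * psi1)) u) -
    \int[P]_w f (\row_i (a i * trunc_sum b N w))| <= e.
  by near: N; move/cvgrPdist_le: cU; exact.
have h2 : 2 * C * (G / ln N%:R / (eta / Kmax.+1%:R) ^+ 2) <= e.
  apply: le_trans (ler_norm _) _; rewrite -[X in `|X|]subr0 distrC.
  by near: N; move/cvgrPdist_le: cD; exact.
have h3 : tmean (trunc_level b N) / ln N%:R <= lambda * psi1 + 1.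
  rewrite -lerBlDl; apply: le_trans (ler_norm _) _; rewrite distrC.
  by near: N; move/cvgrPdist_le: cT; exact.
have h4 : 2 * C * ((psi1 + 1) / b) <= e.
  apply: (@le_trans _ _ (2 * C1 * ((psi1 + 1) / b))).
    by rewrite ler_wpM2r ?ler_wpM2l// divr_ge0 ?(ltW b0)// addr_ge0// ltW.
  by rewrite mulrA ler_pdivrMr// /b [e * _]mulrC divfK// gt_eqF.
have h5 : 2 * C * (tmean (trunc_level b N) / ln N%:R / B ^+ 2) <= e.
  apply: (@le_trans _ _ (2 * C1 * ((lambda * psi1 + 1) / B ^+ 2))).
    apply: (@le_trans _ _ (2 * C * ((lambda * psi1 + 1) / B ^+ 2))).
      by rewrite ler_wpM2l ?mulr_ge0// ler_wpM2r ?invr_ge0 ?sqr_ge0.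
    rewrite ler_wpM2r ?ler_wpM2l// divr_ge0 ?sqr_ge0// addr_ge0// ltW//.
  rewrite mulrA ler_pdivrMr ?exprn_gt0//.
  apply: (@le_trans _ _ (e * B)).
    by rewrite [e * _]mulrC -ler_pdivrMr// /B lerDl.
  rewrite ler_wpM2l ?(ltW e0)// expr2 ler_peMl ?(ltW B0)// lerDr ltW//.
rewrite (le_trans (ler_distD (\int[P]_w f (\row_i (a i * trunc_sum b N w))) _ _))//.
rewrite (_ : ep = e + (e + (e + e + e))); last by rewrite /e; field.
rewrite lerD//; rewrite distrC; apply: le_trans err _.
rewrite lerD// !mulrDr !lerD//.
Unshelve. all: by end_near. Qed.

End fixed_times.

End copies.

(** * Normal limit and the limit in time *)

Lemma expectation_bounded {d} {T : measurableType d} {R : realType} (P : probability T R)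
    (g : T -> R) C : measurable_fun setT g -> (forall w, `|g w| <= C) ->
  'E_P[g]%E = (\int[P]_w g w)%:E.
Proof.
move=> mg gC; rewrite unlock /Rintegral fineK//; apply: integrable_fin_num => //.
exact: (dominated_integrable mg (integrable_cstR P C)).
Qed.

Section normal_limit.
Context {d} {T : measurableType d} {R : realType} (P : probability T R).
Variables (W : {RV P >-> R}) (s : R).

(** Adding the bound C makes the integrand nonnegative, as integral_weighted_eq
    requires; it contributes C on both sides. *)
Lemma normal_expectation (g : R -> R) C :
  (forall B, measurable B -> distribution P W B = normal_prob 0 s B) ->
  measurable_fun setT g -> (forall x, `|g x| <= C) ->
  \int[P]_w g (W w) = \int[lebesgue_measure]_u (g u * normal_pdf 0 s u).
Proof.
move=> lawW mg gC.
have mW : measurable_fun setT W by exact: measurable_funPT.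
have mgW : measurable_fun setT (fun w => g (W w)) by exact: measurableT_comp.
have mpdf : measurable_fun setT (normal_pdf 0 s : R -> R) by exact: measurable_normal_pdf.
have ipdf := integrable_normal_pdf 0 s.
have igW : P.-integrable setT (EFin \o (fun w => g (W w))).
  by apply: (dominated_integrable mgW (integrable_cstR P C)) => w; exact: gC.
have igpdf : lebesgue_measure.-integrable setT (EFin \o (fun u => g u * normal_pdf 0 s u)).
  have iC : lebesgue_measure.-integrable setT (EFin \o (fun u => C * normal_pdf 0 s u)).
    by have := integrableZl measurableT C ipdf; exact.
  apply: (le_integrable _ _ _ iC) => //.
    by apply/measurable_EFinP; exact: measurable_funM.
  move=> u _ /=; rewrite lee_fin !normrM ler_wpM2r//.
  by rewrite (le_trans (gC u))// ler_norm.
have g0 u : 0 <= g u + C by rewrite -lerBlDr sub0r; have := gC u; rewrite ler_norml => /andP[].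
have mgC : measurable_fun setT (fun u => g u + C) by exact: measurable_funD.
have E : (\int[P]_w ((g (W w) + C) * 1)%:E =
    \int[lebesgue_measure]_u ((g u + C) * normal_pdf 0 s u)%:E)%E.
  apply: (@integral_weighted_eq _ _ _ _ _ _ _ P lebesgue_measure W id (fun=> 1)
    (normal_pdf 0 s) mW _ _ _ _ _ _ (fun u => g u + C)) => //.
  - by move=> x; exact: normal_pdf_ge0.
  - move=> B mB; rewrite integral_cst//=; last by rewrite -[X in measurable X]setTI; exact: mW.
    by rewrite mul1e; exact: lawW.
have : \int[P]_w (g (W w) + C) = \int[lebesgue_measure]_u ((g u + C) * normal_pdf 0 s u).
  by rewrite /Rintegral -E; congr fine; apply: eq_integral => w _; rewrite mulr1.
rewrite RintegralD//; last exact: integrable_cstR.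
under [RHS]eq_Rintegral do rewrite mulrDl.
have iC : lebesgue_measure.-integrable setT (EFin \o (fun u => C * normal_pdf 0 s u)).
  by have := integrableZl measurableT C ipdf; exact.
rewrite RintegralD// RintegralZl// Rintegral_cstP.
rewrite (_ : \int[lebesgue_measure]_u normal_pdf 0 s u = 1); last first.
  by rewrite /Rintegral integral_normal_pdf.
by rewrite mulr1 => /addIr.
Qed.

Lemma measurable_scaled_rv (c : R) : measurable_fun setT (fun w => W w * c).
Proof. by apply: measurable_funM => //; exact: measurable_funPT. Qed.

Definition scaled_rv (c : R) : {RV P >-> R} :=
  HB.pack (fun w => W w * c)
    (isMeasurableFun.Build _ _ _ _ (fun w => W w * c) (measurable_scaled_rv c)).

(** floor(n t) / n differs from t by at most 1 / n, uniformly in the times. *)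
Lemma fdd_limit_time_grid (m : nat) (t : 'I_m -> {nonneg R}) (f : 'rV[R]_m -> R) C :
  continuous f -> (forall x, `|f x| <= C) ->
  ('E_P[fun w => f (\row_i (W w * ((Num.truncn (n%:R * (t i)%:num))%:R / n%:R)))%R]
    @[n --> \oo] --> 'E_P[fun w => f (\row_i (W w * (t i)%:num))%R])%E.
Proof.
move=> cf fC; rewrite unlock.
apply: (@dominated_cvg _ _ _ P setT measurableT _ _ (fun=> C%:E)) => //.
- move=> n; apply/measurable_EFinP; apply: measurable_row_comp => // i.
  exact: measurable_scaled_rv.
- move=> w _; apply: cvg_EFin; first by near=> n.
  apply: continuous_cvg; first exact: cf.
  apply/cvgrPdist_le => e e0; near=> n; apply/row_mx_norm_le; first exact: ltW.
  have n0 : 0 < n%:R :> R by rewrite ltr0n; near: n; exact: nbhs_infty_gt.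
  move=> i; rewrite !mxE -mulrBr normrM.
  have /andP[h1 h2] : (Num.truncn (n%:R * (t i)%:num))%:R <= n%:R * (t i)%:num
      < (Num.truncn (n%:R * (t i)%:num)).+1%:R by rewrite truncn_itv// mulr_ge0.
  apply: (@le_trans _ _ (`|W w| * n%:R^-1)).
    rewrite ler_wpM2l// ger0_norm; last by rewrite subr_ge0 ler_pdivrMr// [leRHS]mulrC.
    rewrite lerBlDl -[X in _ + X]mul1r -mulrDl ler_pdivlMr// [leLHS]mulrC ltW//.
    by rewrite natr1.
  rewrite ler_pdivrMr// -ler_pdivrMl// mulrC.
  by near: n; exact: nbhs_infty_ger.
- exact: integrable_cstR.
- by move=> n w _; rewrite /= lee_fin.
Unshelve. all: by end_near. Qed.

End normal_limit.

Theorem theorem4p9 (R : realType) (lambda beta psi1 : R) (psi : R -> R)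
    (d0 : measure_display) (T0 : measurableType d0) (P0 : probability T0 R)
    (alpha : {RV P0 >-> R}) (X0 : {RV P0 >-> nat})
    (xi : nat -> nat -> {RV P0 >-> nat}) (eps : nat -> {RV P0 >-> nat})
    (d : measure_display) (T : measurableType d) (P : probability T R)
    (alphac : nat -> {RV P >-> R}) (Xc : nat -> nat -> {RV P >-> nat})
    (M : nat -> nat -> T -> R)
    (dW : measure_display) (TW : measurableType dW) (PW : probability TW R)
    (W : {RV PW >-> R}) :
  0 < lambda ->
  0 < psi1 ->
  has_density_on P0 alpha `]0, 1[ (fun x => psi x * (1 - x) `^ beta) ->
  psi x @[x --> 1^'-] --> psi1 ->
  randomized_inar1_inputs lambda alpha X0 xi eps ->
  (forall j, same_law
     P (coef_trajectory (alphac j) (fun k => Xc j k))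
     P0 (coef_trajectory alpha (inar1 X0 (fun k j => xi k j) eps))) ->
  mutually_independent P
    (fun j => coef_trajectory (alphac j) (fun k => Xc j k)) ->
  (forall j k, is_cond_expectation P (alphac j) (fun w => (Xc j k w)%:R) (M j k)) ->
  (forall B : set R, measurable B ->
     distribution PW W B = normal_prob 0 (Num.sqrt (lambda * psi1)) B) ->
  beta = 0 ->
  iterated_fdd_lim P
    (fun N n t w =>
       n%:R^-1 * (N%:R * ln N%:R) `^ (- 2^-1) *
       aggregated (fun j k => Xc j k) M N n t w)
    PW (fun t w => W w * t%:num).
Proof.
move=> l0 p0 + psi_cvg inputs law indep condM lawW beta0; rewrite beta0 => dens.
exists (fun=> dW), (fun=> TW), (fun=> PW),
  (fun n t => scaled_rv W ((Num.truncn (n%:R * t%:num))%:R / n%:R)).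
split; last by move=> m t f cf [C fC]; exact: fdd_limit_time_grid.
move=> n n0 m t f cf [C fC].
have L := fdd_limit_copies l0 p0 dens psi_cvg inputs law indep condM (t := t) n0 cf fC.
have mY N i := measurable_scaled_aggregate condM n t N i.
have E1 N := expectation_bounded P
  (measurable_row_comp cf (mY N)) (fun w => fC _).
have mW i : measurable_fun setT (scaled_rv W ((Num.truncn (n%:R * (t i)%:num))%:R / n%:R)).
  exact: measurable_scaled_rv.
have E2 := expectation_bounded PW (measurable_row_comp cf mW) (fun w => fC _).
rewrite E2.
rewrite (_ : (fun N => _) = (fun N : nat => (\int[P]_w f (\row_i scaled_aggregate Xc M n t N i w))%:E)); last first.
  by apply/funext => N; exact: E1.
apply: cvg_EFin; first by near=> N.
rewrite (_ : \int[PW]_w _ = \int[lebesgue_measure]_u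
   (f (\row_i ((Num.truncn (n%:R * (t i)%:num))%:R / n%:R * u)) *
    normal_pdf 0 (Num.sqrt (lambda * psi1)) u)); first exact: L.
rewrite -(normal_expectation (W := W) (C := C) lawW)//.
  by apply: eq_Rintegral => w _; congr f; apply/rowP => i; rewrite !mxE; exact: mulrC.
apply: continuous_measurable_fun; exact: continuous_row_line.
Unshelve. all: by end_near. Qed.
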